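(* Let $\gamma\ge 0$, $\alpha>0$, $\mu\in\mathbb{R}$ with $\delta:=\alpha(\mu+1)-\gamma>0$, and let $g(x):=x^{\gamma}(x^\alpha+1)^{-\mu-1}$. (1) Suppose $(\gamma,\alpha)\not\in\mathbb{Z}_+\times\mathbb{N}$, and put $r=[\gamma]$ if $\gamma\not\in\mathbb{Z}_+$, and $r=\gamma+[\alpha]$ if $\gamma\in\mathbb{Z}_+$ and $\alpha\not\in\mathbb{Z}_+$. Then $g\in C^{r}[0,+\infty)$, $g\not\in C^{r+1}[0,+\infty)$, and for every integer $n\in[0,r]$ the function $g^{(n)}$ is absolutely continuous on $[0,+\infty)$. If $\gamma\not\in\mathbb{Z}_+$, then $g^{(p)}(0)=0$ for every integer $p\in[0,r]$. If $\gamma\in\mathbb{Z}_+$ and $\alpha\not\in\mathbb{N}$, then $g^{(p)}(0)=0$ for every integer $p\in[0,r]$, $p\ne\gamma$, and $g^{(\gamma)}(0)=\gamma!$. Furthermore, for every integer $n\in[0,r]$: $g\in C^n[0,+\infty)$, $g^{(n)}$ is of bounded variation on $[0,+\infty)$, and $g^{(k)}(+\infty)=0$ for $0\le k\le n$. If in addition $\delta>1$, then also $g\in L[0,+\infty)$. (2) Suppose $(\gamma,\alpha)\in\mathbb{Z}_+\times\mathbb{N}$. Then $g\in C^{\infty}(-1,+\infty)$, and for every $q\in(-1,0)$ and every $n\in\mathbb{Z}_+$: $g\in C^n[q,+\infty)$, $g^{(n)}$ is of bounded variation on $[q,+\infty)$, $g^{(k)}(+\infty)=0$ for $0\le k\le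 n$, and $g^{(n)}$ is absolutely continuous on $[q,+\infty)$. Furthermore, for every fixed $u\in\mathbb{R}$, $$\tilde{S}(t,u,\gamma,\alpha,\mu)\sim\sum_{k=0}^{\infty}\frac{(-1)^{k(\alpha+1)+\gamma}}{t^{\alpha(k+\mu+1)}}\cdot\frac{\Gamma(\mu+k+1)\,E_{k\alpha+\gamma}(-u)}{\Gamma(\mu+1)\Gamma(k+1)},\qquad t\to+\infty .$$ If in addition $\delta>1$, then also $g\in L[q,+\infty)$ for every $q\in(-1,0)$, and for every fixed $u\in\mathbb{R}$, $$S(t,u,\gamma,\alpha,\mu)\sim\frac{1}{t^{\alpha(\mu+1)-\gamma-1}}\cdot\frac{2}{\alpha}\,B\left(\frac{\gamma+1}{\alpha},\mu+1-\frac{\gamma+1}{\alpha}\right)+\sum_{k=0}^{\infty}\frac{(-1)^{k(\alpha+1)+\gamma}}{t^{\alpha(k+\mu+1)}}\cdot\frac{2\,\Gamma(\mu+k+1)}{\Gamma(\mu+1)\Gamma(k+1)}\cdot\frac{B_{k\alpha+\gamma+1}(-u)}{k\alpha+\gamma+1},\qquad t\to+\infty .$$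
   Context: $\mathbb{N}=\{1,2,\dots\}$, $\mathbb{Z}_+=\{0,1,2,\dots\}$; $[x]$ is the integer part; $x^0=1$, including $0^0=1$. $B(\cdot,\cdot)$ with two arguments is the Euler Beta function. $B_n(x)$ and $E_n(x)$ are the Bernoulli and Euler polynomials: $\frac{te^{tx}}{e^t-1}=\sum_{n\ge0}\frac{t^n}{n!}B_n(x)$, $\frac{2e^{tx}}{e^t+1}=\sum_{n\ge0}\frac{t^n}{n!}E_n(x)$. The generalized Mathieu series are $$S(t,u,\gamma,\alpha,\mu):=\sum_{k=1}^{\infty}\frac{2(k+u)^{\gamma}}{((k+u)^{\alpha}+t^{\alpha})^{\mu+1}}\quad(\delta>1),\qquad \tilde S(t,u,\gamma,\alpha,\mu):=\sum_{k=1}^{\infty}\frac{2(-1)^{k-1}(k+u)^{\gamma}}{((k+u)^{\alpha}+t^{\alpha})^{\mu+1}}\quad(\delta>0).$$ For $u>-1$ they are considered for $t\ge0$. When $(\gamma,\alpha)\in\mathbb{Z}_+\times\mathbb{N}$ and $u\le -1$, the same formulas are used for all sufficiently large $t$ (namely $t>-1-u$), where all terms are defined. $L[a,+\infty)$ is the space of Lebesgue integrable functions on $[a,+\infty)$; $g^{(k)}(+\infty)=\lim_{x\to+\infty}g^{(k)}(x)$; $g^{(0)}=g$. Absolutely continuous on $[a,+\infty)$ means absolutely continuous on every compact subinterval (here in addition to bounded variation on $[a,+\infty)$). The symbol $\sim$ denotes an asymptotic expansion in the sense of Poincaré: for every $N\in\mathbb{Z}_+$, the difference between the left side and the right side with the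 sum truncated at $k=N$ is $o(t^{-\alpha(N+\mu+1)})$ as $t\to+\infty$. *)

(* Defs.v *)
From HB Require Import structures.
From mathcomp Require Import all_boot all_order all_algebra.
From mathcomp Require Import all_classical all_reals all_analysis.
Set Implicit Arguments.
Unset Strict Implicit.
Unset Printing Implicit Defensive.
Import Order.TTheory GRing.Theory Num.Theory.
Import numFieldNormedType.Exports.
Local Open Scope classical_set_scope.
Local Open Scope ring_scope.

(* Real power: for a natural exponent this is the algebraic power, meaningful
   for negative bases too (the library's powR is not); 0 ^ 0 = 1 both ways. *)
Definition rpow (R : realType) (x y : R) : R :=
  if y \is a Num.nat then x ^+ Num.truncn y else x `^ y.

(* Derivative relative to the set A: difference quotients are taken within A
   only, so it is the one-sided derivative at an endpoint of an interval A and
   does not depend on values of f outside A. *)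
Definition rquot (R : realType) (f : R -> R) (x y : R) : R :=
  (f y - f x) / (y - x).

Definition rderivable (R : realType) (A : set R) (f : R -> R) (x : R) : Prop :=
  cvg (rquot f x y @[y --> within A x^']).

Definition rderive (R : realType) (A : set R) (f : R -> R) (x : R) : R :=
  lim (rquot f x y @[y --> within A x^']).

Definition rderiven (R : realType) (A : set R) (n : nat) (f : R -> R) : R -> R :=
  iter n (rderive A) f.

Definition Cn (R : realType) (A : set R) (n : nat) (f : R -> R) : Prop :=
  (forall k x, (k < n)%N -> A x -> rderivable A (rderiven A k f) x) /\
  (forall k, (k <= n)%N -> {within A, continuous (rderiven A k f)}).

Definition bounded_variation_ray (R : realType) (a : R) (f : R -> R) : Prop :=
  exists M : R, forall b, a <= b -> (total_variation a b f <= M%:E)%E.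

(* s lists finitely many non-overlapping subintervals [p.1, p.2] of [a, b]. *)
Definition abs_continuous (R : realType) (a b : R) (f : R -> R) : Prop :=
  forall e : R, 0 < e -> exists2 d : R, 0 < d &
    forall s : seq (R * R),
      all (fun p => (a <= p.1) && (p.1 <= p.2) && (p.2 <= b)) s ->
      pairwise (fun p q => (p.2 <= q.1) || (q.2 <= p.1)) s ->
      \sum_(p <- s) (p.2 - p.1) < d ->
      \sum_(p <- s) `|f p.2 - f p.1| < e.

Definition abs_continuous_ray (R : realType) (a : R) (f : R -> R) : Prop :=
  (forall b c, a <= b -> b <= c -> abs_continuous b c f) /\
  bounded_variation_ray a f.

Definition in_L_ray (R : realType) (a : R) (f : R -> R) : Prop :=
  (@lebesgue_measure R).-integrable `[a, +oo[ (EFin \o f).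

(* Euler integrals, used for positive arguments only. *)
Definition Gamma (R : realType) (x : R) : R :=
  Rintegral (@lebesgue_measure R) `]0, +oo[ (fun t => t `^ (x - 1) * expR (- t)).

Definition Beta (R : realType) (x y : R) : R :=
  Rintegral (@lebesgue_measure R) `]0, 1[
    (fun t => t `^ (x - 1) * (1 - t) `^ (y - 1)).

(* The families B_n(x) and E_n(x), n in nat, are determined by their generating
   functions near 0 (the first one has a removable singularity at 0). *)
Definition is_Bernoulli (R : realType) (B : nat -> R -> R) : Prop :=
  forall x : R, \forall t \near (0 : R)^',
    series (fun n => t ^+ n / n`!%:R * B n x) @ \oo -->
      t * expR (t * x) / (expR t - 1).

Definition is_Euler (R : realType) (E : nat -> R -> R) : Prop :=
  forall x : R, \forall t \near (0 : R)^',
    series (fun n => t ^+ n / n`!%:R * E n x) @ \oo -->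
      2 * expR (t * x) / (expR t + 1).

Section Mathieu.
Variables (R : realType) (t u gamma alpha mu : R).

Definition mathieu_term (k : nat) : R :=
  2 * rpow (k%:R + u) gamma /
    (rpow (k%:R + u) alpha + rpow t alpha) `^ (mu + 1).

Definition mathieu_psum (n : nat) : R := \sum_(1 <= k < n.+1) mathieu_term k.

Definition alt_mathieu_psum (n : nat) : R :=
  \sum_(1 <= k < n.+1) (-1) ^+ k.-1 * mathieu_term k.

Definition mathieu : R := limn mathieu_psum.

Definition alt_mathieu : R := limn alt_mathieu_psum.

End Mathieu.

Definition gfun (R : realType) (gamma alpha mu x : R) : R :=
  rpow x gamma * (rpow x alpha + 1) `^ (- mu - 1).

Definition smooth_order (R : realType) (gamma alpha : R) : nat :=
  if gamma \is a Num.nat then (Num.truncn gamma + Num.truncn alpha)%N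
  else Num.truncn gamma.

Definition little_o_pinfty (R : realType) (f h : R -> R) : Prop :=
  forall eps : R, 0 < eps -> \forall t \near +oo, `|f t| <= eps * `|h t|.

(* Poincare expansion of f at +oo: psum N is the expansion truncated at k = N,
   whose last term has order t ^ (- e N). *)
Definition asymptotic_expansion (R : realType) (f : R -> R)
    (psum : nat -> R -> R) (e : nat -> R) : Prop :=
  forall N : nat,
    little_o_pinfty (fun t => f t - psum N t) (fun t => t `^ (- e N)).

(* Main.v *)
Require Import Defs.
From HB Require Import structures.
From mathcomp Require Import all_boot all_order all_algebra.
From mathcomp Require Import all_classical all_reals all_analysis.
From mathcomp Require Import measurable_realfun.
From mathcomp Require Import ring lra zify.
Import Order.TTheory GRing.Theory Num.Theory.
Import numFieldNormedType.Exports.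
Local Open Scope classical_set_scope.
Local Open Scope ring_scope.
Set Implicit Arguments.
Unset Strict Implicit.
Unset Printing Implicit Defensive.

(** Regularity.  As [mu + 1 > 0], differentiating [x ^ p (x ^ al + 1) ^ (- nu)]
    gives two products of the same form, so on the open half line the [n]-th
    derivative of [g] is a combination of
    [x ^ (ga - n + i al) (x ^ al + 1) ^ (- (mu + 1 + i))] with [i <= n].  Each of
    these is of order [x ^ (- delta - n)] at infinity; all that matters at [0] is
    the set of exponents [ga - n + i al] with a nonzero coefficient.  They are
    nonnegative for [n <= r], whence continuous one-sided derivatives at [0], and
    the smallest one lies strictly between [-1] and [0] for [n = r + 1], whence a
    derivative that is unbounded near [0] ([gfun_not_Cn]).  Bounded variation and absolute
    continuity of the [n]-th derivative follow because the next one is dominated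
    by the derivative of the bounded increasing function [- (1 + x ^ b) ^ (-1)]
    for a small [b > 0] ([abs_continuous_ray_of_derive]).  For natural exponents
    the derivatives are a polynomial times a power of [x ^ a + 1] for all
    [x > -1].

    Expansions.  With [h = 1 / t] the terms of the series are
    [t ^ (- delta) 2 g (h (k + u))], so the question is the behaviour of sums of
    [g] over a grid of step [h].  Let [e_j = (-1) ^ j E_j (- u) / j!], the
    coefficients of [2 exp (s (1 + u)) / (1 + exp s)], and
    [Phi_k = sum_(j <= M) e_j h ^ j g^(j) (h k)].  The recursion that expresses
    multiplication by [1 + exp s] turns Taylor's formula into
    [Phi_k + Phi_(k+1) = 2 g (h (k + 1 + u)) + O (h ^ (M+1) / (1 + h k) ^ 2)].
    The alternating sum of the left sides telescopes to [Phi_0], and the errors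
    add up to [O (h ^ M)] ([summation_formula], [Boole_summation]).  Finally
    [Phi_0] involves only the Taylor coefficients of [g] at [0], which the
    binomial series provides ([sum_gder_nat_taylor]).  The series without signs is
    treated in the same way with [exp s - 1] instead of [1 + exp s] and the
    primitive of [g] that vanishes at infinity in the place of [g]
    ([Euler_Maclaurin_summation]); the value of this primitive at [0] is
    the opposite of the integral of [g], which the substitution
    [s = x ^ a / (1 + x ^ a)] makes a Beta integral ([Beta_primitive]).

    The recursions for [e_j] come from the generating functions: truncating all
    power series at order [M] leaves a polynomial that is [O (s ^ M)] near [0],
    so that its coefficients below [M] vanish ([generating_recursion]). *)

(** * Relative derivatives, bounded variation and absolute continuity *)

Lemma near_dnbhsP (R : realType) (x : R) (P : R -> Prop) :
  (\forall y \near x^', P y) <->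
  exists2 d, 0 < d & forall y, `|y - x| < d -> y != x -> P y.
Proof.
split.
  move=> /nbhs_ballP[d /= d0 H]; exists d => // y yx yN; apply: H => //.
  by rewrite /ball /= distrC.
move=> [d d0 H]; apply/nbhs_ballP; exists d => //= y; rewrite /ball /= distrC.
exact: H.
Qed.

Lemma is_derive_rquot (R : realType) (A : set R) (f : R -> R) (x l : R) :
  is_derive x 1 f l -> rquot f x y @[y --> within A x^'] --> l.
Proof.
move=> [df fl]; apply: cvg_within_filter.
have : h^-1 *: (f (h *: 1 + x) - f x) @[h --> 0^'] --> l.
  by rewrite -fl; exact: df.
move=> /cvgrPdist_lt H; apply/cvgrPdist_lt => e e0.
have /near_dnbhsP[d d0 Hd] := H _ e0; apply/near_dnbhsP; exists d => // y yd yx.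
have := Hd (y - x); rewrite subr0 => /(_ yd); rewrite subr_eq0 => /(_ yx).
by rewrite /rquot /GRing.scale /= mulr1 subrK mulrC.
Qed.

(** Difference quotients at a point of such a set can be taken to the right, so
    that limits within the set are unique. *)
Definition upclosed (R : realType) (A : set R) :=
  forall x y, A x -> x <= y -> A y.

Lemma upclosed_within_proper (R : realType) (A : set R) (x : R) :
  upclosed A -> A x -> ProperFilter (within A x^').
Proof.
move=> uA Ax; apply: Build_ProperFilter_ex => P.
rewrite /within /= => /near_dnbhsP[d d0 H].
exists (x + d / 2); apply: H; last by apply: uA Ax _; lra.
  by rewrite addrC addKr gtr0_norm; lra.
by rewrite gt_eqF//; lra.
Qed.

Lemma rquot_cvg_ext (R : realType) (A : set R) (f F : R -> R) (x l : R) :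
  A x -> (forall y, A y -> f y = F y) ->
  rquot F x y @[y --> within A x^'] --> l ->
  rquot f x y @[y --> within A x^'] --> l.
Proof.
move=> Ax fF; apply: cvg_trans.
apply: near_eq_cvg; rewrite near_withinE; near=> y => Ay.
by rewrite /rquot !fF.
Unshelve. all: by end_near. Qed.

Lemma rderive_of_rquot (R : realType) (A : set R) (f F : R -> R) (x l : R) :
  upclosed A -> A x -> (forall y, A y -> f y = F y) ->
  rquot F x y @[y --> within A x^'] --> l -> rderive A f x = l.
Proof.
move=> uA Ax fF dF; have pf := upclosed_within_proper uA Ax.
by apply: cvg_lim => //; exact: rquot_cvg_ext dF.
Qed.

(** Iterated relative derivatives are computed once a sequence of functions is
    known whose difference quotients converge to the next one; values outside
    [A], where iterated derivatives are arbitrary, never enter. *)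
Lemma rderiven_of_rquot (R : realType) (A : set R) (f : R -> R) (F : nat -> R -> R)
    (n : nat) : upclosed A ->
  (forall x, A x -> f x = F 0%N x) ->
  (forall k x, (k < n)%N -> A x ->
     rquot (F k) x y @[y --> within A x^'] --> F k.+1 x) ->
  forall k x, (k <= n)%N -> A x -> rderiven A k f x = F k x.
Proof.
move=> uA f0 dF; elim=> [|k IH] x kn Ax; first exact: f0.
by apply: rderive_of_rquot (dF k x kn Ax) => // y Ay; apply: IH => //; exact: ltnW.
Qed.

Lemma Cn_of_rquot (R : realType) (A : set R) (f : R -> R) (F : nat -> R -> R)
    (n : nat) : upclosed A ->
  (forall x, A x -> f x = F 0%N x) ->
  (forall k x, (k < n)%N -> A x ->
     rquot (F k) x y @[y --> within A x^'] --> F k.+1 x) ->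
  (forall k, (k <= n)%N -> {within A, continuous (F k)}) ->
  Cn A n f.
Proof.
move=> uA f0 dF cF; have E := rderiven_of_rquot uA f0 dF; split.
  move=> k x kn Ax; rewrite /rderivable; apply/cvg_ex; exists (F k.+1 x).
  by apply: rquot_cvg_ext (dF k x kn Ax) => // y Ay; apply: E => //; exact: ltnW.
move=> k kn; apply: subspace_eq_continuous (cF k kn) => x; rewrite inE => Ax.
by apply: esym; exact: E.
Qed.

Lemma is_derive_cts (R : realType) (f : R -> R) (x l : R) :
  is_derive x 1 f l -> {for x, continuous f}.
Proof.
by move=> [df _]; apply/differentiable_continuous/derivable1_diffP.
Qed.

Lemma within_ray_segment (R : realType) (q : R) (f : R -> R) :
  {within `[q, +oo[, continuous f} ->
  forall b c, q <= b -> {within `[b, c], continuous f}.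
Proof.
move=> cf b c qb; apply: continuous_subspaceW cf => x /=.
by rewrite !in_itv /= andbT => /andP[/(le_trans qb)].
Qed.

Lemma nondecr_of_derive (R : realType) (f df : R -> R) (a b : R) :
  a <= b -> (forall x, a < x < b -> is_derive x 1 f (df x)) ->
  (forall x, a < x < b -> 0 <= df x) ->
  {within `[a, b], continuous f} -> f a <= f b.
Proof.
rewrite le_eqVlt => /predU1P[->//|ab] dfx df0 cf.
have [c] := @MVT R f df a b ab dfx cf; rewrite in_itv /= => cab E.
by rewrite -subr_ge0 E mulr_ge0// ?df0// subr_ge0 ltW.
Qed.

(** The mean value inequality, in the form where the bound is itself an increment:
    both [h + f] and [h - f] are nondecreasing. *)
Lemma increment_le_of_derive (R : realType) (f df h dh : R -> R) (a b : R) :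
  a <= b -> (forall x, a < x < b -> is_derive x 1 f (df x)) ->
  (forall x, a < x < b -> is_derive x 1 h (dh x)) ->
  (forall x, a < x < b -> `|df x| <= dh x) ->
  {within `[a, b], continuous f} -> {within `[a, b], continuous h} ->
  `|f b - f a| <= h b - h a.
Proof.
move=> ab Df Dh le cf ch; rewrite ler_norml; apply/andP; split.
  have : h a + f a <= h b + f b.
    apply: (@nondecr_of_derive _ (h + f) (fun x => dh x + df x)) => //.
    - by move=> x xab; apply: is_deriveD; [exact: Dh|exact: Df].
    - by move=> x /le; rewrite ler_norml => /andP[? ?]; lra.
    - exact: within_continuousD.
  by move=> ?; lra.
have : h a - f a <= h b - f b.
  apply: (@nondecr_of_derive _ (h - f) (fun x => dh x - df x)) => //.
  - by move=> x xab; apply: is_deriveB; [exact: Dh|exact: Df].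
  - by move=> x /le; rewrite ler_norml => /andP[? ?]; lra.
  - exact: within_continuousB.
by move=> ?; lra.
Qed.

Definition dominated_by (R : realType) (q : R) (f h : R -> R) :=
  forall x y, q <= x -> x <= y -> `|f y - f x| <= h y - h x.

Lemma dominated_bounded_variation (R : realType) (q M : R) (f h : R -> R) :
  dominated_by q f h -> (forall x, q <= x -> h x - h q <= M) ->
  bounded_variation_ray q f.
Proof.
move=> dfh hM; exists M => b qb; apply: ge_ereal_sup => _ [v + <-].
move=> [s /[dup] ps [ps1 /eqP ps2] <-]; rewrite lee_fin; apply: le_trans (hM _ qb).
rewrite variation_zip//.
have H a : q <= a -> path <%R a s -> last a s = b ->
    \sum_(x <- zip s (a :: s)) `|f x.1 - f x.2| <= h b - h a.
  elim: s a {ps ps1 ps2} => [a _ _ /= ->|y s IH x qx /=].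
    by rewrite big_nil subrr.
  case/andP => xy py lb; rewrite big_cons /=.
  have := IH y (le_trans qx (ltW xy)) py lb.
  by have := dfh x y qx (ltW xy) => ? ?; lra.
exact: H.
Qed.

(** Removing one interval splits the others into those before it and those after
    it, so the sum is bounded by induction on the number of intervals. *)
Lemma nonoverlap_sum_le (R : realType) (k : R -> R) (b c : R) (s : seq (R * R)) :
  b <= c -> (forall x y, b <= x -> x <= y -> y <= c -> k x <= k y) ->
  all (fun p => (b <= p.1) && (p.1 <= p.2) && (p.2 <= c)) s ->
  pairwise (fun p q => (p.2 <= q.1) || (q.2 <= p.1)) s ->
  \sum_(p <- s) (k p.2 - k p.1) <= k c - k b.
Proof.
have [n] := ubnP (size s); elim: n s b c => // n IH [|p s] b c.
  by move=> _ bc kk _ _; rewrite big_nil subr_ge0 kk.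
rewrite /= !ltnS => sn bc kk /andP[/andP[/andP[bp pp] pc]] As /andP[Ps pw].
rewrite big_cons (bigID (fun q : R * R => q.2 <= p.1)) /=.
(* the intervals before [p] and those after it *)
pose s1 := [seq q <- s | q.2 <= p.1]; pose s2 := [seq q <- s | ~~ (q.2 <= p.1)].
have H1 : \sum_(q <- s1) (k q.2 - k q.1) <= k p.1 - k b.
  apply: IH => //.
  - by apply: leq_ltn_trans sn; rewrite size_filter count_size.
  - by move=> x y bx xy yp; apply: kk => //; apply: le_trans yp (le_trans pp pc).
  - rewrite all_filter; apply: sub_all As => q /= /andP[/andP[-> ->] _].
    by apply/implyP.
  - exact: pairwise_filter.
have H2 : \sum_(q <- s2) (k q.2 - k q.1) <= k c - k p.2.
  apply: IH => //.
  - by apply: leq_ltn_trans sn; rewrite size_filter count_size.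
  - by move=> x y bx xy yp; apply: kk => //; apply: le_trans bx; exact: le_trans pp.
  - rewrite all_filter; apply/allP => q qs /=.
    move: (allP As q qs) (allP Ps q qs) => /= /andP[/andP[_ ->] ->].
    by rewrite andbT; case: (leP q.2 p.1) => //=; rewrite orbF.
  - exact: pairwise_filter.
have -> : \sum_(i <- s | ~~ (i.2 <= p.1)) (k i.2 - k i.1) =
          \sum_(q <- s2) (k q.2 - k q.1) by rewrite big_filter.
have -> : \sum_(i <- s | i.2 <= p.1) (k i.2 - k i.1) =
          \sum_(q <- s1) (k q.2 - k q.1) by rewrite big_filter.
have := kk p.1 p.2 bp pp pc; lra.
Qed.

(** A monotone part of small total increment controls any family of disjoint
    intervals whatever its length, a Lipschitz part a family of small length. *)
Lemma abs_continuous_split (R : realType) (b c : R) (f : R -> R) :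
  b <= c ->
  (forall e, 0 < e -> exists k : R -> R, exists2 L : R, 0 <= L &
    [/\ forall x y, b <= x -> x <= y -> y <= c -> k x <= k y,
        k c - k b < e &
        forall x y, b <= x -> x <= y -> y <= c ->
          `|f y - f x| <= k y - k x + L * (y - x)]) ->
  abs_continuous b c f.
Proof.
move=> bc H e e0; have [|k [L L0 [kk ke fk]]] := H (e / 2); first by lra.
exists (e / 2 / (L + 1)); first by rewrite !divr_gt0//; lra.
move=> s As Ps; rewrite ltr_pdivlMr; last by lra.
move=> Hs; apply: (@le_lt_trans _ _ (\sum_(p <- s) (k p.2 - k p.1) + L * \sum_(p <- s) (p.2 - p.1))).
  rewrite mulr_sumr -big_split /= big_seq [leRHS]big_seq; apply: ler_sum => p ps.
  by move: (allP As p ps) => /andP[/andP[? ?] ?]; exact: fk.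
have := nonoverlap_sum_le bc kk As Ps.
have : 0 <= \sum_(p <- s) (p.2 - p.1).
  rewrite big_seq sumr_ge0// => p ps.
  by move: (allP As p ps) => /andP[/andP[? ?] ?]; rewrite subr_ge0.
nra.
Qed.

Lemma abs_continuous_ray_ext (R : realType) (q : R) (f1 f2 : R -> R) :
  (forall x, q <= x -> f1 x = f2 x) ->
  abs_continuous_ray q f2 -> abs_continuous_ray q f1.
Proof.
move=> E [ac [M bv]]; split.
  move=> b c qb bc e e0; have [d d0 Hd] := ac b c qb bc e e0.
  exists d => // s As Ps ls; apply: le_lt_trans (Hd s As Ps ls).
  rewrite big_seq [leRHS]big_seq; apply: ler_sum => p ps.
  have /andP[/andP[h1 h2] h3] := allP As p ps.
  have q1 := le_trans qb h1; have q2 := le_trans q1 h2.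
  by rewrite !E.
exists M => b qb; apply: le_trans (bv b qb); apply: ge_ereal_sup => _ [v + <-].
move=> [s ps <-]; apply: ereal_sup_ubound => /=.
exists (variation q b f2 s); first exact: variations_variation.
congr EFin; case: ps => ps _; have : forall x, x \in q :: s -> q <= x.
  move=> x; rewrite inE => /predU1P[->//|xs]; apply: ltW.
  by move: ps; rewrite lt_path_sortedE => /andP[/allP /(_ x xs)].
move=> qs; rewrite /variation !big_nat; apply: eq_bigr => i /andP[_ si] /=.
rewrite -[nth b s i]/(nth b (q :: s) i.+1).
by rewrite !E//; apply: qs; apply: mem_nth => //=; exact: ltnW.
Qed.

Lemma is_derive_ext (R : realType) (f g : R -> R) (x df dg : R) :
  is_derive x 1 f df -> f =1 g -> df = dg -> is_derive x 1 g dg.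
Proof. by move=> Df /funext <- <-. Qed.

(** Up to the factor [b], the derivative of [sigmoid b]: of order [x ^ (b - 1)] at
    [0] and [x ^ (- b - 1)] at infinity, which is what is needed to dominate an
    integrable algebraic singularity and an algebraic decay at once. *)
Definition sigmoid_slope (R : realType) (b y : R) := y `^ (b - 1) / (1 + y `^ b) ^+ 2.

Definition sigmoid (R : realType) (b x : R) : R := - (1 + x `^ b)^-1.

Lemma onepowR_gt0 (R : realType) (b x : R) : 0 < 1 + x `^ b.
Proof. by have := powR_ge0 x b; lra. Qed.

Lemma is_derive_sigmoid (R : realType) (b x : R) : 0 < x ->
  is_derive x 1 (sigmoid b) (b * sigmoid_slope b x).
Proof.
rewrite /sigmoid_slope => x0; have p0 := onepowR_gt0 b x.
have D1 : is_derive x 1 (fun y : R => 1 + y `^ b) (b * x `^ (b - 1)).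
  by have := is_deriveD (@is_derive_cst R R R 1 x 1) (is_derive1_powR b x0); rewrite add0r.
apply: (is_derive_ext (is_deriveN
  (@is_deriveV _ (fun y : R => 1 + y `^ b) x _ _ (lt0r_neq0 p0) D1))) => //.
rewrite /GRing.scale /= mulNr opprK.
by rewrite mulrC mulrA.
Qed.

Lemma sigmoid_cts (R : realType) (b : R) : 0 < b ->
  {within `[0, +oo[, continuous (sigmoid b)}.
Proof.
move=> b0; apply/continuous_within_itvcyP; split.
  move=> x; rewrite in_itv /= andbT => x0.
  exact: is_derive_cts (is_derive_sigmoid b x0).
rewrite /sigmoid powR0 ?gt_eqF// addr0; apply: cvgN; apply: cvgV; first exact: oner_neq0.
rewrite -[X in _ --> X]addr0; apply: cvgD; first exact: cvg_cst.
exact: powR_cvg0.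
Qed.

Lemma sigmoid_bounds (R : realType) (b x : R) : -1 <= sigmoid b x <= 0.
Proof.
have p0 := onepowR_gt0 b x; rewrite /sigmoid lerN2 oppr_le0 invr_ge0 (ltW p0) andbT.
by rewrite invf_le1// lerDl powR_ge0.
Qed.

Lemma within_ray_shift (R : realType) (q : R) (f : R -> R) :
  {within `[0, +oo[, continuous f} ->
  {within `[q, +oo[, continuous (fun x => f (x - q))}.
Proof.
move=> /subspace_continuousP H; apply/subspace_continuousP => x /=.
rewrite in_itv /= andbT => qx.
have /H : `[0, +oo[%classic (x - q) by rewrite /= in_itv /= subr_ge0 qx.
move=> /cvgrPdist_lt H1; apply/cvgrPdist_lt => e /H1.
rewrite /within /= => /nbhs_ballP[d /= d0 Hd].
apply/nbhs_ballP; exists d => //= y xy qy; apply: Hd.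
  by move: xy; rewrite /ball /= opprB addrA subrK.
by move: qy; rewrite !in_itv /= !andbT subr_ge0.
Qed.

(** The increments of [f] are bounded by those of a multiple of [sigmoid b].
    These are small near [q] by continuity, whereas beyond any point to the right
    of [q] the function is Lipschitz, its slope being nonincreasing for
    [b <= 1]. *)
Lemma abs_continuous_ray_of_derive (R : realType) (q b C : R) (f df : R -> R) :
  0 < b -> b <= 1 ->
  {within `[q, +oo[, continuous f} ->
  (forall x, q < x -> is_derive x 1 f (df x)) ->
  (forall x, q < x ->
    `|df x| <= C * sigmoid_slope b (x - q)) ->
  abs_continuous_ray q f.
Proof.
move=> b0 b1 cf Df le.
have ker0 (x : R) : 0 < x -> 0 < sigmoid_slope b x.
  by move=> x0; rewrite /sigmoid_slope divr_gt0// ?powR_gt0// exprn_gt0// onepowR_gt0.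
have C0 : 0 <= C.
  have q1 : q < q + 1 by lra.
  have := le_trans (normr_ge0 _) (le _ q1).
  by rewrite pmulr_lge0// ker0//; lra.
pose h x := C / b * sigmoid b (x - q).
have Dh x : q < x ->
    is_derive x 1 h (C * sigmoid_slope b (x - q)).
  move=> qx; have xq : 0 < x - q by rewrite subr_gt0.
  have D1 : is_derive x 1 (fun y : R => y - q) 1.
    by have := is_deriveB (@is_derive_id R R x 1) (@is_derive_cst R R R q x 1); rewrite subr0.
  apply: (is_derive_ext (is_deriveZ (C / b)
    (@is_derive1_comp _ (sigmoid b) (fun y : R => y - q) _ _ _ (is_derive_sigmoid b xq) D1))) => //.
  by rewrite /GRing.scale /= mulr1 [LHS]mulrA divfK// gt_eqF.
have ch : {within `[q, +oo[, continuous h}.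
  have cs := within_ray_shift (q := q) (sigmoid_cts b0).
  by move=> z; apply: cvgM; [exact: cvg_cst|exact: cs].
have dfh : dominated_by q f h.
  move=> x y qx xy.
  have qz (z : R) : x < z < y -> q < z by move=> /andP[xz _]; exact: le_lt_trans xz.
  exact: (increment_le_of_derive xy (fun z xzy => Df z (qz z xzy))
    (fun z xzy => Dh z (qz z xzy)) (fun z xzy => le z (qz z xzy))
    (@within_ray_segment _ _ _ cf _ _ qx) (@within_ray_segment _ _ _ ch _ _ qx)).
have hmono x y : q <= x -> x <= y -> h x <= h y.
  by move=> qx xy; rewrite -subr_ge0 (le_trans _ (dfh x y qx xy)).
have Cb : 0 <= C / b by rewrite divr_ge0// ltW.
split; last first.
  apply: (@dominated_bounded_variation _ _ (C / b) _ h) => // x qx.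
  rewrite /h -mulrBr ler_piMr//.
  by have /andP[? ?] := sigmoid_bounds b (x - q); have /andP[? ?] := sigmoid_bounds b (q - q); lra.
move=> b' c qb bc; apply: abs_continuous_split => // e e0.
(* [m] separates the part where [h] varies little from the one where it is
   Lipschitz *)
have [m qm hm] : exists2 m, q < m & h m - h q < e.
  have /continuous_within_itvcyP[_ /cvgrPdist_lt /(_ e e0) H] := ch.
  have /filter_ex[m [qm]] : \forall x \near q^'+, q < x /\ `|h q - h x| < e.
    by apply: filterI; [exact: nbhs_right_gt|exact: H].
  rewrite distrC => /(le_lt_trans (ler_norm _)) ?; by exists m.
exists (fun x => h (Num.min x m)), (C * (m - q) `^ (b - 1)).
  by rewrite mulr_ge0// powR_ge0.
have mq : 0 < m - q by rewrite subr_gt0.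
have Lip x y : m <= x -> x <= y -> h y - h x <= C * (m - q) `^ (b - 1) * (y - x).
  move=> mx xy; apply: le_trans (ler_norm _) _.
  rewrite [leRHS]mulrBr; pose L := C * (m - q) `^ (b - 1).
  have DL (z : R) : is_derive z 1 (fun t : R => L * t) L.
    apply: (is_derive_ext (is_deriveZ L (@is_derive_id R R z 1))) => //.
    by rewrite /GRing.scale /= mulr1.
  have Dh' (z : R) : x < z < y ->
      is_derive z 1 h (C * sigmoid_slope b (z - q)).
    by move=> /andP[xz _]; apply: Dh; apply: lt_le_trans qm (le_trans mx (ltW xz)).
  have le' (z : R) : x < z < y ->
      `|C * sigmoid_slope b (z - q)| <= L.
    move=> /andP[xz _]; have mz := le_lt_trans mx xz.
    have qz : 0 < z - q by rewrite subr_gt0 (lt_trans qm).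
    rewrite ger0_norm; last by rewrite mulr_ge0// ltW// ker0.
    rewrite /L ler_wpM2l// /sigmoid_slope ler_pdivrMr ?exprn_gt0 ?onepowR_gt0//.
    have zb : (z - q) `^ (b - 1) <= (m - q) `^ (b - 1).
      rewrite -[b - 1]opprB !powRN lef_pV2 ?posrE ?powR_gt0//.
      by apply: ge0_ler_powR; rewrite ?nnegrE; lra.
    apply: le_trans zb _; rewrite ler_peMr ?powR_ge0// exprn_ege1//.
    by rewrite lerDl powR_ge0.
  have ch' : {within `[x, y], continuous h}.
    by apply: within_ray_segment ch _ _ _; exact: le_trans (ltW qm) mx.
  have cL : {within `[x, y], continuous (fun t : R => L * t)}.
    by apply: continuous_subspaceT => z; exact: is_derive_cts (DL z).
  exact: (increment_le_of_derive xy Dh' (fun z _ => DL z) le' ch' cL).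
have L0 : 0 <= C * (m - q) `^ (b - 1) by rewrite mulr_ge0// powR_ge0.
split.
- move=> x y bx xy _; apply: hmono.
    by rewrite le_min (ltW qm) (le_trans qb bx).
  by rewrite le_min ge_min xy ge_min lexx orbT.
- apply: le_lt_trans hm; apply: lerB.
    by apply: hmono; [rewrite le_min (ltW qm) (le_trans qb bc)|rewrite ge_min lexx orbT].
  by apply: hmono => //; rewrite le_min (ltW qm) qb.
- move=> x y bx xy yc; have qx := le_trans qb bx.
  apply: le_trans (dfh x y qx xy) _.
  have [ym|my] := leP y m.
    rewrite !min_l// ?(le_trans xy)// lerDl mulr_ge0// subr_ge0//.
  have [xm|mx] := leP x m.
    have := Lip m y (lexx _) (ltW my).
    have : C * (m - q) `^ (b - 1) * (y - m) <= C * (m - q) `^ (b - 1) * (y - x).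
      by rewrite ler_wpM2l//; lra.
    lra.
  by have := Lip x y (ltW mx) xy; lra.
Unshelve. all: by end_near. Qed.

(** By the mean value theorem.  This gives the derivatives at the endpoint [0],
    where real powers have none in the two-sided sense. *)
Lemma rquot_right_of_derive_cvg (R : realType) (q l : R) (f df : R -> R) :
  {within `[q, +oo[, continuous f} ->
  (forall x, q < x -> is_derive x 1 f (df x)) ->
  df x @[x --> q^'+] --> l ->
  rquot f q y @[y --> within `[q, +oo[ q^'] --> l.
Proof.
move=> cf Df /cvgrPdist_lt H; apply/cvgrPdist_lt => e /H.
rewrite -[(q)^'+]/(within _ _) /within /= => /nbhs_ballP[d /= d0 Hd].
apply/near_dnbhsP; exists d => // y yd yq; rewrite in_itv /= andbT => qy.
have {}qy : q < y by rewrite lt_neqAle eq_sym yq.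
have Df' x : x \in `]q, y[ -> is_derive x 1 f (df x).
  by rewrite in_itv /= => /andP[qx _]; exact: Df.
have [c] := @MVT _ f df q y qy Df' (@within_ray_segment _ _ _ cf q y (lexx q)).
  rewrite in_itv /= => /andP[qc cy] E.
rewrite /rquot E mulfK ?subr_eq0//; apply: Hd => //.
rewrite /ball /= distrC gtr0_norm ?subr_gt0//.
by move: yd; rewrite gtr0_norm ?subr_gt0//; lra.
Qed.

(** * Products of powers [x ^ p (x ^ al + 1) ^ (- nu)] *)

Lemma cvg_sumr (R : realType) (T I : Type) (F : set_system T) {FF : Filter F}
    (r : seq I) (f : I -> T -> R) (l : I -> R) :
  (forall i, f i x @[x --> F] --> l i) ->
  \sum_(i <- r) f i x @[x --> F] --> \sum_(i <- r) l i.
Proof.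
move=> H; elim: r => [|i r IH].
  rewrite big_nil; under eq_fun do rewrite big_nil; exact: cvg_cst.
by rewrite big_cons; under eq_fun do rewrite big_cons; exact: cvgD.
Qed.

Lemma powRD_gt0 (R : realType) (r s x : R) : 0 < x ->
  x `^ (r + s) = x `^ r * x `^ s.
Proof. by move=> x0; rewrite powRD// (gt_eqF x0) implybT. Qed.

Definition pterm (R : realType) (al p nu x : R) : R :=
  x `^ p * (x `^ al + 1) `^ (- nu).

Lemma powR1_gt0 (R : realType) (al x : R) : 0 < x `^ al + 1.
Proof. by have := powR_ge0 x al; lra. Qed.

Lemma is_derive_pterm (R : realType) (al p nu x : R) : 0 < x ->
  is_derive x 1 (pterm al p nu)
    (p * pterm al (p - 1) nu x
     - nu * al * pterm al (p + al - 1) (nu + 1) x).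
Proof.
move=> x0; have y0 := powR1_gt0 al x.
have D1 : is_derive x 1 (fun y : R => y `^ al + 1) (al * x `^ (al - 1)).
  by have := is_deriveD (is_derive1_powR al x0) (@is_derive_cst R R R 1 x 1); rewrite addr0.
have D2 := @is_derive1_comp _ (fun y : R => y `^ (- nu)) (fun y : R => y `^ al + 1)
   _ _ _ (is_derive1_powR (- nu) y0) D1.
apply: (is_derive_ext (is_deriveM (is_derive1_powR p x0) D2)) => //.
rewrite /GRing.scale /= /pterm (opprD nu 1).
have -> : p + al - 1 = p + (al - 1) by rewrite addrA.
by rewrite (powRD_gt0 p (al - 1) x0); ring.
Qed.

Lemma pterm_cvg0 (R : realType) (al p nu : R) : 0 < al -> 0 <= p ->
  pterm al p nu x @[x --> 0^'+] --> (0 : R) `^ p.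
Proof.
move=> al0 p0; rewrite -[X in _ --> X]mulr1; apply: cvgM.
  move: p0; rewrite le_eqVlt => /predU1P[<-|p0].
    by under eq_fun do rewrite powRr0; rewrite powRr0; exact: cvg_cst.
  by rewrite powR0 ?gt_eqF//; exact: powR_cvg0.
have c1 : {for (1 : R), continuous (fun y : R => y `^ (- nu))}.
  by apply: is_derive_cts; apply: is_derive1_powR.
have H1 : x `^ al + 1 @[x --> 0^'+] --> (1 : R).
  rewrite -[X in _ --> X]add0r.
  by apply: cvgD; [exact: powR_cvg0|exact: cvg_cst].
by have := continuous_cvg _ c1 H1; rewrite /= powR1; apply.
Qed.

Lemma powR_le1 (R : realType) (x p : R) : 0 < x -> x <= 1 -> 0 <= p -> x `^ p <= 1.
Proof.
by move=> x0 x1 p0; rewrite -(powRr0 x); apply: ger_powR => //; rewrite x0 x1.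
Qed.

Lemma powRN_le1 (R : realType) (x p : R) : 1 <= x -> 0 <= p -> x `^ (- p) <= 1.
Proof.
by move=> x1 p0; rewrite -(powRr0 x); apply: ler_powR => //; rewrite oppr_le0.
Qed.

Lemma pterm_ge0 (R : realType) (al p nu x : R) : 0 <= pterm al p nu x.
Proof. by rewrite mulr_ge0 ?powR_ge0. Qed.

Lemma powRN_anti (R : realType) (x y p : R) : 0 < x -> x <= y -> 0 <= p ->
  y `^ (- p) <= x `^ (- p).
Proof.
move=> x0 xy p0; have y0 := lt_le_trans x0 xy.
rewrite !powRN lef_pV2 ?posrE ?powR_gt0//.
by apply: ge0_ler_powR; rewrite ?nnegrE// ltW.
Qed.

Lemma pterm_le_large (R : realType) (al p nu x : R) : 1 <= x -> 0 <= nu ->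
  pterm al p nu x <= x `^ (p - al * nu).
Proof.
move=> x1 nu0; have x0 : 0 < x by exact: lt_le_trans x1.
rewrite /pterm powRD_gt0// -mulrN powRrM ler_wpM2l ?powR_ge0//.
by apply: powRN_anti; rewrite ?powR_gt0//; lra.
Qed.

(** Compare the two sides separately for [x <= 1], where [x ^ (p - b) <= 1], and
    for [x >= 1], where [(x ^ al + 1) ^ (- nu) <= x ^ (- al nu)]. *)
Lemma pterm_le_slope (R : realType) (al p nu b x : R) :
  0 < b -> b <= p -> p + b <= al * nu -> 0 < nu -> 0 < al -> 0 < x ->
  pterm al (p - 1) nu x <= 4 * sigmoid_slope b x.
Proof.
move=> b0 bp pb nu0 al0 x0; rewrite /sigmoid_slope.
rewrite mulrA ler_pdivlMr ?exprn_gt0 ?onepowR_gt0//.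
have xb := onepowR_gt0 b x.
have pbs : pterm al (p - 1) nu x = x `^ (b - 1) * pterm al (p - b) nu x.
  rewrite /pterm mulrA -powRD_gt0//.
  by congr (_ `^ _ * _); ring.
rewrite pbs -mulrA mulrC ler_wpM2r ?powR_ge0//.
have [x1|x1] := leP x 1.
  have p1 : pterm al (p - b) nu x <= 1.
    rewrite /pterm; apply: mulr_ile1; rewrite ?powR_ge0//.
      by apply: powR_le1 => //; lra.
    by apply: powRN_le1; [rewrite lerDr powR_ge0|exact: ltW].
  have : (1 + x `^ b) ^+ 2 <= 4.
    have : x `^ b <= 1 by apply: powR_le1 => //; exact: ltW.
    have := powR_ge0 x b; nra.
  have := pterm_ge0 al (p - b) nu x; have : 0 <= (1 + x `^ b) ^+ 2 by exact: sqr_ge0.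
  nra.
have x1' := ltW x1.
have H1 := pterm_le_large al (p - b) x1' (ltW nu0).
have H2 : (1 + x `^ b) ^+ 2 <= 4 * x `^ (b + b).
  rewrite powRD_gt0//.
  have : 1 <= x `^ b by rewrite -(powRr0 x); apply: ler_powR => //; exact: ltW.
  nra.
apply: le_trans (ler_pM (pterm_ge0 _ _ _ _) (sqr_ge0 _) H1 H2) _.
rewrite mulrCA -powRD_gt0// -[leRHS]mulr1 ler_wpM2l//.
have -> : p - b - al * nu + (b + b) = - (al * nu - p - b) by ring.
by apply: powRN_le1; lra.
Qed.

Lemma powRN_cvgy (R : realType) (s : R) : 0 < s -> x `^ (- s) @[x --> +oo] --> 0.
Proof.
move=> s0; apply/cvgrPdist_lt => e e0; near=> x.
have x0 : 0 < x by near: x; exact: nbhs_pinfty_gt.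
rewrite sub0r normrN ger0_norm ?powR_ge0// powRN invf_plt ?posrE ?powR_gt0//.
have -> : e^-1 = (e^-1 `^ s^-1) `^ s.
  by rewrite -powRrM mulVf ?gt_eqF// powRr1// invr_ge0 ltW.
apply: gt0_ltr_powR; rewrite ?nnegrE ?powR_ge0// ?(ltW x0)//.
Unshelve. all: by end_near. Qed.

Lemma pterm_cvgy (R : realType) (al p nu : R) : 0 <= nu -> p < al * nu ->
  pterm al p nu x @[x --> +oo] --> 0.
Proof.
move=> nu0 pn.
have H : x `^ (- (al * nu - p)) @[x --> +oo] --> 0.
  by apply: powRN_cvgy; rewrite subr_gt0.
apply: (squeeze_cvgr _ (cvg_cst (0 : R)) H).
near=> x; rewrite pterm_ge0 /= opprB; apply: pterm_le_large => //.
Unshelve. all: by end_near. Qed.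

(** * The derivatives of [g] on the half line *)

Lemma upclosed_itvcy (R : realType) (q : R) : upclosed `[q, +oo[%classic.
Proof.
by move=> x y /=; rewrite !in_itv /= !andbT; exact: le_trans.
Qed.

Lemma rpow_powR (R : realType) (x y : R) : 0 <= x -> rpow x y = x `^ y.
Proof.
move=> x0; rewrite /rpow; case: ifPn => // /truncnK {2}<-.
by rewrite powR_mulrn.
Qed.

Section HalfLine.
Context (R : realType) (ga al mu : R).
Hypothesis ga0 : 0 <= ga.
Hypothesis al0 : 0 < al.
Hypothesis de0 : 0 < al * (mu + 1) - ga.

(** The coefficient of [x ^ (ga - n + i al) (x ^ al + 1) ^ (- (mu + 1 + i))] in the
    [n]-th derivative of [g]. *)
Fixpoint gcoef (n i : nat) : R :=
  if n is m.+1 then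
    (ga - m%:R + i%:R * al) * gcoef m i +
    (if i is j.+1 then - ((mu + 1 + j%:R) * al * gcoef m j) else 0)
  else (i == 0%N)%:R.

(** At [x = 0] this is still the right value, as long as negative exponents only
    occur with coefficient [0]: the power of [0] vanishes for a nonzero exponent
    and is [1] for the exponent [0]. *)
Definition gder_ray (n : nat) (x : R) : R :=
  \sum_(i < n.+1) gcoef n i *
    pterm al (ga - n%:R + i%:R * al) (mu + 1 + i%:R) x.

Lemma mu1_gt0 : 0 < mu + 1.
Proof.
have : 0 < al * (mu + 1) by move: ga0 de0; lra.
by rewrite pmulr_rgt0.
Qed.

Lemma nu_gt0 (i : nat) : 0 < mu + 1 + i%:R.
Proof. by have := mu1_gt0; have := ler0n R i; lra. Qed.

Lemma gcoef_gt n i : (n < i)%N -> gcoef n i = 0.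
Proof.
elim: n i => [|n IH] [|i]//= ni; first by rewrite (IH i.+1) ?mulr0 ?(IH i) ?mulr0 ?oppr0 ?addr0// ltnW.
Qed.

Lemma gder_ray0 x : gder_ray 0 x = pterm al ga (mu + 1) x.
Proof. by rewrite /gder_ray big_ord1 /= mul1r mul0r subr0 !addr0. Qed.

Lemma gfun_gder_ray0 (x : R) : 0 <= x -> gfun ga al mu x = gder_ray 0 x.
Proof.
move=> x0; rewrite gder_ray0 /gfun !rpow_powR// /pterm.
by congr (_ * _ `^ _); ring.
Qed.

Lemma is_derive_gder_ray n (x : R) : 0 < x -> is_derive x 1 (gder_ray n) (gder_ray n.+1 x).
Proof.
move=> x0.
pose p i := ga - n%:R + i%:R * al.
pose T i : R -> R := fun y => gcoef n i * pterm al (p i) (mu + 1 + i%:R) y.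
pose U i := pterm al (ga - n.+1%:R + i%:R * al) (mu + 1 + i%:R) x.
have DT (i : 'I_n.+1) : is_derive x 1 (T i)
    (p i * gcoef n i * U i - (mu + 1 + i%:R) * al * gcoef n i * U i.+1).
  apply: (is_derive_ext (is_deriveZ (gcoef n i)
    (is_derive_pterm al (p i) (mu + 1 + i%:R) x0))) => //.
  have E1 : p i - 1 = ga - n.+1%:R + i%:R * al by rewrite /p -natr1; ring.
  have E2 : p i + al - 1 = ga - n.+1%:R + i.+1%:R * al.
    by rewrite /p -[n.+1%:R]natr1 -[i.+1%:R]natr1; ring.
  have E3 : mu + 1 + i%:R + 1 = mu + 1 + i.+1%:R by rewrite -natr1 addrA.
  by rewrite E1 E2 E3 /GRing.scale /= /U; ring.
apply: (is_derive_ext (is_derive_sum DT)) => [y|]; first by rewrite fct_sumE.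
have -> : gder_ray n.+1 x = \sum_(i < n.+2) gcoef n.+1 i * U i by [].
have E : \sum_(i < n.+2) gcoef n.+1 i * U i =
    \sum_(i < n.+2) p i * gcoef n i * U i +
    \sum_(i < n.+2) (if i : nat is j.+1 then - ((mu + 1 + j%:R) * al * gcoef n j) else 0) * U i.
  by rewrite -big_split /=; apply: eq_bigr => i _; rewrite -mulrDl.
rewrite E [X in _ = X + _]big_ord_recr /= (gcoef_gt (ltnSn n)) mulr0 mul0r addr0.
rewrite [X in _ = _ + X]big_ord_recl /= mul0r add0r -big_split /=.
by apply: eq_bigr => i _; rewrite mulNr.
Qed.

Lemma gder_ray_at0 n : gder_ray n 0 = \sum_(i < n.+1) gcoef n i *
  0 `^ (ga - n%:R + i%:R * al).
Proof.
apply: eq_bigr => i _; rewrite /pterm [0 `^ al]powR0 ?gt_eqF//.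
by rewrite add0r powR1 mulr1.
Qed.

Lemma pterm_sum_cvg0 m (c e nu : nat -> R) :
  (forall i, c i != 0 -> 0 <= e i) ->
  \sum_(i < m) c i * pterm al (e i) (nu i) x @[x --> 0^'+] -->
  \sum_(i < m) c i * 0 `^ (e i).
Proof.
move=> H; apply: cvg_sumr => i; have [->|ci] := eqVneq (c i) 0.
  by under eq_fun do rewrite mul0r; rewrite mul0r; exact: cvg_cst.
by apply: cvgM; [exact: cvg_cst|apply: pterm_cvg0 => //; exact: H].
Qed.

Definition nonneg_exponents n :=
  forall i, gcoef n i != 0 -> 0 <= ga - n%:R + i%:R * al.

Lemma gder_ray_cvg0 n : nonneg_exponents n -> gder_ray n x @[x --> 0^'+] --> gder_ray n 0.
Proof. by move=> H; rewrite gder_ray_at0; exact: (@pterm_sum_cvg0 n.+1 (gcoef n) (fun i => ga - n%:R + i%:R * al) (fun i => mu + 1 + i%:R)). Qed.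

Lemma gder_ray_cts n : nonneg_exponents n -> {within `[0, +oo[, continuous (gder_ray n)}.
Proof.
move=> H; apply/continuous_within_itvcyP; split; last exact: gder_ray_cvg0.
move=> x; rewrite in_itv /= andbT => x0.
exact: is_derive_cts (is_derive_gder_ray n x0).
Qed.

Lemma gder_ray_rquot n (x : R) : nonneg_exponents n -> nonneg_exponents n.+1 -> 0 <= x ->
  rquot (gder_ray n) x y @[y --> within `[0, +oo[ x^'] --> gder_ray n.+1 x.
Proof.
move=> Hn Hn1; rewrite le_eqVlt => /predU1P[<-|x0].
  apply: rquot_right_of_derive_cvg (gder_ray_cvg0 Hn1); first exact: gder_ray_cts.
  exact: is_derive_gder_ray.
exact: is_derive_rquot (is_derive_gder_ray n x0).
Qed.

Lemma gder_ray_cvgy n : gder_ray n x @[x --> +oo] --> 0.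
Proof.
rewrite (_ : (0 : R) = \sum_(i < n.+1) gcoef n i * 0).
  apply: cvg_sumr => i; apply: cvgM; first exact: cvg_cst.
  apply: pterm_cvgy; first exact/ltW/nu_gt0.
  by have := ler0n R n; move: de0; nra.
by rewrite big1// => i _; rewrite mulr0.
Qed.

(** The gap [b] between the exponents of the derivative of order [n + 1] and [-1]
    makes that derivative integrable at [0]; at infinity [delta] does. *)
Lemma gder_ray_abs_continuous n :
  nonneg_exponents n ->
  (exists2 b : R, 0 < b & forall i, gcoef n.+1 i != 0 -> b <= ga - n%:R + i%:R * al) ->
  abs_continuous_ray 0 (gder_ray n).
Proof.
move=> Hn [b' b'0 Hb].
pose b := Num.min (Num.min b' 1) (al * (mu + 1) - ga).
have b0 : 0 < b by rewrite !lt_min b'0 ltr01 de0.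
have [bb' b1 bd] : [/\ b <= b', b <= 1 & b <= al * (mu + 1) - ga].
  by rewrite /b !ge_min !lexx ?orbT.
apply: (@abs_continuous_ray_of_derive _ _ b (\sum_(i < n.+2) `|gcoef n.+1 i| * 4) _ (gder_ray n.+1)) => //.
- exact: gder_ray_cts.
- exact: is_derive_gder_ray.
move=> x x0; rewrite subr0 mulr_suml; apply: le_trans (ler_norm_sum _ _ _) _.
apply: ler_sum => i _; rewrite normrM -mulrA.
have [->|ci] := eqVneq (gcoef n.+1 i) 0; first by rewrite normr0 !mul0r.
rewrite ler_wpM2l// ger0_norm ?pterm_ge0//.
have -> : ga - n.+1%:R + i%:R * al = (ga - n%:R + i%:R * al) - 1.
  by rewrite -natr1; ring.
apply: pterm_le_slope => //.
- by apply: le_trans (Hb _ ci).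
- by have := ler0n R n; move: bd; nra.
- exact: nu_gt0.
Qed.

End HalfLine.

Section HalfLineOrder.
Context (R : realType) (ga al mu : R).
Hypothesis ga0 : 0 <= ga.
Hypothesis al0 : 0 < al.
Hypothesis de0 : 0 < al * (mu + 1) - ga.

Let g := gfun ga al mu.
Let A : set R := `[0, +oo[%classic.
Let D := gder_ray ga al mu.
Let co := gcoef ga al mu.

Lemma rderiven_gder_ray r : (forall n, (n <= r)%N -> nonneg_exponents ga al mu n) ->
  forall k x, (k <= r)%N -> 0 <= x -> rderiven A k g x = D k x.
Proof.
move=> H k x kr x0; apply: (@rderiven_of_rquot _ A g D r) => //.
- exact: upclosed_itvcy.
- by move=> y; rewrite /A /= in_itv /= andbT => y0; exact: gfun_gder_ray0.
- move=> j y jr; rewrite /A /= in_itv /= andbT => y0.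
  by apply: gder_ray_rquot => //; apply: H => //; exact: ltnW.
- by rewrite /A /= in_itv /= x0.
Qed.

Lemma Cn_gder_ray r : (forall n, (n <= r)%N -> nonneg_exponents ga al mu n) ->
  Cn A r g.
Proof.
move=> H; apply: (@Cn_of_rquot _ A g D r) => //.
- exact: upclosed_itvcy.
- by move=> y; rewrite /A /= in_itv /= andbT => y0; exact: gfun_gder_ray0.
- move=> j y jr; rewrite /A /= in_itv /= andbT => y0.
  by apply: gder_ray_rquot => //; apply: H => //; exact: ltnW.
- by move=> k kr; apply: gder_ray_cts => //; exact: H.
Qed.

Lemma rderiven_gder_ray_cvgy r : (forall n, (n <= r)%N -> nonneg_exponents ga al mu n) ->
  forall k, (k <= r)%N -> rderiven A k g x @[x --> +oo] --> 0.
Proof.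
move=> H k kr; have := gder_ray_cvgy ga0 al0 de0 k.
apply: cvg_trans; apply: near_eq_cvg; near=> x.
by rewrite (rderiven_gder_ray H)//.
Unshelve. all: by end_near. Qed.

(** If [i0] is the index of the lowest exponent of order [r + 1] and this exponent is
    negative, the derivative of order [r + 1] is unbounded near [0], whereas it
    would have to tend to its value there. *)
Lemma gfun_not_Cn r i0 :
  (forall n, (n <= r)%N -> nonneg_exponents ga al mu n) ->
  ga + i0%:R * al < r.+1%:R -> co r.+1 i0 != 0 -> (i0 <= r.+1)%N ->
  (forall i, co r.+1 i != 0 -> (i0 <= i)%N) ->
  ~ Cn A r.+1 g.
Proof.
move=> H lt ci0 i0r Hi [_ /(_ r.+1 (leqnn _)) /continuous_within_itvcyP[_]].
set L := rderiven A r.+1 g 0 => cL.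
have {}cL : D r.+1 x @[x --> 0^'+] --> L.
  apply: cvg_trans cL; apply: near_eq_cvg; near=> x.
  have x0 : 0 < x by near: x; exact: nbhs_right_gt.
  rewrite /rderiven iterS -/(rderiven A r g).
  apply: (@rderive_of_rquot _ A _ (D r)).
  - exact: upclosed_itvcy.
  - by rewrite /A /= in_itv /= ltW.
  - by move=> y; rewrite /A /= in_itv /= andbT => y0; exact: (rderiven_gder_ray H).
  - by apply: is_derive_rquot; exact: is_derive_gder_ray.
(* [- s] is the lowest exponent in the derivative of order [r + 1]; multiplied by
   [x ^ s], that derivative tends to the coefficient at [i0] *)
pose s := r.+1%:R - (ga + i0%:R * al).
have s0 : 0 < s by rewrite subr_gt0.
have c1 : x `^ s * D r.+1 x @[x --> 0^'+] --> 0.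
  by rewrite -[X in _ --> X](mul0r L); apply: cvgM => //; exact: powR_cvg0.
pose e (i : nat) := ga + i%:R * al - (ga + i0%:R * al).
have eE i : e i = (i%:R - i0%:R) * al by rewrite /e; ring.
have c2 := @pterm_sum_cvg0 R al al0 r.+2 (co r.+1) e (fun i => mu + 1 + i%:R).
have {}c2 : \sum_(i < r.+2) co r.+1 i * pterm al (e i) (mu + 1 + i%:R) x @[x --> 0^'+] --> co r.+1 i0.
  rewrite (_ : co r.+1 i0 = \sum_(i < r.+2) co r.+1 i * 0 `^ (e i)).
    by apply: c2 => i /Hi ii; rewrite eE mulr_ge0 ?subr_ge0 ?ler_nat ?ltW.
  have i0r' : (i0 < r.+2)%N by [].
  rewrite (bigD1 (Ordinal i0r')) //= eE subrr mul0r powRr0 mulr1 big1 ?addr0// => i ii0.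
  rewrite powR0 ?mulr0// eE mulf_neq0 ?(gt_eqF al0)// subr_eq0 eqr_nat.
  by apply: contra ii0 => /eqP ii; apply/eqP/val_inj.
have c3 : x `^ s * D r.+1 x @[x --> 0^'+] --> co r.+1 i0.
  apply: cvg_trans c2; apply: near_eq_cvg; near=> x.
  have x0 : 0 < x by near: x; exact: nbhs_right_gt.
  apply/esym; rewrite /D /gder_ray mulr_sumr; apply: eq_bigr => i _.
  rewrite /pterm mulrCA; congr (_ * _); rewrite mulrA -powRD_gt0//.
  by congr (_ `^ _ * _); rewrite /s /e; ring.
have : co r.+1 i0 = 0 by apply: (cvg_unique _ c3 c1).
by move/eqP; rewrite (negbTE ci0).
Unshelve. all: by end_near. Qed.

Lemma gcoef_n0 n : co n 0 = \prod_(j < n) (ga - j%:R).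
Proof.
elim: n => [|n IH]; first by rewrite big_ord0.
by rewrite big_ord_recr /= -IH mul0r !addr0 mulrC.
Qed.

(** The product over [ga + al] comes from the term [- (mu + 1) x ^ (ga + al)] in
    the expansion of [g] at [0]; what the term of index [0] already contributes to
    that order is subtracted. *)
Lemma gcoef_n1 n : co n 1 = - (mu + 1) *
   (\prod_(j < n) (ga + al - j%:R) - \prod_(j < n) (ga - j%:R)).
Proof.
elim: n => [|n IH]; first by rewrite !big_ord0 subrr mulr0.
rewrite !big_ord_recr /= -/(co n 1) -/(co n 0) IH gcoef_n0 mul1r addr0; ring.
Qed.

Section NonIntegerGamma.
Hypothesis gaN : ga \isn't a Num.nat.
Let r := Num.truncn ga.

Lemma gap_frac n : (n <= r)%N -> 0 < ga - n%:R.
Proof.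
rewrite truncn_ge_nat// => nr; rewrite subr_gt0 lt_neqAle nr andbT.
by apply: contra gaN => /eqP <-; rewrite natr_nat.
Qed.

Lemma exponent_ge_frac n i : (n <= r)%N -> ga - n%:R <= ga - n%:R + i%:R * al.
Proof. by move=> nr; rewrite lerDl mulr_ge0// ltW. Qed.

Lemma nonneg_exponents_frac n : (n <= r)%N -> nonneg_exponents ga al mu n.
Proof.
by move=> nr i _; rewrite (le_trans _ (exponent_ge_frac i nr))// ltW// gap_frac.
Qed.

Lemma gap_exists_frac n : (n <= r)%N ->
  exists2 b : R, 0 < b & forall i, co n.+1 i != 0 -> b <= ga - n%:R + i%:R * al.
Proof.
by move=> nr; exists (ga - n%:R) => [|i _]; [exact: gap_frac|exact: exponent_ge_frac].
Qed.

Lemma not_Cn_frac : ~ Cn A r.+1 g.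
Proof.
apply: (@gfun_not_Cn r 0); [exact: nonneg_exponents_frac| |  |by []|by []].
  by rewrite mul0r addr0 truncnS_gt.
rewrite gcoef_n0; apply/prodf_neq0 => j _; rewrite subr_eq0.
by apply: contra gaN => /eqP ->; rewrite natr_nat.
Qed.

Lemma gder_ray_at0_frac p : (p <= r)%N -> D p 0 = 0.
Proof.
move=> pr; rewrite /D gder_ray_at0// big1// => i _; rewrite powR0 ?mulr0//.
by rewrite gt_eqF// (lt_le_trans (gap_frac pr))// exponent_ge_frac.
Qed.
End NonIntegerGamma.

Section IntegerGamma.
Variable c : nat.
Hypothesis gac : ga = c%:R.
Hypothesis alN : al \isn't a Num.nat.
Let r := (c + Num.truncn al)%N.

Lemma gcoef_nat n : co n 0 = (c ^_ n)%:R.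
Proof.
elim: n => [//|n IH]; rewrite ffactnSr natrM -IH.
have -> : co n.+1 0 = (ga - n%:R) * co n 0 by rewrite /co /= mul0r !addr0.
have [cn|nc] := ltnP c n; first by rewrite IH ffact_small// mulr0 mul0r.
by rewrite gac natrB// mulrC.
Qed.

Lemma gcoef_nat_neq0 n : co n 0 != 0 -> (n <= c)%N.
Proof. by rewrite gcoef_nat; apply: contraR; rewrite -ltnNge => /ffact_small ->. Qed.

Lemma gap_nat n : (n <= r)%N -> 0 < ga + al - n%:R.
Proof.
move=> nr; have H : (Num.truncn al)%:R < al.
  have := truncn_le al; rewrite (ltW al0) => H.
  by rewrite lt_neqAle H andbT; apply: contra alN => /eqP <-; rewrite natr_nat.
have : n%:R <= r%:R :> R by rewrite ler_nat.
by rewrite /r natrD gac; move: H; lra.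
Qed.

Lemma exponent_ge_nat n i : ga + al - n%:R <= ga - n%:R + i.+1%:R * al.
Proof.
have : 0 <= i%:R * al by rewrite mulr_ge0// ltW.
by rewrite -natr1; lra.
Qed.

Lemma nonneg_exponents_nat n : (n <= r)%N -> nonneg_exponents ga al mu n.
Proof.
move=> nr [|i]; last by rewrite (le_trans _ (exponent_ge_nat n i))// ltW// gap_nat.
by move/gcoef_nat_neq0 => nc; rewrite mul0r addr0 gac subr_ge0 ler_nat.
Qed.

Lemma gap_exists_nat n : (n <= r)%N ->
  exists2 b : R, 0 < b & forall i, co n.+1 i != 0 -> b <= ga - n%:R + i%:R * al.
Proof.
move=> nr; exists (Num.min 1 (ga + al - n%:R)).
  by rewrite lt_min ltr01 gap_nat.
move=> [|i]; last by rewrite ge_min exponent_ge_nat orbT.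
move/gcoef_nat_neq0 => nc; rewrite mul0r addr0 ge_min gac; apply/orP; left.
have : n.+1%:R <= c%:R :> R by rewrite ler_nat.
by rewrite -natr1; lra.
Qed.

Lemma not_Cn_nat : ~ Cn A r.+1 g.
Proof.
have rc : (c < r.+1)%N by rewrite ltnS leq_addr.
apply: (@gfun_not_Cn r 1); [exact: nonneg_exponents_nat| | |by []|].
- have := truncnS_gt al; rewrite mul1r gac /r -addnS natrD; lra.
- rewrite gcoef_n1 -gcoef_n0 gcoef_nat ffact_small// subr0 mulf_neq0//.
    by rewrite oppr_eq0 gt_eqF// (mu1_gt0 ga0 al0 de0).
  apply/prodf_neq0 => j _; rewrite subr_eq0; apply: contra alN => /eqP E.
  have -> : al = j%:R - c%:R by rewrite -E gac; ring.
  have cj : (c <= j)%N by rewrite -(ler_nat R) -E gac; move: al0; lra.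
  by rewrite -natrB// natr_nat.
- by move=> [|//] /gcoef_nat_neq0; rewrite leqNgt rc.
Qed.

Lemma gder_ray_at0_nat p : (p <= r)%N -> D p 0 = if p == c then c`!%:R else 0.
Proof.
move=> pr; rewrite /D gder_ray_at0// big_ord_recl /= mul0r addr0 gac big1; last first.
  move=> i _; rewrite -gac powR0 ?mulr0// gt_eqF//.
  exact: lt_le_trans (gap_nat pr) (exponent_ge_nat p i).
rewrite addr0 -gac -/(co p 0) gcoef_nat gac.
have [->|pc] := eqVneq p c; first by rewrite subrr powRr0 mulr1 ffactnn.
by rewrite powR0 ?mulr0// subr_eq0 eqr_nat eq_sym.
Qed.
End IntegerGamma.

End HalfLineOrder.

(** * The derivatives of [g] for natural exponents *)

Lemma rpow_nat (R : realType) (x : R) (n : nat) : rpow x n%:R = x ^+ n.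
Proof. by rewrite /rpow natr_nat natrK. Qed.

Lemma horner_le_pow (R : realType) (p : {poly R}) (d : nat) (x z : R) :
  (size p <= d.+1)%N -> 1 <= z -> `|x| <= z ->
  `|p.[x]| <= (\sum_(i < size p) `|p`_i|) * z ^+ d.
Proof.
move=> sp z1 xz; rewrite horner_coef mulr_suml.
apply: le_trans (ler_norm_sum _ _ _) _; apply: ler_sum => i _.
rewrite normrM normrX ler_wpM2l//.
have id : (i <= d)%N by rewrite -ltnS; exact: leq_trans (ltn_ord i) sp.
apply: (@le_trans _ _ (z ^+ i)); first by rewrite lerXn2r ?nnegrE//; lra.
by rewrite ler_weXn2l.
Qed.

Section NaturalExponents.
Context (R : realType) (c a : nat) (mu : R).
Hypothesis a0 : (0 < a)%N.
Let de := a%:R * (mu + 1) - c%:R.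
Hypothesis de0 : 0 < de.

Fixpoint gpoly (n : nat) : {poly R} :=
  if n is m.+1 then
    (gpoly m)^`() * ('X^a + 1) - ((mu + 1 + m%:R) * a%:R) *: ('X^(a.-1) * gpoly m)
  else 'X^c.

Definition gder_nat (n : nat) (x : R) : R :=
  (gpoly n).[x] * (x ^+ a + 1) `^ (- (mu + 1 + n%:R)).

Lemma gfun_gder_nat0 (x : R) : gfun c%:R a%:R mu x = gder_nat 0 x.
Proof.
rewrite /gfun /gder_nat !rpow_nat /= hornerXn; congr (_ * _ `^ _); ring.
Qed.

(** For [x >= 0] the larger of [1] and [x] is at least [(1 + x) / 2]; for
    negative [x] the factor [1 + q] is already a lower bound. *)
Lemma Xn1_ge (q x : R) : -1 < q -> q <= 0 -> q <= x ->
  (1 + q) * ((1 + x) / 2) ^+ a <= x ^+ a + 1.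
Proof.
move=> q1 q0 qx.
have h0 : 0 <= (1 + x) / 2 by lra.
have [x0|x0] := leP 0 x.
  have H : ((1 + x) / 2) ^+ a <= x ^+ a + 1.
    have [x1|x1] := leP x 1.
      have : ((1 + x) / 2) ^+ a <= 1 by rewrite exprn_ile1//; lra.
      have : 0 <= x ^+ a by exact: exprn_ge0.
      lra.
    have : ((1 + x) / 2) ^+ a <= x ^+ a by rewrite lerXn2r ?nnegrE//; lra.
    lra.
  apply: le_trans H; rewrite ler_piMl//; last by lra.
  exact: exprn_ge0.
have H1 : ((1 + x) / 2) ^+ a <= 1 by rewrite exprn_ile1//; lra.
have H2 : `|x| ^+ a <= - x.
  rewrite ltr0_norm// -[leRHS]expr1; apply: ler_wiXn2l => //; lra.
have H3 : - `|x| ^+ a <= x ^+ a by rewrite -normrX lerNnormlW.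
have H4 : 0 <= ((1 + x) / 2) ^+ a by exact: exprn_ge0.
nra.
Qed.

Lemma Xn1_gt0 (x : R) : -1 < x -> 0 < x ^+ a + 1.
Proof.
move=> x1; have [x0|x0] := leP 0 x; first by have : 0 <= x ^+ a by [exact: exprn_ge0]; lra.
apply: lt_le_trans (Xn1_ge x1 (ltW x0) (lexx _)).
by rewrite mulr_gt0 ?exprn_gt0//; lra.
Qed.

Lemma is_derive_gder_nat (n : nat) (x : R) : -1 < x ->
  is_derive x 1 (gder_nat n) (gder_nat n.+1 x).
Proof.
move=> x1; have w0 := Xn1_gt0 x1.
have D1 : is_derive x 1 (fun y : R => y ^+ a + 1) (a%:R * x ^+ a.-1).
  apply: (is_derive_ext (is_derive_poly ('X^a + 1) x)) => [y|].
    by rewrite hornerD hornerXn hornerC.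
  by rewrite derivD derivXn derivC addr0 hornerMn hornerXn mulr_natl.
have D2 := @is_derive1_comp _ (fun y : R => y `^ (- (mu + 1 + n%:R)))
   (fun y : R => y ^+ a + 1) _ _ _ (is_derive1_powR _ w0) D1.
apply: (is_derive_ext (is_deriveM (is_derive_poly (gpoly n) x) D2)) => //.
rewrite /GRing.scale /= /gder_nat /=.
have -> : - (mu + 1 + n.+1%:R) = - (mu + 1 + n%:R) - 1 by rewrite -natr1; ring.
have -> : (x ^+ a + 1) `^ (- (mu + 1 + n%:R)) =
   (x ^+ a + 1) * (x ^+ a + 1) `^ (- (mu + 1 + n%:R) - 1).
  by rewrite -{2}(powRr1 (ltW w0)) -powRD_gt0//; congr (_ `^ _); ring.
rewrite hornerD hornerN hornerZ !hornerM hornerD !hornerXn hornerC; ring.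
Qed.

(** The degree grows by [a - 1] at each step while the power of [x ^ a + 1] in the
    denominator grows by one, so each derivative gains one order of decay. *)
Lemma size_gpoly n : (size (gpoly n) <= (c + n * a.-1).+1)%N.
Proof.
elim: n => [|n IH]; first by rewrite /= size_polyXn mul0n addn0.
rewrite [gpoly n.+1]/=; apply: leq_trans (size_polyD _ _) _; rewrite geq_max size_polyN; apply/andP; split.
  apply: leq_trans (size_polyMleq _ _) _.
  have -> : size ('X^a + 1 : {poly R}) = a.-1.+2 by rewrite size_XnaddC// prednK.
  have : (size (gpoly n)^`() <= (size (gpoly n)).-1)%N by exact: size_poly.
  rewrite mulSn; move: IH.
  by move: (size (gpoly n)) (size _) (n * a.-1)%N => s s' N; clear; lia.
apply: leq_trans (size_scale_leq _ _) _; apply: leq_trans (size_polyMleq _ _) _.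
rewrite size_polyXn mulSn; move: IH.
by move: (size (gpoly n)) (n * a.-1)%N => s N; clear; lia.
Qed.

(** The shape [(1 + x) / (1 + q)] of the variable, which is at least [1] on the ray,
    gives one bound that serves both near [q] and at infinity. *)
Lemma gder_nat_bound (n : nat) (q : R) : -1 < q -> q <= 0 ->
  exists2 K : R, 0 < K & forall x, q <= x ->
    `|gder_nat n x| <= K * ((1 + x) / (1 + q)) `^ (- (de + n%:R)).
Proof.
move=> q1 q0; set nu := mu + 1 + n%:R.
have p0 : 0 < 1 + q by lra.
(* chosen so that [x ^ a + 1 >= ka * z ^ a], where [z = (1 + x) / (1 + q)] *)
pose ka := (1 + q) * ((1 + q) / 2) ^+ a.
have ka0 : 0 < ka by rewrite mulr_gt0// exprn_gt0//; lra.
pose S := \sum_(i < size (gpoly n)) `|(gpoly n)`_i|.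
have S0 : 0 <= S by apply: sumr_ge0.
have nu0 : 0 <= nu.
  have := ler0n R n; rewrite /nu.
  have : 0 < mu + 1.
    have A0 : 0 < a%:R :> R by rewrite ltr0n.
    have : 0 < a%:R * (mu + 1) by have := ler0n R c; move: de0; rewrite /de; lra.
    by rewrite pmulr_rgt0.
  lra.
exists ((S + 1) * ka `^ (- nu)); first by rewrite mulr_gt0 ?powR_gt0//; lra.
move=> x qx; set z := (1 + x) / (1 + q).
have z1 : 1 <= z by rewrite ler_pdivlMr// mul1r; lra.
have z0 : 0 < z by lra.
have xz : `|x| <= z.
  have [x0|x0] := leP 0 x; last by rewrite ltr0_norm//; lra.
  rewrite ger0_norm//; apply: (@le_trans _ _ (1 + x)); first lra.
  by rewrite ler_pdivlMr// ler_piMr//; lra.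
have w0 : 0 < x ^+ a + 1 by apply: Xn1_gt0; lra.
have kz : 0 < ka * z ^+ a by rewrite mulr_gt0// exprn_gt0.
have wk : ka * z ^+ a <= x ^+ a + 1.
  apply: le_trans (Xn1_ge q1 q0 qx); rewrite -mulrA -exprMn.
  have -> // : (1 + q) / 2 * z = (1 + x) / 2.
  by rewrite /z; field; rewrite gt_eqF.
rewrite /gder_nat -/nu normrM [X in _ * X]ger0_norm ?powR_ge0//.
have H1 := horner_le_pow (size_gpoly n) z1 xz.
have H2 := powRN_anti kz wk nu0.
apply: le_trans (ler_pM (normr_ge0 _) (powR_ge0 _ _) H1 H2) _.
rewrite powRM ?exprn_ge0 ?(ltW ka0) ?(ltW z0)//.
rewrite -(powR_mulrn _ (ltW z0)) -(powR_mulrn a (ltW z0)) -powRrM.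
rewrite mulrACA -powRD_gt0// ler_pM ?powR_ge0// ?mulr_ge0 ?powR_ge0//.
  by rewrite ler_wpM2r ?powR_ge0// lerDl.
rewrite le_eqVlt; apply/orP; left; apply/eqP; congr (_ `^ _).
have Ea : a%:R = a.-1%:R + 1 :> R by rewrite natr1 prednK.
by rewrite /de /nu natrD natrM Ea; ring.
Qed.

Lemma gder_nat_cvgy (n : nat) : gder_nat n x @[x --> +oo] --> 0.
Proof.
have q1 : -1 < - 2^-1 :> R by lra.
have q0 : - 2^-1 <= 0 :> R by lra.
have [K K0 HK] := gder_nat_bound n q1 q0.
have s0 : 0 < de + n%:R by have := ler0n R n; move: de0; lra.
have H : K * x `^ (- (de + n%:R)) @[x --> +oo] --> 0.
  by rewrite -(mulr0 K); apply: cvgM; [exact: cvg_cst|exact: powRN_cvgy].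
have HN : - (K * x `^ (- (de + n%:R))) @[x --> +oo] --> 0.
  by rewrite -oppr0; exact: cvgN.
apply: (squeeze_cvgr _ HN H); near=> x; rewrite -ler_norml.
have x0 : 0 < x by near: x; exact: nbhs_pinfty_gt.
have qx : - 2^-1 <= x by lra.
apply: le_trans (HK x qx) _; rewrite ler_wpM2l ?(ltW K0)//.
apply: powRN_anti => //; last exact: ltW.
by rewrite ler_pdivlMr; lra.
Unshelve. all: by end_near. Qed.

Lemma decay_le_slope (b y : R) : 0 < b -> b <= 1 -> 0 < y ->
  (1 + y) `^ (- (1 + b)) <= 4 * sigmoid_slope b y.
Proof.
move=> b0 b1 y0; rewrite /sigmoid_slope; have y10 : 0 < 1 + y by lra.
rewrite mulrA ler_pdivlMr ?exprn_gt0 ?onepowR_gt0//.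
have H1 : (1 + y `^ b) ^+ 2 <= 4 * (1 + y) `^ (b + b).
  rewrite powRD_gt0//.
  have : y `^ b <= (1 + y) `^ b by apply: ge0_ler_powR; rewrite ?nnegrE; lra.
  have : 1 <= (1 + y) `^ b by rewrite -[leLHS](powRr0 (1 + y)); apply: ler_powR; lra.
  have := powR_ge0 y b; nra.
apply: le_trans (ler_wpM2l (powR_ge0 _ _) H1) _.
rewrite mulrCA ler_wpM2l// -powRD_gt0//.
have -> : - (1 + b) + (b + b) = - (1 - b) by ring.
have -> : b - 1 = - (1 - b) by ring.
by apply: powRN_anti; lra.
Qed.

Lemma gder_nat_within_cts (n : nat) (A : set R) :
  (forall x, A x -> -1 < x) -> {within A, continuous (gder_nat n)}.
Proof.
move=> HA; apply: continuous_in_subspaceT => x; rewrite inE => /HA x1.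
exact: is_derive_cts (is_derive_gder_nat n x1).
Qed.

Lemma gder_nat_abs_continuous (n : nat) (q : R) : -1 < q -> q <= 0 ->
  abs_continuous_ray q (gder_nat n).
Proof.
move=> q1 q0; have [K K0 HK] := gder_nat_bound n.+1 q1 q0.
pose b := Num.min 1 de.
have b0 : 0 < b by rewrite lt_min ltr01 de0.
have [b1 bd] : b <= 1 /\ b <= de by rewrite /b !ge_min !lexx ?orbT.
apply: (@abs_continuous_ray_of_derive _ _ b (K * 4) _ (gder_nat n.+1)) => //.
- by apply: gder_nat_within_cts => x /=; rewrite in_itv /= andbT; exact: lt_le_trans.
- by move=> x qx; apply: is_derive_gder_nat; exact: lt_trans qx.
move=> x qx; apply: le_trans (HK x (ltW qx)) _.
rewrite -mulrA ler_wpM2l ?(ltW K0)//.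
have y0 : 0 < x - q by rewrite subr_gt0.
apply: le_trans (decay_le_slope b0 b1 y0).
have n0 := ler0n R n.
have z1 : 1 <= 1 + (x - q) by lra.
apply: (@le_trans _ _ ((1 + (x - q)) `^ (- (de + n.+1%:R)))).
  apply: powRN_anti; [lra| |by have := ler0n R n.+1; move: de0; lra].
  rewrite ler_pdivlMr; last lra.
  nra.
by apply: ler_powR => //; rewrite lerN2 -natr1; lra.
Qed.

Lemma rderiven_gder_nat (A : set R) : upclosed A -> (forall x, A x -> -1 < x) ->
  forall k x, A x -> rderiven A k (gfun c%:R a%:R mu) x = gder_nat k x.
Proof.
move=> uA HA k x Ax; apply: (@rderiven_of_rquot _ A _ gder_nat k) => //.
  by move=> y _; exact: gfun_gder_nat0.
move=> j y _ Ay; apply: is_derive_rquot; apply: is_derive_gder_nat; exact: HA.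
Qed.

Lemma Cn_gder_nat (A : set R) (n : nat) : upclosed A -> (forall x, A x -> -1 < x) ->
  Cn A n (gfun c%:R a%:R mu).
Proof.
move=> uA HA; apply: (@Cn_of_rquot _ A _ gder_nat n) => //.
- by move=> y _; exact: gfun_gder_nat0.
- move=> j y _ Ay; apply: is_derive_rquot; apply: is_derive_gder_nat; exact: HA.
- by move=> k _; exact: gder_nat_within_cts.
Qed.
End NaturalExponents.

(** * Improper integrals of nonnegative functions *)

(** Integrands may be singular at the ends of [D], whereas the fundamental theorem
    of calculus is available on compact intervals. *)
Definition exhausted_by (R : realType) (D : set R) (a b : nat -> R) :=
  [/\ forall n, a n < b n,
      forall n, a n.+1 <= a n /\ b n <= b n.+1 &
      D = \bigcup_n `[a n, b n]%classic].

Lemma exhausted_homo (R : realType) (D : set R) (a b : nat -> R) :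
  exhausted_by D a b ->
  {homo (fun n => `[a n, b n]%classic) : n m / (n <= m)%N >-> (n <= m)%O}.
Proof.
move=> [_ H _]; apply: homo_leq => [A|B A C|n]; first exact: lexx.
  exact: le_trans.
apply/subsetPset => x /=; rewrite !in_itv /= => /andP[h1 h2].
by have [H1 H2] := H n; rewrite (le_trans H1 h1) (le_trans h2 H2).
Qed.

Section Exhaustion.
Context (R : realType) (D : set R) (a b : nat -> R).
Hypothesis Dab : exhausted_by D a b.
Local Notation leb := (@lebesgue_measure R).

Lemma exhausted_subset n : `[a n, b n]%classic `<=` D.
Proof. by case: Dab => _ _ -> x abx; exists n. Qed.

Lemma exhausted_measurable : measurable D.
Proof. by case: Dab => _ _ ->; exact: bigcup_measurable. Qed.

Lemma exhausted_cts_in n (f : R -> R) : (forall x, D x -> {for x, continuous f}) ->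
  {within `[a n, b n], continuous f}.
Proof.
move=> cf; apply: continuous_in_subspaceT => x; rewrite inE => abx.
by apply: cf; exact: exhausted_subset abx.
Qed.

Lemma exhausted_measurable_fun (f : R -> R) :
  (forall x, D x -> {for x, continuous f}) -> measurable_fun D f.
Proof.
move=> cf; apply: subspace_continuous_measurable_fun.
  exact: exhausted_measurable.
by apply: continuous_in_subspaceT => x; rewrite inE; exact: cf.
Qed.

Lemma exhausted_cvg (f : R -> R) :
  (forall x, D x -> {for x, continuous f}) -> (forall x, D x -> 0 <= f x) ->
  (\int[leb]_(x in `[a n, b n]) (f x)%:E)%E @[n --> \oo] -->
  (\int[leb]_(x in D) (f x)%:E)%E.
Proof.
move=> cf f0; have [_ _ E] := Dab; rewrite [X in _ --> X](_ : _ =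
   (\int[leb]_(x in \bigcup_n `[a n, b n]%classic) (f x)%:E)%E); last by rewrite -E.
apply: ge0_nondecreasing_set_cvg_integral.
- exact: exhausted_homo Dab.
- by [].
- move=> n; apply/measurable_EFinP.
  apply: measurable_funS (exhausted_measurable_fun cf).
    exact: exhausted_measurable.
  exact: exhausted_subset.
- by move=> n x abx; rewrite lee_fin f0//; exact: exhausted_subset abx.
Qed.

Lemma exhausted_FTC2 n (f F : R -> R) :
  (forall x, D x -> {for x, continuous f}) ->
  (forall x, D x -> is_derive x 1 F (f x)) ->
  (\int[leb]_(x in `[a n, b n]) (f x)%:E)%E = (F (b n) - F (a n))%:E.
Proof.
move=> cf DF; have [ab _ _] := Dab.
have inD x : a n <= x -> x <= b n -> D x.
  by move=> ax xb; apply: (@exhausted_subset n); rewrite /= in_itv /= ax xb.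
rewrite (@continuous_FTC2 _ f F)//.
- exact: exhausted_cts_in.
- split.
  + move=> x; rewrite in_itv /= => /andP[ax xb].
    by have [] := DF x (inD x (ltW ax) (ltW xb)).
  + apply: cvg_at_right_filter; apply: is_derive_cts (DF _ _).
    by apply: inD => //; exact/ltW.
  + apply: cvg_at_left_filter; apply: is_derive_cts (DF _ _).
    by apply: inD => //; exact/ltW.
- move=> x; rewrite in_itv /= => /andP[ax xb]; rewrite derive1E.
  by have [_ ->] := DF x (inD x (ltW ax) (ltW xb)).
Qed.

(** Monotone convergence along the exhaustion. *)
Lemma ge0_integral_primitive (f F : R -> R) (L : R) :
  (forall x, D x -> {for x, continuous f}) -> (forall x, D x -> 0 <= f x) ->
  (forall x, D x -> is_derive x 1 F (f x)) ->
  F (b n) - F (a n) @[n --> \oo] --> L ->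
  (\int[leb]_(x in D) (f x)%:E)%E = L%:E.
Proof.
move=> cf f0 DF FL; have := exhausted_cvg cf f0.
under eq_fun do rewrite (exhausted_FTC2 _ cf DF).
move=> H; apply: cvg_unique H _ => //.
by apply/fine_cvgP; split; [near=> n|exact: FL].
Unshelve. all: by end_near. Qed.

End Exhaustion.

Definition ray_lo (R : realType) (q : R) (n : nat) : R := q + n.+1%:R^-1.
Definition ray_hi (R : realType) (q : R) (n : nat) : R := q + n.+2%:R.

Lemma exhausted_ray (R : realType) (q : R) :
  exhausted_by `]q, +oo[%classic (ray_lo q) (ray_hi q).
Proof.
rewrite /ray_lo /ray_hi; split.
- move=> n; rewrite ltrD2l; apply: (@le_lt_trans _ _ 1).
    by rewrite invf_le1// ler1n.
  by rewrite ltr1n.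
- move=> n; split; last by rewrite lerD2l ler_nat.
  by rewrite lerD2l lef_pV2 ?posrE ?ltr0n// ler_nat.
apply/seteqP; split => x /=.
  rewrite in_itv /= andbT => qx; have y0 : 0 < x - q by rewrite subr_gt0.
  pose m := Num.truncn (Num.max (x - q) (x - q)^-1).
  have := truncnS_gt (Num.max (x - q) (x - q)^-1); rewrite -/m gt_max => /andP[h1 h2].
  exists m => //=; rewrite in_itv /=; apply/andP; split.
    rewrite -lerBrDl -[leRHS]invrK lef_pV2 ?posrE ?invr_gt0//; exact: ltW.
  by rewrite -lerBlDl (le_trans (ltW h1))// ler_nat.
move=> [n _]; rewrite /= !in_itv /= andbT => /andP[+ _].
by apply: lt_le_trans; rewrite ltrDl.
Qed.

Lemma ray_hi_cvgy (R : realType) (q : R) : ray_hi q n @[n --> \oo] --> +oo.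
Proof.
apply/cvgryPge => A; near=> n; rewrite /ray_hi -lerBlDl.
apply: (@le_trans _ _ n%:R); last by rewrite ler_nat; lia.
near: n; have /cvgryPge := @cvgr_idn R; exact.
Unshelve. all: by end_near. Qed.

Lemma ray_lo_cvg (R : realType) (q : R) : ray_lo q n @[n --> \oo] --> q.
Proof.
rewrite -[X in _ --> X]addr0; apply: cvgD; [exact: cvg_cst|exact: cvg_harmonic].
Qed.

Lemma cvg_ray_increment (R : realType) (q l m : R) (F : R -> R) :
  F x @[x --> q^'+] --> m -> F x @[x --> +oo] --> l ->
  F (ray_hi q n) - F (ray_lo q n) @[n --> \oo] --> l - m.
Proof.
move=> /cvg_at_rightP Fm /cvg_pinftyP Fl; apply: cvgB.
  by apply: Fl; exact: ray_hi_cvgy.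
apply: Fm; split; last exact: ray_lo_cvg.
by move=> n; rewrite /ray_lo ltrDl.
Qed.

Lemma sigmoid_slope_ge0 (R : realType) (b y : R) : 0 <= sigmoid_slope b y.
Proof. by rewrite divr_ge0 ?powR_ge0 ?sqr_ge0. Qed.

Lemma powR_cts (R : realType) (p x : R) : 0 < x -> {for x, continuous (fun y : R => y `^ p)}.
Proof. by move=> x0; exact: is_derive_cts (is_derive1_powR p x0). Qed.

Lemma sigmoid_slope_cts (R : realType) (b y : R) : 0 < y -> {for y, continuous (sigmoid_slope b)}.
Proof.
move=> y0; apply: cvgM; first exact: powR_cts.
apply: cvgV; first by rewrite expf_neq0// gt_eqF// onepowR_gt0.
by apply: cvgM; apply: cvgD; do ?[exact: cvg_cst|exact: powR_cts].
Qed.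

Lemma sigmoid_cvgy (R : realType) (b : R) : 0 < b -> sigmoid b x @[x --> +oo] --> 0.
Proof.
move=> b0; have H := powRN_cvgy b0.
have HN : - x `^ (- b) @[x --> +oo] --> 0 by rewrite -oppr0; exact: cvgN.
apply: (squeeze_cvgr _ HN (cvg_cst 0)); near=> x.
have x0 : 0 < x by near: x; exact: nbhs_pinfty_gt.
have /andP[_ ->] := sigmoid_bounds b x; rewrite andbT /sigmoid lerN2 powRN.
by rewrite lef_pV2 ?posrE ?powR_gt0 ?onepowR_gt0// lerDr.
Unshelve. all: by end_near. Qed.

Lemma sigmoid0 (R : realType) (b : R) : 0 < b -> sigmoid b 0 = -1 :> R.
Proof. by move=> b0; rewrite /sigmoid powR0 ?gt_eqF// addr0 invr1. Qed.

Lemma integral_sigmoid_slope (R : realType) (b q : R) : 0 < b ->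
  (\int[@lebesgue_measure R]_(x in `]q, +oo[) (b * sigmoid_slope b (x - q))%:E)%E = 1%:E.
Proof.
move=> b0.
have DB (x : R) : is_derive x 1 (fun y : R => y - q) 1.
  by have := is_deriveB (@is_derive_id R R x 1) (@is_derive_cst R R R q x 1); rewrite subr0.
apply: (ge0_integral_primitive (exhausted_ray q) (F := fun x => sigmoid b (x - q))).
- move=> x /=; rewrite in_itv /= andbT => qx; have y0 : 0 < x - q by rewrite subr_gt0.
  apply: cvgM; first exact: cvg_cst.
  have := continuous_comp (is_derive_cts (DB x)) (sigmoid_slope_cts (b := b) y0).
  by apply.
- by move=> x _; rewrite mulr_ge0 ?sigmoid_slope_ge0// ltW.
- move=> x /=; rewrite in_itv /= andbT => qx; have y0 : 0 < x - q by rewrite subr_gt0.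
  apply: (is_derive_ext (@is_derive1_comp _ (sigmoid b) (fun y : R => y - q) _ _ _ (is_derive_sigmoid b y0) (DB x))) => //.
  by rewrite mulr1.
have E n : sigmoid b (ray_hi q n - q) - sigmoid b (ray_lo q n - q) =
    sigmoid b (ray_hi 0 n) - sigmoid b (ray_lo 0 n).
  by rewrite /ray_hi /ray_lo !add0r (addrC q) addrK (addrC q) addrK.
under eq_fun do rewrite E.
have c0 : sigmoid b x @[x --> 0^'+] --> sigmoid b 0.
  by have /continuous_within_itvcyP[] := sigmoid_cts b0.
by have := cvg_ray_increment c0 (sigmoid_cvgy b0); rewrite sigmoid0// opprK add0r.
Qed.

(** The dominating function is singular at [q], so the comparison takes place on
    the open ray. *)
Lemma in_L_ray_of_slope (R : realType) (b q C : R) (f : R -> R) : 0 < b ->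
  {within `[q, +oo[, continuous f} ->
  (forall x, q < x -> `|f x| <= C * sigmoid_slope b (x - q)) -> in_L_ray q f.
Proof.
move=> b0 cf le; rewrite /in_L_ray.
have mf : measurable_fun `[q, +oo[%classic f.
  exact: subspace_continuous_measurable_fun.
have msub : `]q, +oo[%classic `<=` `[q, +oo[%classic by move=> x; rewrite /= !in_itv /= !andbT => /ltW.
have mfo : measurable_fun `]q, +oo[%classic f by apply: (measurable_funS _ msub mf).
apply/integrableP; split; first exact/measurable_EFinP.
rewrite -integral_itv_obnd_cbnd; last first.
  by apply: measurableT_comp => //; exact/measurable_EFinP.
have mk : measurable_fun `]q, +oo[%classic (fun x => b * sigmoid_slope b (x - q)).
  apply: (exhausted_measurable_fun (exhausted_ray q)).
  move=> x /=; rewrite in_itv /= andbT => qx; have y0 : 0 < x - q by rewrite subr_gt0.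
  apply: cvgM; first exact: cvg_cst.
  have DB : is_derive x 1 (fun y : R => y - q) 1.
    by have := is_deriveB (@is_derive_id R R x 1) (@is_derive_cst R R R q x 1); rewrite subr0.
  have := continuous_comp (is_derive_cts DB) (sigmoid_slope_cts (b := b) y0).
  by apply.
have C0 : 0 <= C.
  have q1 : q < q + 1 by lra.
  have := le_trans (normr_ge0 _) (le _ q1).
  rewrite pmulr_lge0// /sigmoid_slope divr_gt0 ?powR_gt0 ?exprn_gt0 ?onepowR_gt0//; lra.
apply: (@le_lt_trans _ _ (\int[@lebesgue_measure R]_(x in `]q, +oo[) ((C / b)%:E * (b * sigmoid_slope b (x - q))%:E))%E).
  apply: ge0_le_integral => //.
  - by apply: measurableT_comp => //; exact/measurable_EFinP.
  - by apply: measurable_funeM; exact/measurable_EFinP.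
  move=> x /=; rewrite in_itv /= andbT => qx; rewrite -EFinM lee_fin mulrA divfK ?gt_eqF//.
  exact: le.
rewrite ge0_integralZl//.
- by rewrite integral_sigmoid_slope// mule1 ltry.
- exact/measurable_EFinP.
- by move=> x _; rewrite lee_fin mulr_ge0 ?sigmoid_slope_ge0// ltW.
- by rewrite lee_fin divr_ge0// ltW.
Qed.

(** * Euler's Gamma function *)

Section EulerGamma.
Context (R : realType).
Implicit Types x t : R.
Local Notation leb := (@lebesgue_measure R).

Definition gamma_density x t : R := t `^ (x - 1) * expR (- t).

Lemma expr_expRN_le (m : nat) t : 0 <= t -> t ^+ m * expR (- t) <= m`!%:R.
Proof.
move=> t0; rewrite expRN ler_pdivrMr ?expR_gt0//.
case: m => [|m]; first by rewrite expr0 mul1r -expR0 ler_expR.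
have := expR_ge1Dxn m t0; have f0 : 0 < m.+1`!%:R :> R by rewrite ltr0n fact_gt0.
move=> H; have : t ^+ m.+1 / m.+1`!%:R <= expR t by lra.
by rewrite ler_pdivrMr// mulrC.
Qed.

Lemma powR_expRN_bounded x : exists2 C : R, 0 < C & forall t, 1 <= t -> t `^ x * expR (- t) <= C.
Proof.
pose m := (Num.truncn x).+1; exists m`!%:R; first by rewrite ltr0n fact_gt0.
move=> t t1; apply: le_trans (expr_expRN_le m (le_trans ler01 t1)).
rewrite ler_wpM2r ?expR_ge0// -powR_mulrn ?(le_trans ler01)//.
by apply: ler_powR => //; exact/ltW/truncnS_gt.
Qed.

Lemma gamma_density_ge0 x t : 0 <= gamma_density x t.
Proof. by rewrite mulr_ge0 ?powR_ge0 ?expR_ge0. Qed.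

Lemma gamma_density_cts x t : 0 < t -> {for t, continuous (gamma_density x)}.
Proof.
move=> t0; apply: cvgM; first exact: powR_cts.
have D : is_derive t 1 (fun s : R => expR (- s)) (expR (- t) * -1).
  by apply: is_derive1_comp.
exact: is_derive_cts D.
Qed.

(** [exp (- t)] decreases faster than any power, here than [(1 + t ^ x) ^ (-2)]. *)
Lemma gamma_density_le_slope x : 0 < x ->
  exists2 C : R, 0 < C & forall t, 0 < t -> gamma_density x t <= C * (x * sigmoid_slope x t).
Proof.
move=> x0; have [C C0 HC] := powR_expRN_bounded (x + x).
exists (4 * (C + 1) / x); first by rewrite divr_gt0// mulr_gt0//; lra.
move=> t t0; rewrite mulrA divfK ?gt_eqF// /sigmoid_slope mulrA ler_pdivlMr ?exprn_gt0 ?onepowR_gt0//.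
rewrite /gamma_density -[leLHS]mulrA [leLHS]mulrC ler_wpM2r ?powR_ge0//.
have e0 := expR_gt0 (- t).
have [t1|t1] := leP t 1.
  have H1 : t `^ x <= 1 by apply: powR_le1 => //; exact: ltW.
  have H2 : expR (- t) <= 1 by rewrite expR_le1; lra.
  have H3 := powR_ge0 t x.
  have H4 : (1 + t `^ x) ^+ 2 <= 4 by nra.
  apply: (@le_trans _ _ (1 * 4)); last lra.
  by apply: ler_pM => //; exact: sqr_ge0.
have H1 : 1 <= t `^ x by rewrite -[leLHS](powRr0 t); apply: ler_powR; lra.
have := HC t (ltW t1); rewrite powRD_gt0// => H2.
have H3 : (1 + t `^ x) ^+ 2 <= 4 * (t `^ x * t `^ x) by nra.
apply: le_trans (ler_wpM2l (ltW e0) H3) _; lra.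
Qed.

Let Dab := exhausted_ray (0 : R).

Lemma ray_gt0 t : `]0, +oo[%classic t -> 0 < t.
Proof. by rewrite /= in_itv /= andbT. Qed.

Lemma integrable_gamma_density x : 0 < x ->
  leb.-integrable `]0, +oo[ (EFin \o gamma_density x).
Proof.
move=> x0; have [C C0 HC] := gamma_density_le_slope x0.
have mg : measurable_fun (`]0, +oo[%classic : set R) (gamma_density x).
  by apply: (exhausted_measurable_fun Dab) => t /ray_gt0 t0; exact: gamma_density_cts.
have mk : measurable_fun (`]0, +oo[%classic : set R) (fun t => x * sigmoid_slope x t).
  apply: (exhausted_measurable_fun Dab) => t /ray_gt0 t0.
  by apply: cvgM; [exact: cvg_cst|exact: sigmoid_slope_cts].
apply/integrableP; split; first exact/measurable_EFinP.
have H : (\int[leb]_(t in `]0%R, +oo[) (C%:E * (x * sigmoid_slope x t)%:E) < +oo)%E.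
  rewrite ge0_integralZl//.
  - have -> : (\int[leb]_(t in `]0%R, +oo[) (x * sigmoid_slope x t)%:E)%E = 1%:E.
      rewrite -(integral_sigmoid_slope (0 : R) x0).
      by apply: eq_integral => t _; rewrite subr0.
    by rewrite mule1 ltry.
  - exact/measurable_EFinP.
  - by move=> t _; rewrite lee_fin mulr_ge0 ?sigmoid_slope_ge0// ltW.
  - by rewrite lee_fin ltW.
apply: le_lt_trans H; apply: ge0_le_integral => //.
- by apply: measurableT_comp => //; exact/measurable_EFinP.
- by apply: measurable_funeM; exact/measurable_EFinP.
move=> t /ray_gt0 t0; rewrite -EFinM lee_fin ger0_norm ?gamma_density_ge0//.
exact: HC.
Qed.

Lemma GammaE x : 0 < x ->
  (\int[leb]_(t in `]0%R, +oo[) (gamma_density x t)%:E)%E = (Gamma x)%:E.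
Proof.
by move=> x0; rewrite /Gamma /Rintegral fineK//; apply: integrable_fin_num => //; exact: integrable_gamma_density.
Qed.

Lemma Gamma_cvg x : 0 < x ->
  \int[leb]_(t in `[ray_lo 0 n, ray_hi 0 n]) gamma_density x t @[n --> \oo] --> Gamma x.
Proof.
move=> x0.
have := exhausted_cvg Dab (f := gamma_density x).
move=> /(_ (fun t Dt => gamma_density_cts (ray_gt0 Dt)) (fun t _ => gamma_density_ge0 x t)).
by rewrite GammaE// => /fine_cvgP[].
Qed.

Lemma powR_expRN_cvgy x : t `^ x * expR (- t) @[t --> +oo] --> 0.
Proof.
have [C C0 HC] := powR_expRN_bounded (x + 1).
have H : C * t `^ (-1) @[t --> +oo] --> 0.
  by rewrite -[X in _ --> X](mulr0 C); apply: cvgM; [exact: cvg_cst|exact: powRN_cvgy].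
apply: (squeeze_cvgr _ (cvg_cst (0 : R)) H); near=> t.
rewrite mulr_ge0 ?powR_ge0 ?expR_ge0//=.
have t1 : 1 <= t by near: t; exact: nbhs_pinfty_ge.
have t0 : 0 < t by lra.
have -> : t `^ x = t `^ (x + 1) * t `^ (-1) by rewrite -powRD_gt0//; congr (_ `^ _); ring.
by rewrite mulrAC ler_wpM2r ?powR_ge0// HC.
Unshelve. all: by end_near. Qed.

(** The difference of the two integrands is the derivative of
    [- t ^ x exp (- t)], which vanishes at both ends. *)
Lemma GammaS x : 0 < x -> Gamma (x + 1) = x * Gamma x.
Proof.
move=> x0; apply/eqP; rewrite -subr_eq0; apply/eqP.
have x10 : 0 < x + 1 by lra.
pose F t := - (t `^ x * expR (- t)).
pose f t := gamma_density (x + 1) t - x * gamma_density x t.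
have DF t : 0 < t -> is_derive t 1 F (f t).
  move=> t0.
  have D : is_derive t 1 (fun s : R => expR (- s)) (expR (- t) * -1).
    by apply: is_derive1_comp.
  apply: (is_derive_ext (is_deriveN (is_deriveM (is_derive1_powR x t0) D))) => //.
  by rewrite /GRing.scale /= /f /gamma_density addrK; ring.
have cf t : `]0, +oo[%classic t -> {for t, continuous f}.
  move=> /ray_gt0 t0; apply: cvgB; first exact: gamma_density_cts.
  by apply: cvgM; [exact: cvg_cst|exact: gamma_density_cts].
have E n : \int[leb]_(t in `[ray_lo 0 n, ray_hi 0 n]) gamma_density (x + 1) t -
    x * \int[leb]_(t in `[ray_lo 0 n, ray_hi 0 n]) gamma_density x t =
    F (ray_hi 0 n) - F (ray_lo 0 n).
  have := exhausted_FTC2 Dab n (F := F) cf (fun t Dt => DF t (ray_gt0 Dt)).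
  move=> /(congr1 fine) /= <-.
  rewrite -[RHS]/(\int[leb]_(t in `[ray_lo 0 n, ray_hi 0 n]) f t) /f.
  have ci y : leb.-integrable `[ray_lo 0 n, ray_hi 0 n] (EFin \o gamma_density y).
    apply: continuous_compact_integrable; first exact: segment_compact.
    by apply: (exhausted_cts_in Dab) => t /ray_gt0 t0; exact: gamma_density_cts.
  rewrite RintegralB//; first by rewrite RintegralZl.
  apply: continuous_compact_integrable; first exact: segment_compact.
  apply: (exhausted_cts_in Dab) => t /ray_gt0 t0.
  by apply: cvgM; [exact: cvg_cst|exact: gamma_density_cts].
have H1 := cvgB (Gamma_cvg x10) (cvgM (cvg_cst x) (Gamma_cvg x0)).
have H2 : F (ray_hi 0 n) - F (ray_lo 0 n) @[n --> \oo] --> 0 - 0.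
  apply: cvg_ray_increment.
    rewrite -[X in _ --> X]oppr0; apply: cvgN; rewrite -[X in _ --> X](mul0r (expR (- 0))).
    apply: cvgM; first exact: powR_cvg0.
    apply: cvg_at_right_filter.
    have D : is_derive (0 : R) 1 (fun s : R => expR (- s)) (expR (- 0) * -1).
      by apply: is_derive1_comp.
    exact: is_derive_cts D.
  by rewrite -[X in _ --> X]oppr0; apply: cvgN; exact: powR_expRN_cvgy.
rewrite subrr in H2.
have H3 : F (ray_hi 0 n) - F (ray_lo 0 n) @[n --> \oo] --> Gamma (x + 1) - x * Gamma x.
  by under eq_fun do rewrite -E; exact: H1.
by apply: (cvg_unique _ H3 H2).
Qed.

(** The integrand has a positive lower bound on [[1, 2]]. *)
Lemma Gamma_gt0 x : 0 < x -> 0 < Gamma x.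
Proof.
move=> x0; rewrite -lte_fin -GammaE//.
pose m := Num.min 1 (2 `^ (x - 1)) * expR (- 2).
have m0 : 0 < m by rewrite mulr_gt0 ?expR_gt0// lt_min ltr01 powR_gt0.
have mg : measurable_fun (`]0, +oo[%classic : set R) (EFin \o gamma_density x).
  apply/measurable_EFinP; apply: (exhausted_measurable_fun Dab) => t /ray_gt0 t0.
  exact: gamma_density_cts.
have sub : `[1, 2]%classic `<=` (`]0, +oo[%classic : set R).
  by move=> t; rewrite /= !in_itv /= andbT => /andP[t1 _]; lra.
apply: (@lt_le_trans _ _ (\int[leb]_(t in `[1%R, 2%R]) (cst m%:E t))%E).
  rewrite integral_cst//= lebesgue_measure_itv /= lte_fin ltr1n.
  by rewrite -EFinB -EFinM lte_fin mulr_gt0//; lra.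
apply: (@le_trans _ _ (\int[leb]_(t in `[1%R, 2%R]) (gamma_density x t)%:E)%E); last first.
  apply: ge0_subset_integral => // t _; rewrite lee_fin gamma_density_ge0//.
apply: ge0_le_integral => //.
- by move=> t _; rewrite lee_fin ltW.
- by apply: measurable_funS mg.
move=> t /=; rewrite in_itv /= => /andP[t1 t2]; rewrite lee_fin /m /gamma_density.
apply: ler_pM.
- by rewrite le_min ler01 powR_ge0.
- exact: expR_ge0.
- rewrite ge_min; have [x1|x1] := leP 1 x.
    by apply/orP; left; rewrite -[leLHS](powRr0 t); apply: ler_powR; lra.
  rewrite -[x - 1]opprB; apply/orP; right; apply: powRN_anti; lra.
- by rewrite ler_expR lerN2.
Qed.

End EulerGamma.

Lemma Gamma1 (R : realType) : Gamma (1 : R) = 1.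
Proof.
apply: EFin_inj; rewrite -GammaE ?ltr01//.
have DF (t : R) : is_derive t 1 (fun s : R => - expR (- s)) (gamma_density 1 t).
  have D : is_derive t 1 (fun s : R => expR (- s)) (expR (- t) * -1).
    by apply: is_derive1_comp.
  apply: (is_derive_ext (is_deriveN D)) => //.
  by rewrite /gamma_density subrr powRr0; ring.
have c0 : - expR (- t) @[t --> (0 : R)^'+] --> - expR (- 0).
  by apply: cvg_at_right_filter; exact: is_derive_cts (DF 0).
have cy : - expR (- t) @[t --> +oo] --> - (0 : R).
  by apply: cvgN; exact: cvgr_expR.
apply: (ge0_integral_primitive (exhausted_ray (0 : R)) (F := fun s : R => - expR (- s))).
- by move=> t /ray_gt0 t0; exact: gamma_density_cts.
- by move=> t _; exact: gamma_density_ge0.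
by have := cvg_ray_increment c0 cy; rewrite !oppr0 expR0 opprK add0r.
Qed.

Lemma Gamma_nat (R : realType) (k : nat) : Gamma (k%:R + 1 : R) = k`!%:R.
Proof.
elim: k => [|k IH]; first by rewrite add0r Gamma1.
rewrite GammaS ?ltr0n// -natr1 IH natr1 -natrM mulnC mulnC.
by rewrite -factS.
Qed.

(** * Integrability of [g] and Euler's Beta integral *)

Lemma in_L_gfun_half_line (R : realType) (ga al mu : R) : 0 <= ga -> 0 < al ->
  1 < al * (mu + 1) - ga -> in_L_ray 0 (gfun ga al mu).
Proof.
move=> ga0 al0 de1; have de0 : 0 < al * (mu + 1) - ga by lra.
pose b := Num.min 1 (al * (mu + 1) - ga - 1).
have b0 : 0 < b by rewrite lt_min ltr01; lra.
have [b1 bd] : b <= 1 /\ b <= al * (mu + 1) - ga - 1 by rewrite /b !ge_min !lexx ?orbT.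
have e0 x : 0 <= x -> gfun ga al mu x = gder_ray ga al mu 0 x by exact: gfun_gder_ray0.
have nn : nonneg_exponents ga al mu 0.
  by move=> i _; rewrite subr0 addr_ge0// mulr_ge0// ltW.
apply: (@in_L_ray_of_slope _ b 0 4) => //.
  apply: subspace_eq_continuous (gder_ray_cts al0 nn) => x; rewrite inE /= in_itv /= andbT => x0.
  by rewrite /from_subspace e0.
move=> x x0; rewrite e0 ?(ltW x0)// gder_ray0 subr0 ger0_norm ?pterm_ge0//.
have mu0 := mu1_gt0 ga0 al0 de0.
by have := @pterm_le_slope _ al (ga + 1) (mu + 1) b x b0; rewrite addrK; apply => //; lra.
Qed.

Definition unit_lo (R : realType) (n : nat) : R := n.+3%:R^-1.
Definition unit_hi (R : realType) (n : nat) : R := 1 - n.+3%:R^-1.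

Lemma exhausted_unit (R : realType) :
  exhausted_by (`]0, 1[%classic : set R) (@unit_lo R) (@unit_hi R).
Proof.
rewrite /unit_lo /unit_hi.
have I3 n : n.+3%:R^-1 <= 3^-1 :> R.
  by rewrite lef_pV2 ?posrE ?ltr0n// ler_nat.
have IS n : n.+4%:R^-1 <= n.+3%:R^-1 :> R.
  by rewrite lef_pV2 ?posrE ?ltr0n// ler_nat.
have I0 n : 0 < n.+3%:R^-1 :> R by rewrite invr_gt0 ltr0n.
split.
- by move=> n /=; move: (I3 n); move: (n.+3%:R^-1 : R) => z; lra.
- by move=> n /=; move: (IS n); move: (n.+3%:R^-1 : R) (n.+4%:R^-1 : R) => z w; split; lra.
apply/seteqP; split => x /=.
  rewrite in_itv /= => /andP[x0 x1]; have y0 : 0 < 1 - x by rewrite subr_gt0.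
  pose M := Num.max x^-1 (1 - x)^-1; exists (Num.truncn M) => //=.
  have := truncnS_gt M; rewrite {2}/M gt_max => /andP[h1 h2].
  have L (z : R) : 0 < z -> z^-1 < (Num.truncn M).+1%:R -> (Num.truncn M).+3%:R^-1 <= z.
    move=> z0 zM; rewrite -[leRHS]invrK lef_pV2 ?posrE ?invr_gt0//.
    by apply: le_trans (ltW zM) _; rewrite ler_nat; lia.
  by rewrite in_itv /= L//= lerBrDl -lerBrDr; exact: L.
by move=> [n _]; rewrite /= !in_itv /= => /andP[h1 h2]; move: (I0 n) h1 h2; move: (n.+3%:R^-1 : R) => z; lra.
Qed.

Section Primitive.
Context (R : realType) (c a : nat) (mu : R).
Hypothesis a0 : (0 < a)%N.
Hypothesis de1 : 1 < a%:R * (mu + 1) - c%:R.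
Let g := gder_nat c a mu 0.

Let de0 : 0 < a%:R * (mu + 1) - c%:R. Proof. by move: de1; lra. Qed.

Lemma in_L_gfun_ray (q : R) : -1 < q -> q <= 0 -> in_L_ray q (gfun c%:R a%:R mu).
Proof.
move=> q1 q0; have [K K0 HK] := gder_nat_bound a0 de0 0 q1 q0.
pose b := Num.min 1 (a%:R * (mu + 1) - c%:R - 1).
have b0 : 0 < b by rewrite lt_min ltr01; move: de1; lra.
have [b1 bd] : b <= 1 /\ b <= a%:R * (mu + 1) - c%:R - 1 by rewrite /b !ge_min !lexx ?orbT.
apply: (@in_L_ray_of_slope _ b q (K * 4)) => //.
  rewrite (_ : gfun _ _ _ = gder_nat c a mu 0); last by apply/funext => x; exact: gfun_gder_nat0.
  by apply: gder_nat_within_cts => // x /=; rewrite in_itv /= andbT; exact: lt_le_trans.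
move=> x qx; rewrite gfun_gder_nat0; apply: le_trans (HK x (ltW qx)) _.
rewrite -mulrA ler_wpM2l ?(ltW K0)//.
have y0 : 0 < x - q by rewrite subr_gt0.
apply: le_trans (decay_le_slope b0 b1 y0).
have z1 : 1 <= 1 + (x - q) by lra.
rewrite addr0; apply: (@le_trans _ _ ((1 + (x - q)) `^ (- (a%:R * (mu + 1) - c%:R)))).
  apply: powRN_anti; [lra| |exact: ltW].
  rewrite ler_pdivlMr; last lra.
  nra.
by apply: ler_powR => //; rewrite lerN2; lra.
Qed.

(** The primitive is monotone on the nonnegative half line and bounded there, since
    [delta > 1] makes [g] smaller than a slope. *)
Lemma primitive_gder_nat : exists G : R -> R, exists l : R,
  (forall x : R, - (3 / 4) < x -> is_derive x 1 G (g x)) /\ G x @[x --> +oo] --> l.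
Proof.
pose G0 (x : R) := \int[@lebesgue_measure R]_(t in `[- (3 / 4), x]) g t.
have gc (x : R) : -1 < x -> {for x, continuous g}.
  by move=> x1; exact: is_derive_cts (is_derive_gder_nat c mu a0 0 x1).
have DG (x : R) : - (3 / 4) < x -> is_derive x 1 G0 (g x).
  move=> x1; have xu : x < x + 1 by lra.
  have [] := @continuous_FTC1_closed _ g (- (3 / 4)) x (x + 1) xu _ x1 _.
  - apply: continuous_compact_integrable; first exact: segment_compact.
    by apply: gder_nat_within_cts => // y /=; rewrite in_itv /= => /andP[y1 _]; lra.
  - by apply: gc; lra.
  by move=> D1 D2; split; [exact: D1|rewrite -derive1E; exact: D2].
have cG (A : set R) : (forall x, A x -> - (3 / 4) < x) -> {within A, continuous G0}.
  move=> HA; apply: continuous_in_subspaceT => x; rewrite inE => /HA x1.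
  exact: is_derive_cts (DG x x1).
have g0 (x : R) : 0 <= x -> 0 <= g x.
  by move=> x0; rewrite mulr_ge0 ?powR_ge0//= hornerXn exprn_ge0.
have mono (x y : R) : 0 <= x -> x <= y -> G0 x <= G0 y.
  move=> x0 xy; apply: (@nondecr_of_derive _ G0 g) => //.
  - by move=> z /andP[xz _]; apply: DG; lra.
  - by move=> z /andP[xz _]; apply: g0; lra.
  - by apply: cG => z /=; rewrite in_itv /= => /andP[xz _]; lra.
pose b := Num.min 1 (a%:R * (mu + 1) - c%:R - 1).
have b0 : 0 < b by rewrite lt_min ltr01; move: de1; lra.
have [b1 bd] : b <= 1 /\ b <= a%:R * (mu + 1) - c%:R - 1 by rewrite /b !ge_min !lexx ?orbT.
have gk (x : R) : 0 < x -> `|g x| <= 4 * sigmoid_slope b x.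
  move=> x0; rewrite ger0_norm ?g0 ?(ltW x0)//.
  have -> : g x = pterm a%:R (c%:R + 1 - 1) (mu + 1) x.
    rewrite /g /gder_nat /pterm /= hornerXn addrK addr0.
    by rewrite !powR_mulrn// ltW.
  apply: pterm_le_slope => //.
  - by have := ler0n R c; lra.
  - by lra.
  - have A0 : 0 < a%:R :> R by rewrite ltr0n.
    have : 0 < a%:R * (mu + 1) by have := ler0n R c; move: de0; lra.
    by rewrite pmulr_rgt0.
  - by rewrite ltr0n.
have bnd (x : R) : 0 <= x -> G0 x <= G0 0 + 4 / b.
  move=> x0; have : `|G0 x - G0 0| <= 4 / b * sigmoid b x - 4 / b * sigmoid b 0.
    have D1 (z : R) : 0 < z < x -> is_derive z 1 G0 (g z).
      by move=> /andP[xz _]; apply: DG; lra.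
    have D2 (z : R) : 0 < z < x ->
        is_derive z 1 (fun x => 4 / b * sigmoid b x) (4 * sigmoid_slope b z).
      move=> /andP[z0 _].
      apply: (is_derive_ext (is_deriveZ (4 / b) (is_derive_sigmoid b z0))) => //.
      by rewrite /GRing.scale /= [LHS]mulrA divfK// gt_eqF.
    have D3 (z : R) : 0 < z < x -> `|g z| <= 4 * sigmoid_slope b z.
      by move=> /andP[z0 _]; exact: gk.
    have c1 : {within `[0, x], continuous G0}.
      by apply: cG => z /=; rewrite in_itv /= => /andP[xz _]; lra.
    have c2 : {within `[0, x], continuous (fun x => 4 / b * sigmoid b x)}.
      apply: (@within_ray_segment _ 0) => //.
      by move=> z; apply: cvgM; [exact: cvg_cst|exact: sigmoid_cts].
    exact: (increment_le_of_derive x0 D1 D2 D3 c1 c2).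
  move=> /(le_trans (ler_norm _)); rewrite sigmoid0//.
  have /andP[_ s0] := sigmoid_bounds b x.
  have b4 : 0 <= 4 / b by rewrite divr_ge0// ltW.
  nra.
(* [G0] need not be monotone to the left of [0] *)
pose G1 (x : R) := G0 (Num.max x 0).
have cv : G1 x @[x --> +oo] --> sup (range G1).
  apply: nondecreasing_cvgr.
    move=> x y xy; apply: mono; first by rewrite le_max lexx orbT.
    by rewrite ge_max !le_max lexx xy orbT.
  exists (G0 0 + 4 / b) => _ [x _ <-]; apply: bnd.
  by rewrite le_max lexx orbT.
exists G0, (sup (range G1)); split => //.
apply: cvg_trans cv; apply: near_eq_cvg; near=> x.
have x0 : 0 < x by near: x; exact: nbhs_pinfty_gt.
by rewrite /G1 max_l// ltW.
Unshelve. all: by end_near. Qed.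

(** Substitution [s = x ^ a / (1 + x ^ a)], carried out on the primitives. *)
Lemma Beta_primitive (G : R -> R) (l : R) :
  (forall x : R, - (3 / 4) < x -> is_derive x 1 G (g x)) -> G x @[x --> +oo] --> l ->
  Beta ((c%:R + 1) / a%:R) (mu + 1 - (c%:R + 1) / a%:R) = a%:R * (l - G 0).
Proof.
move=> DG Gl; have A0 : 0 < a%:R :> R by rewrite ltr0n.
have An : a%:R != 0 :> R by rewrite gt_eqF.
pose p : R := (c%:R + 1) / a%:R.
(* the inverse of the substitution [s = x ^ a / (1 + x ^ a)] *)
pose phi (s : R) : R := (s / (1 - s)) `^ a%:R^-1.
pose f (s : R) : R := s `^ (p - 1) * (1 - s) `^ (mu + 1 - p - 1).
have D01 (s : R) : `]0, 1[%classic s -> 0 < s /\ 0 < 1 - s.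
  by rewrite /= in_itv /= => /andP[? ?]; split; lra.
have D1m (s : R) : is_derive s 1 (fun x : R => 1 - x) (-1).
  by have := is_deriveB (@is_derive_cst R R R 1 s 1) (@is_derive_id R R s 1); rewrite sub0r.
have DF (s : R) : `]0, 1[%classic s -> is_derive s 1 (fun x => a%:R * G (phi x)) (f s).
  move=> /D01[s0 t0]; have tn : 1 - s != 0 by rewrite gt_eqF.
  have y0 : 0 < s / (1 - s) by rewrite divr_gt0.
  have D2 := is_deriveM (@is_derive_id R R s 1)
    (@is_deriveV _ (fun x : R => 1 - x) s _ _ tn (D1m s)).
  have D3 := @is_derive1_comp _ (fun y : R => y `^ a%:R^-1)
    (fun x : R => x / (1 - x)) _ _ _ (is_derive1_powR a%:R^-1 y0) D2.
  have ph0 : - (3 / 4) < phi s by have := powR_ge0 (s / (1 - s)) a%:R^-1; rewrite -/(phi s); lra.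
  apply: (is_derive_ext (is_deriveZ a%:R (@is_derive1_comp _ G phi _ _ _ (DG _ ph0) D3))) => //.
  rewrite /GRing.scale /= /g /gder_nat /= hornerXn addr0.
  have phn (k : nat) : phi s ^+ k = (s / (1 - s)) `^ (k%:R / a%:R).
    by rewrite -powR_mulrn ?powR_ge0// -powRrM; congr (_ `^ _); rewrite mulrC.
  rewrite !phn divff// powRr1 ?(ltW y0)//.
  have -> : s / (1 - s) + 1 = (1 - s) `^ (-1).
    by rewrite powR_inv1 ?(ltW t0)//; field.
  rewrite -powRrM mulN1r opprK.
  have yE e : (s / (1 - s)) `^ e = s `^ e * (1 - s) `^ (- e).
    rewrite powRM ?invr_ge0 ?(ltW s0) ?(ltW t0)//; congr (_ * _).
    by rewrite -[(1 - s)^-1]powR_inv1 ?(ltW t0)// -powRrM mulN1r.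
  have E2 : (1 - s)^-1 + s * ((1 - s) ^- 2) = (1 - s) `^ (- 2).
    have -> : - 2 = (-1) + (-1) :> R by ring.
    by rewrite powRD_gt0// powR_inv1 ?(ltW t0)//; field.
  have -> : s * (- (1 - s) ^- 2 * -1) + (1 - s)^-1 * 1 = (1 - s) `^ (- 2).
    by rewrite -E2; ring.
  rewrite !yE /f.
  have -> : p - 1 = c%:R / a%:R + (a%:R^-1 - 1) by rewrite /p; field.
  have -> : mu + 1 - p - 1 = - (c%:R / a%:R) + (mu + 1) + (- (a%:R^-1 - 1)) + (- 2).
    by rewrite /p; field.
  rewrite !(powRD_gt0 _ _ s0) !(powRD_gt0 _ _ t0).
  by field.
have -> : Beta p (mu + 1 - p) = fine (a%:R * l - a%:R * G 0)%:E; last by rewrite /= mulrBr.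
rewrite /Beta /Rintegral; congr fine.
apply: (ge0_integral_primitive (exhausted_unit R) (F := fun x => a%:R * G (phi x))).
- move=> s /D01[s0 t0]; apply: cvgM; first exact: powR_cts.
  have := continuous_comp (is_derive_cts (D1m s)) (powR_cts (p := mu + 1 - p - 1) t0).
  by apply.
- by move=> s _; rewrite mulr_ge0 ?powR_ge0.
have h0 n : (1 - n.+3%:R^-1) / n.+3%:R^-1 = n.+2%:R :> R.
  by rewrite invrK mulrBl mul1r mulVf ?pnatr_eq0// -[n.+3%:R]natr1 addrK.
have h1 n : @unit_hi R n / (1 - @unit_hi R n) = n.+2%:R.
  by rewrite /unit_hi subKr h0.
have h2 n : @unit_lo R n / (1 - @unit_lo R n) = n.+2%:R^-1.
  by rewrite /unit_lo -invf_div h0.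
apply: cvgB; apply: cvgM; try exact: cvg_cst.
  move/cvg_pinftyP : Gl; apply.
  apply/cvgryPge => A; near=> n; rewrite /phi h1.
  apply: (le_trans (ler_norm A)).
  have -> : `|A| = (`|A| `^ a%:R) `^ a%:R^-1 by rewrite -powRrM mulfV// powRr1.
  apply: ge0_ler_powR; rewrite ?nnegrE ?powR_ge0// ?invr_ge0 ?(ltW A0)//.
  apply: (@le_trans _ _ n%:R); last by rewrite ler_nat; lia.
  near: n; have /cvgryPge := @cvgr_idn R; exact.
have cG0 : {for 0, continuous G} by apply: is_derive_cts (DG 0 _); lra.
have cp : phi (@unit_lo R n) @[n --> \oo] --> 0.
  under eq_fun do rewrite /phi h2.
  have inv0 : 0 < a%:R^-1 :> R by rewrite invr_gt0.
  have /cvg_at_rightP := powR_cvg0 inv0.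
  apply; split; first by move=> n; rewrite invr_gt0 ltr0n.
  by have := @cvg_harmonic R; rewrite -cvg_shiftS; exact.
by have := continuous_cvg _ cG0 cp; apply.
Unshelve. all: by end_near. Qed.

End Primitive.

(** * Polynomials small at the origin and Taylor's formula *)

(** The constant coefficient is the limit at [0]; divide by ['X] and repeat.  This
    replaces the uniqueness of power series expansions. *)
Lemma poly_small_coef (R : realType) (M : nat) (p : {poly R}) (C d : R) :
  0 < d -> (forall x, 0 < x -> x < d -> `|p.[x]| <= C * x ^+ M) ->
  forall i, (i < M)%N -> p`_i = 0.
Proof.
move=> d0; elim: M p => [//|M IH] p H.
have [q [c pE]] : exists q c, p = q * 'X + c%:P.
  by elim/poly_ind: p {H} => [|q c _]; [exists 0, 0; rewrite mul0r add0r|exists q, c].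
have c0 : c = 0.
  have P0 : p.[x] @[x --> 0^'+] --> p.[0].
    by apply: cvg_at_right_filter; exact: is_derive_cts (is_derive_poly p 0).
  have X0 : C * x ^+ M.+1 @[x --> 0^'+] --> 0.
    rewrite [X in _ --> X](_ : 0 = (C *: 'X^(M.+1) : {poly R}).[0]); last first.
      by rewrite hornerZ hornerXn expr0n mulr0.
    under eq_fun => x do rewrite -(hornerXn x) -hornerZ.
    by apply: cvg_at_right_filter; exact: is_derive_cts (is_derive_poly _ 0).
  have XN : - (C * x ^+ M.+1) @[x --> 0^'+] --> 0 by rewrite -[X in _ --> X]oppr0; exact: cvgN.
  have P1 : p.[x] @[x --> 0^'+] --> 0.
    apply: (squeeze_cvgr _ XN X0); near=> x; rewrite -ler_norml; apply: H.
      by near: x; exact: nbhs_right_gt.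
    by near: x; exact: nbhs_right_lt.
  have : p.[0] = 0 by apply: (cvg_unique _ P0 P1).
  by rewrite pE hornerD hornerM hornerX mulr0 add0r hornerC.
have Hq x : 0 < x -> x < d -> `|q.[x]| <= C * x ^+ M.
  move=> x0 xd; have := H x x0 xd.
  rewrite pE c0 addr0 hornerM hornerX normrM [X in _ * X]gtr0_norm//.
  by rewrite exprSr mulrA ler_pM2r.
move=> [|i] iM; first by rewrite pE c0 addr0 coefMX.
by rewrite pE c0 addr0 coefMX /=; exact: IH Hq _ _.
Unshelve. all: by end_near. Qed.

(** With the constant [1] instead of [1 / M!] one application of the mean value
    theorem bounds the remainder of order [M + 1] by the one of order [M] of the
    derivative. *)
Lemma taylor_bound (R : realType) (m : R) (M : nat) :
  forall (F : nat -> R -> R) (x s B : R),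
  (forall n (y : R), m < y -> is_derive y 1 (F n) (F n.+1 y)) ->
  m < x -> m < x + s ->
  (forall y, m < y -> `|y - x| <= `|s| -> `|F M y| <= B) ->
  `|F 0%N (x + s) - \sum_(i < M) F i x * (s ^+ i / i`!%:R)| <= B * `|s| ^+ M.
Proof.
elim: M => [|M IH] F x s B DF mx ms HB.
  rewrite big_ord0 subr0 expr0 mulr1; apply: HB => //.
  by rewrite addrC addKr.
(* a parameter in [0, 1] treats both signs of [s] alike *)
pose r (th : R) := F 0%N (x + th * s) - \sum_(i < M.+1) F i x * ((th * s) ^+ i / i`!%:R).
pose dr (th : R) := s * (F 1%N (x + th * s) - \sum_(i < M) F i.+1 x * ((th * s) ^+ i / i`!%:R)).
have mth th : 0 <= th <= 1 -> m < x + th * s.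
  move=> /andP[t0 t1]; have [s0|s0] := leP 0 s.
    by have : 0 <= th * s by [exact: mulr_ge0]; lra.
  by have : s <= th * s by [nra]; lra.
have Dths (th : R) : is_derive th 1 (fun t : R => t * s) s.
  apply: (is_derive_ext (is_deriveM (@is_derive_id R R th 1) (@is_derive_cst R R R s th 1))) => //.
  by rewrite /GRing.scale /= mulr0 add0r mulr1.
have Dr (th : R) : 0 <= th <= 1 -> is_derive th 1 r (dr th).
  move=> t01.
  have D1 : is_derive th 1 (fun t : R => x + t * s) s.
    by have := is_deriveD (@is_derive_cst R R R x th 1) (Dths th); rewrite add0r.
  have D2 := @is_derive1_comp _ (F 0%N) (fun t : R => x + t * s) _ _ _ (DF 0%N _ (mth _ t01)) D1.
  have D3 (i : 'I_M.+1) : is_derive th 1 (fun t : R => F i x * ((t * s) ^+ i / i`!%:R))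
      (if i : nat is j.+1 then s * (F j.+1 x * ((th * s) ^+ j / j`!%:R)) else 0).
    have D4 := @is_derive1_comp _ (horner ((F i x / i`!%:R) *: 'X^i)) (fun t : R => t * s)
      _ _ _ (is_derive_poly _ _) (Dths th).
    apply: (is_derive_ext D4) => [t|].
      by rewrite /= hornerZ hornerXn mulrAC mulrA.
    rewrite derivZ derivXn hornerZ hornerMn hornerXn.
    case: (nat_of_ord i) => [|j]; first by rewrite mulr0n mulr0 mul0r.
    rewrite factS natrM /= -mulr_natl.
    have f0 : j`!%:R != 0 :> R by rewrite pnatr_eq0 -lt0n fact_gt0.
    have j0 : j.+1%:R != 0 :> R by rewrite pnatr_eq0.
    by field; rewrite f0 nat1r j0.
  apply: (is_derive_ext (is_deriveB D2 (is_derive_sum D3))) => [t|].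
    by rewrite /r fct_sumE.
  by rewrite /dr mulrBr mulr_sumr big_ord_recl /= add0r mulrC.
have cr : {within `[0, 1], continuous r}.
  apply: continuous_in_subspaceT => t; rewrite inE /= in_itv /= => t01.
  exact: is_derive_cts (Dr t t01).
have [] := @MVT _ r dr 0 1 ltr01 _ cr.
  by move=> t; rewrite in_itv /= => /andP[t0 t1]; apply: Dr; rewrite !ltW.
move=> th; rewrite in_itv /= => /andP[t0 t1]; rewrite subr0 mulr1 => E.
have r0 : r 0 = 0.
  rewrite /r mul0r addr0 big_ord_recl expr0 fact0 divr1 mulr1 big1 ?addr0 ?subrr// => i _.
  by rewrite /= exprS !mul0r mulr0.
rewrite r0 subr0 /r !mul1r in E; rewrite E /dr normrM exprS mulrCA ler_wpM2l//.
have t01 : 0 <= th <= 1 by rewrite !ltW.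
have ns : `|th * s| <= `|s| by rewrite normrM gtr0_norm// ler_piMl// ltW.
have B0 : 0 <= B by apply: le_trans (normr_ge0 (F M.+1 x)) (HB x mx _); rewrite subrr normr0.
apply: le_trans (IH (fun n => F n.+1) x (th * s) B _ mx (mth _ t01) _) _.
  by move=> y my yx; apply: HB => //; exact: le_trans ns.
by rewrite ler_wpM2l// lerXn2r ?nnegrE.
Qed.

(** * A summation formula with unspecified coefficients *)

Lemma le_of_eq (R : realType) (x y : R) : x = y -> x <= y.
Proof. by move=> ->. Qed.

Lemma sum_triangle (V : nmodType) (G : nat -> nat -> V) (M : nat) :
  \sum_(j < M) \sum_(i < M - j) G j (j + i)%N =
  \sum_(n < M) \sum_(j < n.+1) G j n.
Proof.
elim: M => [|M IH]; first by rewrite !big_ord0.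
rewrite big_ord_recr [RHS]big_ord_recr /= -IH.
rewrite subSn// subnn big_ord1 addn0 [in RHS]big_ord_recr /= addrA -big_split /=.
congr (_ + _); apply: eq_bigr => j _.
by rewrite subSn ?(ltnW (ltn_ord j))// big_ord_recr /= subnKC// ltnW.
Qed.

(** A Riemann sum of [(1 + y) ^ (-2)], bounded by telescoping
    [(1 + h m) ^ (-1) - (1 + h (m + 1)) ^ (-1)]. *)
Lemma sum_inv_sqr_le (R : realType) (h : R) (n : nat) : 0 < h ->
  \sum_(k < n) h / (1 + h * k%:R) ^+ 2 <= 1 + h.
Proof.
move=> h0; have p0 k : 0 < 1 + h * k%:R by rewrite ltr_pwDl// mulr_ge0// ltW.
have H m : \sum_(k < m.+1) h / (1 + h * k%:R) ^+ 2 <= 1 + h - (1 + h * m%:R)^-1.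
  elim: m => [|m IH]; first by rewrite big_ord1 mulr0 addr0 expr1n invr1; lra.
  rewrite big_ord_recr /=.
  suff : h / (1 + h * m.+1%:R) ^+ 2 <= (1 + h * m%:R)^-1 - (1 + h * m.+1%:R)^-1.
    by move: IH; lra.
  have -> : (1 + h * m%:R)^-1 - (1 + h * m.+1%:R)^-1 =
      h / ((1 + h * m.+1%:R) * (1 + h * m%:R)).
    have := p0 m; have := p0 m.+1; rewrite -natr1 => a1 a2.
    by field; rewrite !gt_eqF.
  rewrite ler_wpM2l ?(ltW h0)// lef_pV2 ?posrE ?mulr_gt0 ?exprn_gt0//.
  by rewrite expr2 ler_wpM2l ?(ltW (p0 _))// lerD2l ler_wpM2l ?(ltW h0)// ler_nat.
case: n => [|m]; first by rewrite big_ord0; lra.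
by apply: le_trans (H m) _; have := p0 m; rewrite -invr_gt0; lra.
Qed.

Lemma abs_summable_cvg (R : realType) (v : nat -> R) (C : R) :
  (forall n, \sum_(k < n) `|v k| <= C) ->
  exists2 l, series v n @[n --> \oo] --> l & `|l| <= C.
Proof.
move=> H.
have cv : cvgn (series v).
  apply: normed_cvg; apply: nondecreasing_is_cvgn.
    by apply: nondecreasing_series => k _ _; exact: normr_ge0.
  by exists C => _ [n _ <-]; rewrite -[leLHS]/(series (fun k => `|v k|) n) seriesEord; exact: H.
exists (limn (series v)) => //.
have cn : `|series v n| @[n --> \oo] --> `|limn (series v)| by exact: cvg_norm.
apply: (cvgr_to_le cn).
near=> n; rewrite seriesEord.
exact: le_trans (ler_norm_sum _ _ _) (H n).
Unshelve. all: by end_near. Qed.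

Section Summation.
Context (R : realType) (F : nat -> R -> R) (M : nat) (sg K : R) (e r : nat -> R).
Hypothesis sg1 : `|sg| = 1.
Hypothesis DF : forall n (y : R), - 2^-1 < y -> is_derive y 1 (F n) (F n.+1 y).
Hypothesis FM : forall y : R, - 2^-1 < y -> `|F M.+1 y| <= K / (1 + y) ^+ 2.
Hypothesis Fy : forall n, F n y @[y --> +oo] --> 0.
Hypothesis er : forall n, (n < M.+1)%N ->
  e n - sg * \sum_(i < n.+1) e i / (n - i)`!%:R = r n.

Let K0 : 0 <= K.
Proof.
have := le_trans (normr_ge0 _) (FM (y := 0) _); rewrite addr0 expr1n divr1.
by apply; lra.
Qed.

(** Moving by at most [1 / 2] at most halves [1 + x]. *)
Lemma decay_near_grid (x s y : R) : 0 <= x -> `|s| <= 2^-1 -> - 2^-1 < y ->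
  `|y - x| <= `|s| -> `|F M.+1 y| <= 4 * K / (1 + x) ^+ 2.
Proof.
move=> x0 s2 y2 yx; apply: le_trans (FM y2) _.
have H : (1 + x) / 2 <= 1 + y.
  have : - (y - x) <= 2^-1.
    by apply: le_trans (ler_norm _) _; rewrite normrN; exact: le_trans s2.
  lra.
have p0 : 0 < (1 + x) / 2 by lra.
have H2 : ((1 + x) / 2) ^+ 2 <= (1 + y) ^+ 2 by rewrite lerXn2r ?nnegrE; lra.
have -> : 4 * K / (1 + x) ^+ 2 = K / ((1 + x) / 2) ^+ 2.
  by field; rewrite gt_eqF//; lra.
by rewrite ler_wpM2l// lef_pV2 ?posrE ?exprn_gt0//; lra.
Qed.

(** The truncation of [e (D)] applied to [F] at the grid point [h k], where
    [e (s) = sum_j e_j s ^ j] and [D] is the differentiation operator, [F j] being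
    the [j]-th derivative of [F 0]. *)
Definition formal_sum (h : R) (k : nat) : R :=
  \sum_(j < M.+1) e j * (h ^+ j * F j (h * k%:R)).

(** Shifting by [h] is [exp (h D)], so the hypothesis on [e], that is
    [e (s) (1 - sg exp s) = r (s)], makes the difference a sum of Taylor
    remainders. *)
Lemma formal_sum_step (h : R) (k : nat) : 0 < h -> h <= 2^-1 ->
  `|formal_sum h k - sg * formal_sum h k.+1 -
    \sum_(n < M.+1) r n * (h ^+ n * F n (h * k%:R))| <=
  (\sum_(j < M.+1) `|e j|) * (4 * K) * (h ^+ M.+1 / (1 + h * k%:R) ^+ 2).
Proof.
move=> h0 h2; set x := h * k%:R.
have x0 : 0 <= x by rewrite mulr_ge0// ltW.
have xh : h * k.+1%:R = x + h by rewrite -natr1 mulrDr mulr1.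
pose T (j : nat) := \sum_(i < M.+1 - j) F (j + i)%N x * (h ^+ i / i`!%:R).
have HT (j : 'I_M.+1) : `|F j (x + h) - T j| <= 4 * K / (1 + x) ^+ 2 * h ^+ (M.+1 - j).
  have := @taylor_bound R (- 2^-1) (M.+1 - j) (fun i => F (j + i)%N) x h (4 * K / (1 + x) ^+ 2).
  rewrite addn0 [`|h|]gtr0_norm//; apply; [ |lra|lra|].
    by move=> n y y2; rewrite addnS; exact: DF.
  move=> y y2 yx; rewrite subnKC; last exact: ltnW.
  by apply: (@decay_near_grid _ h) => //; rewrite [`|h|]gtr0_norm.
have ET : \sum_(j < M.+1) e j * (h ^+ j * T j) =
    \sum_(n < M.+1) (\sum_(i < n.+1) e i / (n - i)`!%:R) * (h ^+ n * F n x).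
  pose G (j n : nat) := e j / (n - j)`!%:R * (h ^+ n * F n x).
  transitivity (\sum_(j < M.+1) \sum_(i < M.+1 - j) G j (j + i)%N).
    apply: eq_bigr => j _; rewrite /T !mulr_sumr; apply: eq_bigr => i _.
    by rewrite /G addKn exprD; ring.
  by rewrite sum_triangle; apply: eq_bigr => n _; rewrite mulr_suml.
have -> : formal_sum h k - sg * formal_sum h k.+1 -
    \sum_(n < M.+1) r n * (h ^+ n * F n x) =
    - (sg * \sum_(j < M.+1) e j * (h ^+ j * (F j (x + h) - T j))).
  have -> : \sum_(n < M.+1) r n * (h ^+ n * F n x) =
      formal_sum h k - sg * \sum_(j < M.+1) e j * (h ^+ j * T j).
    rewrite ET mulr_sumr -sumrB; apply: eq_bigr => n _.
    by rewrite -er//; ring.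
  have -> : \sum_(j < M.+1) e j * (h ^+ j * (F j (x + h) - T j)) =
      formal_sum h k.+1 - \sum_(j < M.+1) e j * (h ^+ j * T j).
    by rewrite -sumrB; apply: eq_bigr => n _; rewrite xh; ring.
  by ring.
rewrite normrN normrM sg1 mul1r; apply: le_trans (ler_norm_sum _ _ _) _.
rewrite mulr_suml mulr_suml; apply: ler_sum => j _.
rewrite normrM -mulrA ler_wpM2l// normrM normrX gtr0_norm//.
apply: le_trans (ler_wpM2l _ (HT j)) _; first by rewrite exprn_ge0// ltW.
have -> : h ^+ M.+1 = h ^+ j * h ^+ (M.+1 - j) by rewrite -exprD subnKC// ltnW.
by apply: le_of_eq; ring.
Qed.

Lemma formal_sum_cvgy (h : R) : 0 < h -> formal_sum h k @[k --> \oo] --> 0.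
Proof.
move=> h0; rewrite [X in _ --> X](_ : 0 = \sum_(j < M.+1) e j * (h ^+ j * 0)); last first.
  by rewrite big1// => j _; rewrite !mulr0.
apply: cvg_sumr => j; apply: cvgM; first exact: cvg_cst.
apply: cvgM; first exact: cvg_cst.
have /cvg_pinftyP := Fy j; apply; apply/cvgryPge => A; near=> k.
rewrite mulrC -ler_pdivrMr//.
near: k; have /cvgryPge := @cvgr_idn R; exact.
Unshelve. all: by end_near. Qed.

(** The sums of [formal_sum h k - sg * formal_sum h k.+1] with the signs [sg ^ k]
    telescope; the errors are summable over the grid, at the price of one power
    of [h]. *)
Lemma summation_formula (K2 : R) : 0 <= K2 ->
  exists2 C : R, 0 <= C & forall (h : R) (V : nat -> R), 0 < h -> h <= 2^-1 ->
  (forall k, `|V k - \sum_(n < M.+1) r n * (h ^+ n * F n (h * k%:R))| <=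
     K2 * (h ^+ M.+1 / (1 + h * k%:R) ^+ 2)) ->
  exists2 S : R, series (fun k => sg ^+ k * V k) n @[n --> \oo] --> S &
    `|S - \sum_(j < M) e j * (h ^+ j * F j 0)| <= C * h ^+ M.
Proof.
move=> K20; pose C1 := (\sum_(j < M.+1) `|e j|) * (4 * K) + K2.
have C10 : 0 <= C1 by rewrite addr_ge0// mulr_ge0 ?sumr_ge0// mulr_ge0.
exists (C1 * 2 + `|e M * F M 0|); first by rewrite addr_ge0// mulr_ge0.
move=> h V h0 h2 HV.
pose D k := sg ^+ k * (V k - (formal_sum h k - sg * formal_sum h k.+1)).
have sgk k : `|sg ^+ k| = 1 by rewrite normrX sg1 expr1n.
have HD k : `|D k| <= C1 * h ^+ M * (h / (1 + h * k%:R) ^+ 2).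
  rewrite /D normrM sgk mul1r.
  have := HV k; have := formal_sum_step k h0 h2.
  set a := _ - sg * _; set b := \sum_(n < _) _; move=> H1 H2.
  have -> : V k - a = (V k - b) - (a - b) by ring.
  apply: le_trans (ler_normB _ _) _; apply: le_trans (lerD H2 H1) _.
  by rewrite /C1 exprSr; apply: le_of_eq; ring.
have [l Dl lC] : exists2 l, series D n @[n --> \oo] --> l & `|l| <= C1 * h ^+ M * (1 + h).
  apply: abs_summable_cvg => n; apply: le_trans (_ : _ <= C1 * h ^+ M * \sum_(k < n) h / (1 + h * k%:R) ^+ 2) _.
    by rewrite mulr_sumr; apply: ler_sum => k _; exact: HD.
  by rewrite ler_wpM2l ?sum_inv_sqr_le// mulr_ge0// exprn_ge0// ltW.
have E n : series (fun k => sg ^+ k * V k) n =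
    formal_sum h 0 - sg ^+ n * formal_sum h n + series D n.
  rewrite !seriesEord /=; elim: n => [|n IH].
    by rewrite !big_ord0 expr0 mul1r subrr addr0.
  by rewrite !big_ord_recr /= IH /D exprSr; ring.
have c0 : sg ^+ n * formal_sum h n @[n --> \oo] --> 0.
  have H := formal_sum_cvgy h0.
  have HN : `|formal_sum h n| @[n --> \oo] --> 0.
    by rewrite -[X in _ --> X](normr0 R); exact: cvg_norm.
  have HNN : - `|formal_sum h n| @[n --> \oo] --> 0.
    by rewrite -[X in _ --> X]oppr0; exact: cvgN.
  apply: (squeeze_cvgr _ HNN HN); near=> n; rewrite -ler_norml normrM sgk mul1r//.
exists (formal_sum h 0 - 0 + l).
  under eq_fun do rewrite E.
  by apply: cvgD => //; apply: cvgB => //; exact: cvg_cst.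
have -> : formal_sum h 0 - 0 + l - \sum_(j < M) e j * (h ^+ j * F j 0) =
    l + e M * F M 0 * h ^+ M.
  by rewrite /formal_sum mulr0 big_ord_recr /=; ring.
apply: le_trans (ler_normD _ _) _; rewrite mulrDl; apply: lerD.
  apply: le_trans lC _; rewrite mulrAC ler_wpM2r ?exprn_ge0 ?(ltW h0)//.
  by rewrite ler_wpM2l//; lra.
by rewrite normrM [X in _ * X]ger0_norm// exprn_ge0// ltW.
Unshelve. all: by end_near. Qed.

End Summation.

(** * The recursions behind Euler and Bernoulli polynomials *)

Lemma geometric_sum_le2 (R : realType) (q : R) (n : nat) : 0 <= q -> q <= 2^-1 ->
  \sum_(k < n) q ^+ k <= 2.
Proof.
move=> q0 q2; have H : \sum_(k < n) q ^+ k + 2 * q ^+ n <= 2.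
  elim: n => [|n IH]; first by rewrite big_ord0 add0r expr0 mulr1.
  rewrite big_ord_recr /= exprS; have := exprn_ge0 n q0; move: IH; nra.
have := exprn_ge0 n q0; move: H; lra.
Qed.

(** The terms are bounded at some point [s0], so the tail at [s <= s0 / 2] is
    dominated by a geometric series. *)
Lemma power_series_tail (R : realType) (e : nat -> R) (H : R -> R) (d : R) (M : nat) :
  0 < d ->
  (forall s, 0 < s -> s < d -> series (fun n => s ^+ n * e n) n @[n --> \oo] --> H s) ->
  exists C : R, exists2 d' : R, 0 < d' & d' <= d /\ forall s, 0 < s -> s < d' ->
    `|H s - \sum_(n < M) e n * s ^+ n| <= C * s ^+ M.
Proof.
move=> d0 HH; have [s0 s00 s0d] : exists2 s0 : R, 0 < s0 & s0 < d by exists (d / 2); lra.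
have [K K0 HK] : exists2 K : R, 0 <= K & forall n, `|s0 ^+ n * e n| <= K.
  have cv : cvgn (series (fun n => s0 ^+ n * e n)).
    by apply/cvg_ex; exists (H s0); exact: HH.
  have := cvg_series_cvg_0 cv => /cvgP /cvg_seq_bounded [K [_ HK]].
  exists (`|K| + 1); first by rewrite addr_ge0.
  by move=> n; apply: HK => //; rewrite ltr_pwDr// ler_norm.
exists (K * 2 / s0 ^+ M), (s0 / 2); first by lra.
split; first by lra.
move=> s sp sd; pose q := s / s0.
have q0 : 0 <= q by rewrite divr_ge0 ?ltW.
have q2 : q <= 2^-1 by rewrite ler_pdivrMr//; lra.
have sq n : `|s ^+ n * e n| <= K * q ^+ n.
  have -> : s ^+ n * e n = (s0 ^+ n * e n) * q ^+ n.
    by rewrite mulrAC -exprMn mulrC /q mulrCA divff ?mulr1 ?gt_eqF// mulrC.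
  by rewrite normrM [X in _ * X]ger0_norm ?exprn_ge0// ler_wpM2r ?exprn_ge0.
have B n : `|series (fun n => s ^+ n * e n) (M + n)%N - \sum_(n < M) e n * s ^+ n| <= K * 2 / s0 ^+ M * s ^+ M.
  rewrite seriesEord /= big_split_ord /=.
  under [X in _ - X]eq_bigr do rewrite mulrC.
  rewrite addrAC subrr add0r; apply: le_trans (ler_norm_sum _ _ _) _.
  apply: (@le_trans _ _ (\sum_(k < n) K * q ^+ M * q ^+ k)).
    by apply: ler_sum => k _; apply: le_trans (sq _) _; rewrite exprD mulrA.
  rewrite -mulr_sumr.
  have -> : K * 2 / s0 ^+ M * s ^+ M = K * q ^+ M * 2.
    by rewrite /q expr_div_n; move: (s ^+ M) (s0 ^+ M)^-1 => u v; ring.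
  by rewrite ler_wpM2l ?geometric_sum_le2// mulr_ge0// exprn_ge0.
have c1 : series (fun n => s ^+ n * e n) (M + n)%N @[n --> \oo] --> H s.
  under eq_fun do rewrite addnC.
  by have := HH s sp (lt_le_trans sd _); rewrite -(cvg_shiftn M); apply; lra.
have c2 : `|series (fun n => s ^+ n * e n) (M + n)%N - \sum_(n < M) e n * s ^+ n| @[n --> \oo] -->
    `|H s - \sum_(n < M) e n * s ^+ n|.
  by apply: cvg_norm; apply: cvgB => //; exact: cvg_cst.
by apply: (cvgr_to_le c2); near=> n; exact: B.
Unshelve. all: by end_near. Qed.

Lemma expR_taylor (R : realType) (w : R) (M : nat) : exists C : R, forall s, 0 < s -> s < 1 ->
  `|expR (s * w) - \sum_(n < M) w ^+ n / n`!%:R * s ^+ n| <= C * s ^+ M.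
Proof.
exists (expR `|w| * `|w| ^+ M) => s s0 s1.
have sw : `|s * w| <= `|w| by rewrite normrM gtr0_norm// ler_piMl// ltW.
have := @taylor_bound R (- `|w| - 1) M (fun=> expR) 0 (s * w) (expR `|w|).
rewrite add0r expR0.
have -> : \sum_(i < M) 1 * ((s * w) ^+ i / i`!%:R) = \sum_(n < M) w ^+ n / n`!%:R * s ^+ n.
  by apply: eq_bigr => i _; rewrite mul1r exprMn; ring.
rewrite -mulrA -exprMn normrM [`|s|]gtr0_norm// [_ * s]mulrC; apply.
- by have := normr_ge0 w; lra.
- by have := ler_norm (- (s * w)); rewrite normrN; lra.
- move=> y _; rewrite subr0 => yw; rewrite ger0_norm ?expR_ge0// ler_expR.
  apply: le_trans (ler_norm _) _; apply: le_trans yw _.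
  by move: sw; rewrite normrM [`|s|]gtr0_norm.
Qed.

Lemma horner_bounded01 (R : realType) (p : {poly R}) : exists2 C : R, 0 <= C &
  forall s, 0 < s -> s < 1 -> `|p.[s]| <= C.
Proof.
exists (\sum_(i < size p) `|p`_i|); first by apply: sumr_ge0.
move=> s s0 s1; have := @horner_le_pow _ p (size p) s 1 (leqnSn _) (lexx _).
by rewrite expr1n mulr1; apply; rewrite gtr0_norm// ltW.
Qed.

Lemma generating_recursion (R : realType) (e r : nat -> R) (sg d : R) (H rho : R -> R) :
  0 < d ->
  (forall s, 0 < s -> s < d -> series (fun n => s ^+ n * e n) n @[n --> \oo] --> H s) ->
  (forall s, 0 < s -> s < d -> H s * (1 - sg * expR s) = rho s) ->
  (forall M, exists C : R, forall s, 0 < s -> s < 1 ->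
     `|rho s - \sum_(n < M) r n * s ^+ n| <= C * s ^+ M) ->
  forall n, e n - sg * \sum_(i < n.+1) e i / (n - i)`!%:R = r n.
Proof.
move=> d0 HH Hrho rhoT n; pose M := n.+1.
have [C1 [d' d'0 [d'd H1]]] := power_series_tail M d0 HH.
have [C2 H2] := expR_taylor (1 : R) M.
have [C3 H3] := rhoT M.
pose P := \poly_(i < M) e i; pose Q := \poly_(i < M) (i`!%:R^-1 : R); pose T := \poly_(i < M) r i.
have [CP CP0 HP] := horner_bounded01 P.
have [CQ CQ0 HQ] := horner_bounded01 (1 - sg *: Q).
(* [P], [Q], [T] truncate [H], the exponential and [rho] *)
pose p := P - sg *: (P * Q) - T.
pose C := `|C1| * CQ + (CP + `|C1|) * (`|sg| * `|C2|) + `|C3|.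
have small : forall s, 0 < s -> s < Num.min d' 1 -> `|p.[s]| <= C * s ^+ M.
  move=> s s0; rewrite lt_min => /andP[sd s1].
  have z0 : 0 <= s ^+ M by rewrite exprn_ge0// ltW.
  have z1 : s ^+ M <= 1 by rewrite exprn_ile1// ltW.
  have E1 : `|H s - P.[s]| <= `|C1| * s ^+ M.
    rewrite horner_poly; apply: le_trans (H1 s s0 sd) _.
    by rewrite ler_wpM2r// ler_norm.
  have E2 : `|expR s - Q.[s]| <= `|C2| * s ^+ M.
    rewrite horner_poly; have := H2 s s0 s1; rewrite mulr1.
    under eq_bigr do rewrite expr1n mul1r.
    by move=> /le_trans; apply; rewrite ler_wpM2r// ler_norm.
  have E3 : `|rho s - T.[s]| <= `|C3| * s ^+ M.
    rewrite horner_poly; apply: le_trans (H3 s s0 s1) _.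
    by rewrite ler_wpM2r// ler_norm.
  have EQ := HQ s s0 s1; have EP := HP s s0 s1.
  have EH : `|H s| <= CP + `|C1|.
    have -> : H s = P.[s] + (H s - P.[s]) by ring.
    apply: le_trans (ler_normD _ _) _; apply: lerD => //; apply: le_trans E1 _.
    by rewrite ler_piMr.
  have sd2 : s < d by exact: lt_le_trans d'd.
  have -> : p.[s] = - ((H s - P.[s]) * (1 - sg *: Q).[s]) +
      H s * (sg * (expR s - Q.[s])) + (rho s - T.[s]).
    rewrite -Hrho// /p !(hornerD, hornerN, hornerM, hornerZ) hornerC; ring.
  apply: le_trans (ler_normD _ _) _; rewrite /C [leRHS]mulrDl; apply: lerD => //.
  apply: le_trans (ler_normD _ _) _; rewrite [leRHS]mulrDl normrN; apply: lerD.
    by rewrite normrM mulrAC; apply: ler_pM.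
  rewrite normrM -mulrA; apply: ler_pM => //.
  by rewrite normrM -mulrA ler_wpM2l.
have dm : 0 < Num.min d' 1 by rewrite lt_min d'0 ltr01.
have := poly_small_coef dm small (ltnSn n : (n < M)%N).
rewrite /p !coefB coefZ coefM !coef_poly ltnSn => /eqP; rewrite subr_eq0 => /eqP <-.
congr (_ - _ * _); apply: eq_bigr => i _.
rewrite !coef_poly ltn_ord ltnS leq_subr.
by [].
Qed.

(** The generating function at [- s] is [2 exp (s (1 + u)) / (1 + exp s)]. *)
Lemma Euler_recursion (R : realType) (E : nat -> R -> R) (u : R) : is_Euler E ->
  let e n := (-1) ^+ n * E n (- u) / n`!%:R in
  forall n, e n - (-1) * \sum_(i < n.+1) e i / (n - i)`!%:R = 2 * ((1 + u) ^+ n / n`!%:R).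
Proof.
move=> /(_ (- u)) /near_dnbhsP[d d0 HE] e.
pose H (s : R) := 2 * expR (- s * - u) / (expR (- s) + 1).
apply: (@generating_recursion _ e _ (-1) d H (fun s => 2 * expR (s * (1 + u)))) => //.
- move=> s s0 sd; have := HE (- s); rewrite subr0 normrN gtr0_norm// => /(_ sd).
  rewrite oppr_eq0 gt_eqF// => /(_ isT); rewrite -/(H s).
  suff -> : (fun n => (- s) ^+ n / n`!%:R * E n (- u)) = (fun n => s ^+ n * e n) by [].
  by apply/funext => n; rewrite /e (exprNn s); move: ((-1) ^+ n) (s ^+ n) (n`!%:R^-1) => x y z; ring.
- move=> s s0 sd; rewrite /H mulrNN (_ : s * (1 + u) = s + s * u); last by ring.
  rewrite expRD mulN1r opprK expRN.
  have p0 := expR_gt0 s; have p1 : (expR s)^-1 + 1 != 0 by rewrite gt_eqF// addr_gt0// invr_gt0.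
  by field; rewrite !gt_eqF//; lra.
- move=> M; have [C HC] := expR_taylor (1 + u) M; exists (2 * C) => s s0 s1.
  under eq_bigr do rewrite -mulrA.
  rewrite -mulr_sumr -mulrBr normrM [`|2|]ger0_norm// -mulrA ler_wpM2l//.
  exact: HC.
Qed.

(** The coefficients of [- s exp (s (1 + u))]. *)
Definition Bernoulli_rhs (R : realType) (u : R) (n : nat) : R :=
  if n is m.+1 then - ((1 + u) ^+ m / m`!%:R) else 0.

(** The generating function at [- s] is [s exp (s (1 + u)) / (exp s - 1)]. *)
Lemma Bernoulli_recursion (R : realType) (B : nat -> R -> R) (u : R) : is_Bernoulli B ->
  let e n := (-1) ^+ n * B n (- u) / n`!%:R in
  forall n, e n - 1 * \sum_(i < n.+1) e i / (n - i)`!%:R = Bernoulli_rhs u n.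
Proof.
move=> /(_ (- u)) /near_dnbhsP[d d0 HE] e.
pose H (s : R) := - s * expR (- s * - u) / (expR (- s) - 1).
apply: (@generating_recursion _ e _ 1 d H (fun s => - (s * expR (s * (1 + u))))) => //.
- move=> s s0 sd; have := HE (- s); rewrite subr0 normrN gtr0_norm// => /(_ sd).
  rewrite oppr_eq0 gt_eqF// => /(_ isT); rewrite -/(H s).
  suff -> : (fun n => (- s) ^+ n / n`!%:R * B n (- u)) = (fun n => s ^+ n * e n) by [].
  by apply/funext => n; rewrite /e (exprNn s); move: ((-1) ^+ n) (s ^+ n) (n`!%:R^-1) => x y z; ring.
- move=> s s0 sd; rewrite /H mulrNN (_ : s * (1 + u) = s + s * u); last by ring.
  rewrite expRD mul1r expRN.
  have p0 := expR_gt0 s; have p1 : 1 < expR s by rewrite expR_gt1.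
  have p2 : (expR s)^-1 - 1 != 0.
    by rewrite lt_eqF// subr_lt0 invf_lt1.
  have p3 : 1 - expR s != 0 by rewrite lt_eqF// subr_lt0.
  by field; rewrite mulN1r p3 gt_eqF.
- move=> [|M].
    exists (expR (`|1 + u|)) => s s0 s1; rewrite big_ord0 subr0 expr0 mulr1 normrN normrM.
    rewrite gtr0_norm// ger0_norm ?expR_ge0// -[leRHS]mul1r.
    apply: ler_pM; rewrite ?expR_ge0 ?(ltW s0) ?(ltW s1)//.
    rewrite ler_expR; apply: le_trans (ler_norm _) _.
    by rewrite normrM gtr0_norm// ler_piMl// ltW.
  have [C HC] := expR_taylor (1 + u) M; exists C => s s0 s1.
  rewrite big_ord_recl /= mul0r add0r.
  have -> : - (s * expR (s * (1 + u))) - \sum_(i < M) - ((1 + u) ^+ i / i`!%:R) * s ^+ (lift ord0 i)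
     = - (s * (expR (s * (1 + u)) - \sum_(n < M) (1 + u) ^+ n / n`!%:R * s ^+ n)).
    rewrite mulrBr opprB mulr_sumr -sumrN addrC; congr (_ - _).
    by apply: eq_bigr => i _; rewrite /= exprS; ring.
  rewrite normrN normrM gtr0_norm// exprS mulrCA ler_wpM2l ?(ltW s0)//.
  exact: HC.
Qed.

(** * Boole and Euler-Maclaurin summation; Taylor coefficients of [g] *)

Section SummationFormulas.
Context (R : realType) (F : nat -> R -> R) (M : nat) (K u : R).
Hypothesis DF : forall n (y : R), - 2^-1 < y -> is_derive y 1 (F n) (F n.+1 y).
Hypothesis FM : forall y : R, - 2^-1 < y -> `|F M.+1 y| <= K / (1 + y) ^+ 2.
Hypothesis Fy : forall n, F n y @[y --> +oo] --> 0.

Let K0 : 0 <= K.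
Proof.
have := le_trans (normr_ge0 _) (FM (y := 0) _); rewrite addr0 expr1n divr1.
by apply; lra.
Qed.

Let h0 : R := Num.min 2^-1 (4^-1 / (`|1 + u| + 1)).

Let h0_gt0 : 0 < h0.
Proof.
have := normr_ge0 (1 + u) => ?.
by rewrite lt_min divr_gt0//; lra.
Qed.

Lemma step_small (h : R) : 0 < h -> h < h0 ->
  h <= 2^-1 /\ `|h * (1 + u)| <= 4^-1.
Proof.
move=> hp; rewrite lt_min => /andP[h2 h4]; split; first exact: ltW.
have u0 := normr_ge0 (1 + u).
rewrite normrM gtr0_norm//; move: h4; rewrite ltr_pdivlMr; last by lra.
nra.
Qed.

Lemma taylor_at_grid (i m : nat) (h : R) (k : nat) : (i + m = M.+1)%N ->
  0 < h -> h < h0 ->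
  `|F i (h * (k%:R + 1 + u)) -
    \sum_(n < m) F (i + n)%N (h * k%:R) * ((h * (1 + u)) ^+ n / n`!%:R)| <=
  4 * K / (1 + h * k%:R) ^+ 2 * `|h * (1 + u)| ^+ m.
Proof.
move=> im hp hh; have [h2 hu] := step_small hp hh.
have x0 : 0 <= h * k%:R by rewrite mulr_ge0// ltW.
have -> : h * (k%:R + 1 + u) = h * k%:R + h * (1 + u) by ring.
have := @taylor_bound R (- 2^-1) m (fun n => F (i + n)%N) (h * k%:R) (h * (1 + u)) (4 * K / (1 + h * k%:R) ^+ 2).
rewrite addn0; apply.
- by move=> n y y2; rewrite addnS; exact: DF.
- by lra.
- by move: hu; rewrite ler_norml => /andP[? ?]; lra.
- move=> y y2 yx; rewrite im; apply: (decay_near_grid FM x0 _ y2 yx).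
  by apply: le_trans hu _; lra.
Qed.

(** Here [r (s) = 2 exp (s (1 + u))], and [exp (h (1 + u) D)] is the shift from
    [h k] to [h (k + 1 + u)]. *)
Lemma Boole_summation (E : nat -> R -> R) : is_Euler E ->
  exists C : R, exists2 d : R, 0 < d & forall h : R, 0 < h -> h < d ->
  exists2 S : R,
    series (fun k => (-1) ^+ k * (2 * F 0 (h * (k%:R + 1 + u)))) n @[n --> \oo] --> S &
    `|S - \sum_(j < M) (-1) ^+ j * E j (- u) / j`!%:R * (h ^+ j * F j 0)| <= C * h ^+ M.
Proof.
move=> /(Euler_recursion u) er.
have sg1 : `|-1 : R| = 1 by rewrite normrN1.
have K20 : 0 <= 2 * (4 * K * `|1 + u| ^+ M.+1) by rewrite !mulr_ge0// exprn_ge0.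
have [C C0 HC] := summation_formula sg1 DF FM Fy (fun n _ => er n) K20.
exists C, h0 => // h hp hh; have [h2 _] := step_small hp hh.
apply: HC => // k.
have T := @taylor_at_grid 0 M.+1 h k (erefl M.+1) hp hh.
have -> : 2 * F 0 (h * (k%:R + 1 + u)) -
    \sum_(n < M.+1) 2 * ((1 + u) ^+ n / n`!%:R) * (h ^+ n * F n (h * k%:R)) =
   2 * (F 0 (h * (k%:R + 1 + u)) -
    \sum_(n < M.+1) F n (h * k%:R) * ((h * (1 + u)) ^+ n / n`!%:R)).
  rewrite mulrBr mulr_sumr; congr (_ - _); apply: eq_bigr => n _.
  by rewrite exprMn; ring.
rewrite normrM [`|2|]ger0_norm// -!mulrA ler_wpM2l//.
apply: le_trans T _; rewrite normrM exprMn [`|h|]gtr0_norm//.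
by apply: le_of_eq; ring.
Qed.

(** Here [r (s) = - s exp (s (1 + u))]: besides the shift there is one
    differentiation, so the function that is summed is [F 1]. *)
Lemma Euler_Maclaurin_summation (B : nat -> R -> R) : is_Bernoulli B ->
  exists C : R, exists2 d : R, 0 < d & forall h : R, 0 < h -> h < d ->
  exists2 S : R,
    series (fun k => - (h * F 1 (h * (k%:R + 1 + u)))) n @[n --> \oo] --> S &
    `|S - \sum_(j < M) (-1) ^+ j * B j (- u) / j`!%:R * (h ^+ j * F j 0)| <= C * h ^+ M.
Proof.
move=> /(Bernoulli_recursion u) er.
have sg1 : `|1 : R| = 1 by rewrite normr1.
have K20 : 0 <= 4 * K * `|1 + u| ^+ M by rewrite !mulr_ge0// exprn_ge0.
have [C C0 HC] := summation_formula sg1 DF FM Fy (fun n _ => er n) K20.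
exists C, h0 => // h hp hh; have [h2 _] := step_small hp hh.
have [] := HC h (fun k => - (h * F 1 (h * (k%:R + 1 + u)))) hp h2.
  move=> k; have T := @taylor_at_grid 1 M h k (erefl M.+1) hp hh.
  have -> : - (h * F 1 (h * (k%:R + 1 + u))) -
      \sum_(n < M.+1) Bernoulli_rhs u n * (h ^+ n * F n (h * k%:R)) =
     - (h * (F 1 (h * (k%:R + 1 + u)) -
      \sum_(n < M) F n.+1 (h * k%:R) * ((h * (1 + u)) ^+ n / n`!%:R))).
    rewrite big_ord_recl /= mul0r add0r mulrBr mulr_sumr opprB -sumrN addrC; congr (_ - _).
    by apply: eq_bigr => n _; rewrite /= /bump /= add1n add0n exprS exprMn; ring.
  rewrite normrN normrM gtr0_norm//.
  apply: le_trans (ler_wpM2l (ltW hp) T) _; rewrite normrM exprMn [`|h|]gtr0_norm// (exprS h).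
  by apply: le_of_eq; ring.
move=> S HS HS2; exists S => //.
rewrite (_ : (fun k : nat => - _) = (fun k => 1 ^+ k * - (h * F 1 (h * (k%:R + 1 + u))))) //.
by apply/funext => k; rewrite expr1n mul1r.
Qed.

End SummationFormulas.

(** The [k]-th derivative at [0] of [y |-> (1 + y) ^ (- nu)]. *)
Definition binom_coef (R : realType) (nu : R) (k : nat) : R :=
  \prod_(j < k) (- (nu + j%:R)).

Lemma powR1p_taylor (R : realType) (nu : R) (K : nat) : 0 < nu -> exists C : R,
  forall y, 0 < y -> y <= 2^-1 ->
  `|(1 + y) `^ (- nu) - \sum_(k < K) binom_coef nu k / k`!%:R * y ^+ k| <= C * y ^+ K.
Proof.
move=> nu0; pose B := `|binom_coef nu K| * 2^-1 `^ (- (nu + K%:R)).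
exists B => y y0 y2.
pose F k y : R := binom_coef nu k * (1 + y) `^ (- (nu + k%:R)).
have DF n (z : R) : - 1 < z -> is_derive z 1 (F n) (F n.+1 z).
  move=> z1; have w0 : 0 < 1 + z by lra.
  have D1 : is_derive z 1 (fun t : R => 1 + t) 1.
    by have := is_deriveD (@is_derive_cst R R R 1 z 1) (@is_derive_id R R z 1); rewrite add0r.
  apply: (is_derive_ext (is_deriveZ (binom_coef nu n) (@is_derive1_comp _
    (fun t : R => t `^ (- (nu + n%:R))) (fun t : R => 1 + t) _ _ _ (is_derive1_powR _ w0) D1))) => //.
  rewrite /F /binom_coef big_ord_recr /= -natr1 /GRing.scale /= mulr1.
  have -> : - (nu + (n%:R + 1)) = - (nu + n%:R) - 1 by ring.
  ring.
have := @taylor_bound R (-1) K F 0 y B DF.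
rewrite add0r [X in `|X - _|]/F /binom_coef big_ord0 mul1r addr0 [`|y|]gtr0_norm//.
have -> : \sum_(i < K) F i 0 * (y ^+ i / i`!%:R) = \sum_(k < K) binom_coef nu k / k`!%:R * y ^+ k.
  by apply: eq_bigr => i _; rewrite /F addr0 powR1 mulr1; ring.
apply; [by lra|by lra|].
move=> z z1; rewrite subr0 => zy; rewrite /F normrM ler_wpM2l// ger0_norm ?powR_ge0//.
have := ler0n R K; have := ler_norm (- z); rewrite normrN => h1 h2.
by apply: powRN_anti; lra.
Qed.

Lemma binom_coef_Gamma (R : realType) (nu : R) (k : nat) : 0 < nu ->
  binom_coef nu k = (-1) ^+ k * (Gamma (nu + k%:R) / Gamma nu).
Proof.
move=> nu0; have G0 := Gamma_gt0 nu0.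
elim: k => [|k IH]; first by rewrite /binom_coef big_ord0 addr0 divff ?mulr1// gt_eqF.
rewrite /binom_coef big_ord_recr /= -/(binom_coef nu k) IH -natr1 addrA GammaS; last first.
  by rewrite ltr_pwDl.
by rewrite exprS; ring.
Qed.

(** Compare the Taylor polynomial of [g] with the one that results from the
    binomial expansion of [(1 + y) ^ (- mu - 1)] at [y = x ^ a]. *)
Lemma gder_nat_taylor_coef (R : realType) (c a : nat) (mu : R) (M : nat) :
  (0 < a)%N -> 0 < a%:R * (mu + 1) - c%:R -> forall n, (n < M)%N ->
  gder_nat c a mu n 0 / n`!%:R =
  \sum_(k < M) (n == k * a + c)%N%:R * (binom_coef (mu + 1) k / k`!%:R).
Proof.
move=> a0 de0 n nM.
have mu0 : 0 < mu + 1.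
  have A0 : 0 < a%:R :> R by rewrite ltr0n.
  have : 0 < a%:R * (mu + 1) by have := ler0n R c; lra.
  by rewrite pmulr_rgt0.
pose p1 := \poly_(i < M) (gder_nat c a mu i 0 / i`!%:R).
pose p2 := \sum_(k < M) (binom_coef (mu + 1) k / k`!%:R) *: 'X^(k * a + c).
have [C1 HC1] := powR1p_taylor M mu0.
have q1 : -1 < - 2^-1 :> R by lra.
have q0 : - 2^-1 <= 0 :> R by lra.
have [K K0 HK] := gder_nat_bound a0 de0 M q1 q0.
have dp : 0 < 2^-1 :> R by lra.
(* two polynomials that approximate [g] up to [O (x ^ M)] agree below degree [M] *)
suff small : forall x, 0 < x -> x < 2^-1 -> `|(p1 - p2).[x]| <= (K + `|C1|) * x ^+ M.
  have := poly_small_coef dp small nM; rewrite coefB coef_poly nM => /eqP.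
  rewrite subr_eq0 => /eqP ->; rewrite coef_sum; apply: eq_bigr => k _.
  by rewrite coefZ coefXn mulrC.
move=> x x0 x2.
have e1 : `|gder_nat c a mu 0 x - p1.[x]| <= K * x ^+ M.
  have := @taylor_bound R (-1) M (gder_nat c a mu) 0 x K _.
  move=> /(_ (fun n y => is_derive_gder_nat c mu a0 n (x := y))).
  rewrite add0r [`|x|]gtr0_norm//.
  have -> : \sum_(i < M) gder_nat c a mu i 0 * (x ^+ i / i`!%:R) = p1.[x].
    by rewrite horner_poly; apply: eq_bigr => i _; ring.
  apply; [by lra|by lra|].
  move=> y y1; rewrite subr0 => yx; have := ler_norm (- y); rewrite normrN => yn.
  have y2 : - 2^-1 <= y by lra.
  apply: le_trans (HK y y2) _; rewrite ler_piMr ?(ltW K0)//.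
  apply: powRN_le1; first by rewrite ler_pdivlMr; lra.
  by have := ler0n R M; lra.
have e2 : `|gder_nat c a mu 0 x - p2.[x]| <= `|C1| * x ^+ M.
  have xa0 : 0 < x ^+ a by exact: exprn_gt0.
  have xa2 : x ^+ a <= 2^-1.
    by apply: le_trans (ltW x2); rewrite -[leRHS]expr1; apply: ler_wiXn2l => //; lra.
  have -> : gder_nat c a mu 0 x - p2.[x] = x ^+ c * ((1 + x ^+ a) `^ (- (mu + 1)) -
      \sum_(k < M) binom_coef (mu + 1) k / k`!%:R * (x ^+ a) ^+ k).
    rewrite mulrBr mulr_sumr; congr (_ - _).
      by rewrite /gder_nat /= hornerXn addr0 [1 + _]addrC.
    rewrite /p2 horner_sum; apply: eq_bigr => k _.
    by rewrite hornerZ hornerXn exprD mulnC exprM; ring.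
  rewrite normrM ger0_norm ?exprn_ge0 ?(ltW x0)//.
  have cx : x ^+ c <= 1 by rewrite exprn_ile1//; lra.
  have H := le_trans (HC1 _ xa0 xa2) (ler_wpM2r (exprn_ge0 M (ltW xa0)) (ler_norm C1)).
  apply: le_trans (ler_pM (exprn_ge0 _ (ltW x0)) (normr_ge0 _) cx H) _.
  rewrite mul1r ler_wpM2l// -exprM; apply: ler_wiXn2l; rewrite ?(ltW x0)//; first by lra.
  by rewrite leq_pmull.
rewrite hornerD hornerN.
have -> : p1.[x] - p2.[x] = - (gder_nat c a mu 0 x - p1.[x]) + (gder_nat c a mu 0 x - p2.[x]) by ring.
by apply: le_trans (ler_normD _ _) _; rewrite normrN mulrDl; exact: lerD.
Qed.

Lemma sum_gder_nat_taylor (R : realType) (c a : nat) (mu : R) (N : nat) (w : nat -> R) :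
  (0 < a)%N -> 0 < a%:R * (mu + 1) - c%:R ->
  \sum_(n < (N * a + c).+1) w n * (gder_nat c a mu n 0 / n`!%:R) =
  \sum_(k < N.+1) w (k * a + c)%N * (binom_coef (mu + 1) k / k`!%:R).
Proof.
move=> a0 de0; set M := (N * a + c).+1.
under eq_bigr => n _ do rewrite (gder_nat_taylor_coef a0 de0 (ltn_ord n)) mulr_sumr.
rewrite exchange_big /=.
have NM : (N.+1 <= M)%N by rewrite ltnS (leq_trans (leq_pmulr N a0))// leq_addr.
rewrite [RHS](big_ord_widen M (fun k => w (k * a + c)%N * (binom_coef (mu + 1) k / k`!%:R)) NM).
rewrite [RHS]big_mkcond /=; apply: eq_bigr => k _.
case: ifPn => kN.
  have kM : (k * a + c < M)%N by rewrite ltnS leq_add2r leq_mul2r -ltnS kN orbT.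
  rewrite (bigD1 (Ordinal kM)) //= eqxx mul1r big1 ?addr0// => n nk.
  rewrite (_ : (n == k * a + c :> nat)%N = false) ?mul0r ?mulr0//.
  by apply: contraNF nk => /eqP E; apply/eqP/val_inj.
rewrite big1// => n _; rewrite (_ : (n == k * a + c :> nat)%N = false) ?mul0r ?mulr0//.
apply: contraNF kN => /eqP E; have := ltn_ord n.
by rewrite E /M !ltnS leq_add2r leq_mul2r eqn0Ngt a0.
Qed.

(** * Asymptotic expansions of the Mathieu series *)

Section Expansions.
Context (R : realType) (c a : nat) (mu : R).
Hypothesis a0 : (0 < a)%N.
Let de := a%:R * (mu + 1) - c%:R.
Hypothesis de0 : 0 < de.

Let mu0 : 0 < mu + 1.
Proof.
have A0 : 0 < a%:R :> R by rewrite ltr0n.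
have : 0 < a%:R * (mu + 1) by have := ler0n R c; move: de0; rewrite /de; lra.
by rewrite pmulr_rgt0.
Qed.

(** Homogeneity: divide [k + u] and [t] by [t]. *)
Lemma mathieu_term_scaled (t u : R) (k : nat) : 0 < t -> - t < k%:R + u ->
  mathieu_term t u c%:R a%:R mu k =
  2 * t `^ (- de) * gder_nat c a mu 0 (t^-1 * (k%:R + u)).
Proof.
move=> t0 kt; rewrite /mathieu_term !rpow_nat; set y := t^-1 * (k%:R + u).
have tn : t != 0 by rewrite gt_eqF.
have yE : k%:R + u = t * y by rewrite /y mulrA mulfV// mul1r.
have y1 : -1 < y by rewrite /y mulrC ltr_pdivlMr// mulN1r.
have w0 := Xn1_gt0 a0 y1.
have ta : t ^+ a = t `^ a%:R by rewrite powR_mulrn// ltW.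
have tc : t ^+ c = t `^ c%:R by rewrite powR_mulrn// ltW.
clearbody y; rewrite yE !exprMn.
have -> : t ^+ a * y ^+ a + t ^+ a = t ^+ a * (y ^+ a + 1) by rewrite mulrDr mulr1.
rewrite powRM ?exprn_ge0 ?(ltW t0) ?(ltW w0)// ta -powRrM tc.
rewrite /gder_nat /= hornerXn addr0 invfM -!powRN.
have -> : - de = c%:R + - (a%:R * (mu + 1)) by rewrite /de; ring.
by rewrite (powRD_gt0 _ _ t0); ring.
Qed.

Lemma alt_mathieu_psum_scaled (t u : R) : 0 < t -> `|u| < t ->
  alt_mathieu_psum t u c%:R a%:R mu = fun n =>
  t `^ (- de) * series (fun k => (-1) ^+ k * (2 * gder_nat c a mu 0 (t^-1 * (k%:R + 1 + u)))) n.
Proof.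
move=> t0 ut; apply/funext => n; rewrite /alt_mathieu_psum seriesEord /= big_add1 big_mkord mulr_sumr.
apply: eq_bigr => k _; rewrite mathieu_term_scaled//.
  by rewrite -[k.+1%:R]natr1 /=; ring.
by have := ler_norm (- u); rewrite normrN => ?; have := ler0n R k.+1; lra.
Qed.

Lemma mathieu_psum_scaled (t u : R) : 0 < t -> `|u| < t ->
  mathieu_psum t u c%:R a%:R mu = fun n =>
  - (2 * t `^ (1 - de)) * series (fun k => - (t^-1 * gder_nat c a mu 0 (t^-1 * (k%:R + 1 + u)))) n.
Proof.
move=> t0 ut; apply/funext => n; rewrite /mathieu_psum seriesEord /= big_add1 big_mkord mulr_sumr.
apply: eq_bigr => k _; rewrite mathieu_term_scaled//.
  rewrite (powRD_gt0 _ _ t0) powRr1 ?(ltW t0)// -[k.+1%:R]natr1 /=.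
  by field; rewrite gt_eqF.
by have := ler_norm (- u); rewrite normrN => ?; have := ler0n R k.+1; lra.
Qed.

Lemma gder_nat_decay2 (n : nat) : (1 < n)%N -> exists K : R,
  forall y : R, - 2^-1 < y -> `|gder_nat c a mu n y| <= K / (1 + y) ^+ 2.
Proof.
move=> n1; have q1 : -1 < - 2^-1 :> R by lra.
have q0 : - 2^-1 <= 0 :> R by lra.
have [K K0 HK] := gder_nat_bound a0 de0 n q1 q0; exists K => y y2.
apply: le_trans (HK y (ltW y2)) _; rewrite ler_wpM2l ?(ltW K0)//.
have y0 : 0 < 1 + y by lra.
have z0 : 0 < (1 + y) / (1 + - 2^-1) by rewrite divr_gt0//; lra.
have z1 : 1 <= (1 + y) / (1 + - 2^-1) by rewrite ler_pdivlMr; lra.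
have n2 : 2%:R <= n%:R :> R by rewrite ler_nat.
apply: (@le_trans _ _ (((1 + y) / (1 + - 2^-1)) `^ (- 2%:R))).
  by apply: ler_powR => //; rewrite lerN2; move: de0; rewrite /de; lra.
rewrite powR_invn ?(ltW z0)// lef_pV2 ?posrE ?exprn_gt0//.
by rewrite lerXn2r ?nnegrE ?(ltW y0) ?(ltW z0)// ler_pdivlMr; lra.
Qed.

Lemma little_o_of_bound (f : R -> R) (s C t0 : R) :
  (forall t, t0 < t -> `|f t| <= C * t `^ (- s - 1)) ->
  little_o_pinfty f (fun t => t `^ (- s)).
Proof.
move=> H eps eps0; near=> t.
have t00 : t0 < t by near: t; apply: nbhs_pinfty_gt; exact: num_real.
have tp : 0 < t by near: t; exact: nbhs_pinfty_gt.
have tC : C / eps <= t by near: t; apply: nbhs_pinfty_ge; exact: num_real.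
apply: le_trans (H t t00) _; rewrite [`|_ `^ _|]ger0_norm ?powR_ge0//.
rewrite (powRD_gt0 _ _ tp) powR_inv1 ?(ltW tp)// mulrCA mulrC ler_wpM2r ?powR_ge0//.
by rewrite ler_pdivrMr// mulrC -ler_pdivrMr.
Unshelve. all: by end_near. Qed.

Lemma powR_scale (t : R) (m : nat) : 0 < t ->
  t `^ (- de) * t^-1 ^+ m = t `^ (- (de + m%:R)).
Proof.
move=> t0; rewrite (opprD de m%:R) (powRD_gt0 _ _ t0); congr (_ * _).
by rewrite powR_invn ?(ltW t0)// exprVn.
Qed.

Lemma power_term (t : R) (k : nat) : 0 < t ->
  t `^ (- de) * t^-1 ^+ (k * a + c) = (t `^ (a%:R * (k%:R + mu + 1)))^-1.
Proof.
move=> t0; rewrite powR_scale// -powRN; congr (_ `^ (- _)).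
by rewrite /de natrD natrM; ring.
Qed.

Lemma remainder_exponent (N : nat) :
  - (de + (N * a + c).+1%:R) = - (a%:R * (N%:R + mu + 1)) - 1.
Proof. by rewrite /de -natr1 natrD natrM; ring. Qed.

Lemma sign_term (k : nat) : (-1) ^+ (k * (a + 1) + c) = (-1) ^+ (k * a + c) * (-1) ^+ k :> R.
Proof. by rewrite -exprD; congr (_ ^+ _); lia. Qed.

Lemma Gamma_ratio (k : nat) : Gamma (mu + k%:R + 1) / (Gamma (mu + 1) * Gamma (k%:R + 1)) =
  (-1) ^+ k * (binom_coef (mu + 1) k / k`!%:R).
Proof.
rewrite binom_coef_Gamma// Gamma_nat mulrA mulrA -exprD addnn -mul2n exprM sqrrN expr1n expr1n mul1r.
have -> : mu + k%:R + 1 = mu + 1 + k%:R by ring.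
by rewrite invfM mulrA.
Qed.

Lemma alt_mathieu_expansion (E : nat -> R -> R) (u : R) : is_Euler E ->
  (\forall t \near +oo, cvgn (alt_mathieu_psum t u c%:R a%:R mu)) /\
  asymptotic_expansion
    (fun t => alt_mathieu t u c%:R a%:R mu)
    (fun N t => \sum_(0 <= k < N.+1)
      (-1) ^+ (k * (a + 1) + c) / t `^ (a%:R * (k%:R + mu + 1)) *
      (Gamma (mu + k%:R + 1) * E (k * a + c)%N (- u) /
        (Gamma (mu + 1) * Gamma (k%:R + 1))))
    (fun N => a%:R * (N%:R + mu + 1)).
Proof.
move=> HE.
have main N : exists C : R, exists t0 : R, forall t, t0 < t ->
    exists2 S : R, alt_mathieu_psum t u c%:R a%:R mu n @[n --> \oo] --> S &
    `|S - \sum_(0 <= k < N.+1)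
      (-1) ^+ (k * (a + 1) + c) / t `^ (a%:R * (k%:R + mu + 1)) *
      (Gamma (mu + k%:R + 1) * E (k * a + c)%N (- u) /
        (Gamma (mu + 1) * Gamma (k%:R + 1)))| <=
    C * t `^ (- (a%:R * (N%:R + mu + 1)) - 1).
  pose M := (N * a + c).+1.
  have [K HK] := @gder_nat_decay2 M.+1 isT.
  have DF n (y : R) : - 2^-1 < y -> is_derive y 1 (gder_nat c a mu n) (gder_nat c a mu n.+1 y).
    by move=> y2; apply: is_derive_gder_nat => //; lra.
  have Fy n := @gder_nat_cvgy R c a mu a0 de0 n.
  have [C [d d0 HC]] := Boole_summation u DF HK Fy HE.
  (* [t > |u|] keeps all the points [(k + u) / t], [k >= 1], to the right of [-1] *)
  exists C, (Num.max `|u| d^-1) => t; rewrite gt_max => /andP[ut dt].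
  have t0 : 0 < t by exact: le_lt_trans ut.
  have td : t^-1 < d by rewrite invf_plt ?posrE.
  have tV0 : 0 < t^-1 by rewrite invr_gt0.
  have [S HS HSC] := HC t^-1 tV0 td.
  exists (t `^ (- de) * S).
    by rewrite alt_mathieu_psum_scaled//; apply: cvgM => //; exact: cvg_cst.
  have -> : \sum_(0 <= k < N.+1)
      (-1) ^+ (k * (a + 1) + c) / t `^ (a%:R * (k%:R + mu + 1)) *
      (Gamma (mu + k%:R + 1) * E (k * a + c)%N (- u) /
        (Gamma (mu + 1) * Gamma (k%:R + 1))) =
      t `^ (- de) * \sum_(j < M) (-1) ^+ j * E j (- u) / j`!%:R * (t^-1 ^+ j * gder_nat c a mu j 0).
    rewrite (_ : \sum_(j < M) _ = \sum_(j < M) (-1) ^+ j * E j (- u) * t^-1 ^+ j *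
        (gder_nat c a mu j 0 / j`!%:R)); last first.
      by apply: eq_bigr => j _; move: (t^-1 ^+ j) ((-1) ^+ j) => x y; ring.
    rewrite (sum_gder_nat_taylor N (fun j => (-1) ^+ j * E j (- u) * t^-1 ^+ j) a0 de0).
    rewrite big_mkord mulr_sumr; apply: eq_bigr => k _.
    rewrite -(power_term k t0) sign_term.
    rewrite [Gamma _ * _ / _]mulrAC Gamma_ratio.
    have s1 : (-1) ^+ k * (-1) ^+ k = 1 :> R by rewrite -exprMn mulrNN mul1r expr1n.
    set x := (-1) ^+ k in s1 *; set y := (-1) ^+ (k * a + c); set z := t `^ _; set v := t^-1 ^+ _.
    set q := binom_coef _ _ / _; rewrite -[RHS]mul1r -s1.
    move: x y z v q {s1} => x y z v q; ring.
  rewrite -mulrBr normrM ger0_norm ?powR_ge0//.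
  rewrite -remainder_exponent -/M -powR_scale// mulrCA ler_wpM2l ?powR_ge0//.
split.
  have [C [t0 H]] := main 0%N.
  near=> t; have tt0 : t0 < t by near: t; apply: nbhs_pinfty_gt; exact: num_real.
  by have [S HS _] := H t tt0; apply/cvg_ex; exists S.
move=> N; have [C [t0 H]] := main N; apply: (@little_o_of_bound _ _ C t0) => t /H[S HS].
by rewrite /alt_mathieu (cvg_lim (@Rhausdorff R) HS).
Unshelve. all: by end_near. Qed.

Lemma mathieu_expansion (B : nat -> R -> R) (u : R) : is_Bernoulli B -> 1 < de ->
  (\forall t \near +oo, cvgn (mathieu_psum t u c%:R a%:R mu)) /\
  asymptotic_expansion
    (fun t => mathieu t u c%:R a%:R mu)
    (fun N t =>
      (t `^ (a%:R * (mu + 1) - c%:R - 1))^-1 *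
        (2 / a%:R * Beta ((c%:R + 1) / a%:R) (mu + 1 - (c%:R + 1) / a%:R)) +
      \sum_(0 <= k < N.+1)
        (-1) ^+ (k * (a + 1) + c) / t `^ (a%:R * (k%:R + mu + 1)) *
        (2 * Gamma (mu + k%:R + 1) / (Gamma (mu + 1) * Gamma (k%:R + 1))) *
        (B (k * a + c + 1)%N (- u) / (k * a + c + 1)%:R))
    (fun N => a%:R * (N%:R + mu + 1)).
Proof.
move=> HB de1.
have [G [l [DG Gl]]] := primitive_gder_nat a0 de1.
have BE := Beta_primitive a0 de1 DG Gl.
(* the recursion at [n = 1], since the one at [n = 0] is trivial *)
have B0 : B 0%N (- u) = 1.
  have := Bernoulli_recursion u HB 1; rewrite /= big_ord_recl big_ord1 /=.
  have f1 : 1`!%:R = 1 :> R by [].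
  have f0 : 0`!%:R = 1 :> R by [].
  rewrite ?subn0 ?subnn ?f1 ?f0 /bump /=; lra.
pose F n : R -> R := if n is m.+1 then gder_nat c a mu m else fun x => G x - l.
have main N : exists C : R, exists t0 : R, forall t, t0 < t ->
    exists2 S : R, mathieu_psum t u c%:R a%:R mu n @[n --> \oo] --> S &
    `|S - ((t `^ (a%:R * (mu + 1) - c%:R - 1))^-1 *
        (2 / a%:R * Beta ((c%:R + 1) / a%:R) (mu + 1 - (c%:R + 1) / a%:R)) +
      \sum_(0 <= k < N.+1)
        (-1) ^+ (k * (a + 1) + c) / t `^ (a%:R * (k%:R + mu + 1)) *
        (2 * Gamma (mu + k%:R + 1) / (Gamma (mu + 1) * Gamma (k%:R + 1))) *
        (B (k * a + c + 1)%N (- u) / (k * a + c + 1)%:R))| <=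
    C * t `^ (- (a%:R * (N%:R + mu + 1)) - 1).
  pose M := (N * a + c).+1.
  have [K HK] := @gder_nat_decay2 M.+1 isT.
  have DF n (y : R) : - 2^-1 < y -> is_derive y 1 (F n) (F n.+1 y).
    move=> y2; case: n => [|n]; last by apply: is_derive_gder_nat => //; lra.
    have D1 : is_derive y 1 G (gder_nat c a mu 0 y) by apply: DG; lra.
    by have := is_deriveB D1 (@is_derive_cst R R R l y 1); rewrite subr0.
  have Fy n : F n y @[y --> +oo] --> 0.
    case: n => [|n]; last exact: gder_nat_cvgy.
    by rewrite -[X in _ --> X](subrr l); apply: cvgB => //; exact: cvg_cst.
  have [C [d d0 HC]] := @Euler_Maclaurin_summation R F M.+1 K u DF HK Fy B HB.
  exists (2 * C), (Num.max `|u| d^-1) => t; rewrite gt_max => /andP[ut dt].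
  have t0 : 0 < t by exact: le_lt_trans ut.
  have td : t^-1 < d by rewrite invf_plt ?posrE.
  have tV0 : 0 < t^-1 by rewrite invr_gt0.
  have [S HS HSC] := HC t^-1 tV0 td.
  exists (- (2 * t `^ (1 - de)) * S).
    by rewrite mathieu_psum_scaled//; apply: cvgM => //; exact: cvg_cst.
  have tE : t `^ (1 - de) = t * t `^ (- de) by rewrite (powRD_gt0 _ _ t0) powRr1// ltW.
  have -> : (t `^ (a%:R * (mu + 1) - c%:R - 1))^-1 *
        (2 / a%:R * Beta ((c%:R + 1) / a%:R) (mu + 1 - (c%:R + 1) / a%:R)) +
      \sum_(0 <= k < N.+1)
        (-1) ^+ (k * (a + 1) + c) / t `^ (a%:R * (k%:R + mu + 1)) *
        (2 * Gamma (mu + k%:R + 1) / (Gamma (mu + 1) * Gamma (k%:R + 1))) *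
        (B (k * a + c + 1)%N (- u) / (k * a + c + 1)%:R) =
      - (2 * t `^ (1 - de)) *
      \sum_(j < M.+1) (-1) ^+ j * B j (- u) / j`!%:R * (t^-1 ^+ j * F j 0).
    rewrite [in RHS]big_ord_recl [RHS]mulrDr; congr (_ + _).
      rewrite BE /= B0 !expr0 fact0 divr1 !mul1r -powRN opprB -/de.
      have -> : 2 / a%:R * (a%:R * (l - G 0)) = 2 * (l - G 0).
        by field; rewrite pnatr_eq0 -lt0n.
      by ring.
    rewrite (_ : \sum_(j < M) _ = - (t^-1 * \sum_(j < M)
        (-1) ^+ j * (B j.+1 (- u) / j.+1%:R) * t^-1 ^+ j * (gder_nat c a mu j 0 / j`!%:R))); last first.
      rewrite mulr_sumr -sumrN; apply: eq_bigr => j _; rewrite /= /bump /= add1n.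
      rewrite !exprS factS natrM invfM.
      by move: (t^-1 ^+ j) ((-1) ^+ j) t^-1 (j.+1%:R^-1 : R) (j`!%:R^-1 : R) => x y z v w; ring.
    rewrite (sum_gder_nat_taylor N (fun j => (-1) ^+ j * (B j.+1 (- u) / j.+1%:R) * t^-1 ^+ j) a0 de0).
    have -> : forall W, - (2 * t `^ (1 - de)) * - (t^-1 * W) = 2 * t `^ (- de) * W.
      by move=> W; rewrite tE; field; rewrite gt_eqF.
    rewrite big_mkord mulr_sumr; apply: eq_bigr => k _.
    rewrite -(power_term k t0) sign_term addn1.
    rewrite -[2 * Gamma _ / _]mulrA Gamma_ratio.
    have s1 : (-1) ^+ k * (-1) ^+ k = 1 :> R by rewrite -exprMn mulrNN mul1r expr1n.
    set x := (-1) ^+ k in s1 *; set y := (-1) ^+ (k * a + c); set z := t `^ _; set v := t^-1 ^+ _.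
    set q := binom_coef _ _ / _; set w := B _ _ / _; rewrite -[RHS]mul1r -s1.
    move: x y z v q w {s1} => x y z v q w; ring.
  rewrite -mulrBr normrM normrN [`|2 * _|]ger0_norm ?mulr_ge0 ?powR_ge0//.
  apply: le_trans (ler_wpM2l _ HSC) _; first by rewrite mulr_ge0 ?powR_ge0.
  rewrite -remainder_exponent -/M -powR_scale// tE exprS.
  have tn : t * t^-1 = 1 by rewrite mulfV// gt_eqF.
  apply: le_of_eq; rewrite -[RHS]mul1r -tn; move: t^-1 (t `^ (- de)) => x y; ring.
split.
  have [C [t0 H]] := main 0%N.
  near=> t; have tt0 : t0 < t by near: t; apply: nbhs_pinfty_gt; exact: num_real.
  by have [S HS _] := H t tt0; apply/cvg_ex; exists S.
move=> N; have [C [t0 H]] := main N; apply: (@little_o_of_bound _ _ C t0) => t /H[S HS].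
by rewrite /mathieu (cvg_lim (@Rhausdorff R) HS).
Unshelve. all: by end_near. Qed.

End Expansions.

(** * The theorem *)

Lemma regularity_half_line (R : realType) (ga al mu : R) (r : nat) :
  0 <= ga -> 0 < al -> 0 < al * (mu + 1) - ga ->
  (forall n, (n <= r)%N -> nonneg_exponents ga al mu n) ->
  (forall n, (n <= r)%N -> exists2 b : R, 0 < b &
     forall i, gcoef ga al mu n.+1 i != 0 -> b <= ga - n%:R + i%:R * al) ->
  let A : set R := `[0, +oo[%classic in
  (forall n, (n <= r)%N -> abs_continuous_ray 0 (rderiven A n (gfun ga al mu))) /\
  (forall n, (n <= r)%N ->
     [/\ Cn A n (gfun ga al mu),
         bounded_variation_ray 0 (rderiven A n (gfun ga al mu)) &
         forall k, (k <= n)%N -> rderiven A k (gfun ga al mu) x @[x --> +oo] --> 0]).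
Proof.
move=> ga0 al0 de0 Hn Hb A.
have ac n : (n <= r)%N -> abs_continuous_ray 0 (rderiven A n (gfun ga al mu)).
  move=> nr; apply: (@abs_continuous_ray_ext _ _ _ (gder_ray ga al mu n)).
    by move=> x x0; exact: (rderiven_gder_ray al0 Hn).
  by apply: gder_ray_abs_continuous => //; [exact: Hn|exact: Hb].
split=> // n nr; split.
- by apply: Cn_gder_ray => // j jn; apply: Hn; exact: leq_trans nr.
- by have [] := ac n nr.
- by move=> k kn; apply: (rderiven_gder_ray_cvgy ga0 al0 de0 Hn); exact: leq_trans nr.
Qed.

Unset Implicit Arguments.

Theorem theorem2p4 (R : realType) (gamma alpha mu : R)
    (gamma_ge0 : 0 <= gamma) (alpha_gt0 : 0 < alpha)
    (delta_gt0 : 0 < alpha * (mu + 1) - gamma) :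
  let delta := alpha * (mu + 1) - gamma in
  let g := gfun gamma alpha mu in
  (~ (gamma \is a Num.nat /\ alpha \is a Num.nat) ->
    let r := smooth_order gamma alpha in
    let A : set R := `[0, +oo[%classic in
    [/\ Cn A r g,
        ~ Cn A r.+1 g &
        forall n : nat, (n <= r)%N -> abs_continuous_ray 0 (rderiven A n g)] /\
    (gamma \isn't a Num.nat ->
      forall p : nat, (p <= r)%N -> rderiven A p g 0 = 0) /\
    (forall c : nat, gamma = c%:R -> alpha \isn't a Num.nat ->
      (forall p : nat, (p <= r)%N -> p <> c -> rderiven A p g 0 = 0) /\
      rderiven A c g 0 = c`!%:R) /\
    (forall n : nat, (n <= r)%N ->
      [/\ Cn A n g,
          bounded_variation_ray 0 (rderiven A n g) &
          forall k : nat, (k <= n)%N -> rderiven A k g x @[x --> +oo] --> 0]) /\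
    (1 < delta -> in_L_ray 0 g)) /\
  (forall c a : nat, gamma = c%:R -> alpha = a%:R ->
    (forall n : nat, Cn `]-1, +oo[%classic n g) /\
    (forall (q : R) (n : nat), -1 < q -> q < 0 ->
      let A : set R := `[q, +oo[%classic in
      [/\ Cn A n g,
          bounded_variation_ray q (rderiven A n g),
          forall k : nat, (k <= n)%N -> rderiven A k g x @[x --> +oo] --> 0 &
          abs_continuous_ray q (rderiven A n g)]) /\
    (forall E : nat -> R -> R, is_Euler E -> forall u : R,
      (\forall t \near +oo,
        cvgn (alt_mathieu_psum t u gamma alpha mu)) /\
      asymptotic_expansion
        (fun t => alt_mathieu t u gamma alpha mu)
        (fun N t => \sum_(0 <= k < N.+1)
          (-1) ^+ (k * (a + 1) + c) / t `^ (alpha * (k%:R + mu + 1)) *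
          (Gamma (mu + k%:R + 1) * E (k * a + c)%N (- u) /
            (Gamma (mu + 1) * Gamma (k%:R + 1))))
        (fun N => alpha * (N%:R + mu + 1))) /\
    (1 < delta ->
      (forall q : R, -1 < q -> q < 0 -> in_L_ray q g) /\
      (forall B : nat -> R -> R, is_Bernoulli B -> forall u : R,
        (\forall t \near +oo,
          cvgn (mathieu_psum t u gamma alpha mu)) /\
        asymptotic_expansion
          (fun t => mathieu t u gamma alpha mu)
          (fun N t =>
            (t `^ (alpha * (mu + 1) - gamma - 1))^-1 *
              (2 / alpha *
                Beta ((gamma + 1) / alpha) (mu + 1 - (gamma + 1) / alpha)) +
            \sum_(0 <= k < N.+1)
              (-1) ^+ (k * (a + 1) + c) / t `^ (alpha * (k%:R + mu + 1)) *
              (2 * Gamma (mu + k%:R + 1) / (Gamma (mu + 1) * Gamma (k%:R + 1))) *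
              (B (k * a + c + 1)%N (- u) / (k * a + c + 1)%:R))
          (fun N => alpha * (N%:R + mu + 1))))).
Proof.
move=> delta g; split.
  move=> notnat r A.
  have [gaN|gaN] := boolP (gamma \is a Num.nat).
    have alN : alpha \isn't a Num.nat by apply/negP => alN; apply: notnat.
    have gac : gamma = (Num.truncn gamma)%:R by rewrite truncnK.
    have rE : r = (Num.truncn gamma + Num.truncn alpha)%N by rewrite /r /smooth_order gaN.
    have Hn := @nonneg_exponents_nat R gamma alpha mu alpha_gt0 _ gac alN.
    have Hb := @gap_exists_nat R gamma alpha mu alpha_gt0 _ gac alN.
    rewrite -rE in Hn Hb.
    have [ac reg] := regularity_half_line gamma_ge0 alpha_gt0 delta_gt0 Hn Hb.
    split; [split|split; [|split; [|split]]] => //.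
    - by have [] := reg r (leqnn r).
    - by rewrite rE; exact: (not_Cn_nat gamma_ge0 alpha_gt0 delta_gt0 gac alN).
    - move=> c gaE _; have cE : Num.truncn gamma = c by rewrite gaE natrK.
      have val p : (p <= r)%N -> rderiven A p g 0 = if p == c then c`!%:R else 0.
        move=> pr; rewrite (rderiven_gder_ray alpha_gt0 Hn) //.
        rewrite (@gder_ray_at0_nat R gamma alpha mu alpha_gt0 _ gac alN) ?cE// -?cE -?rE//.
      split=> [p pr /eqP /negbTE pc|]; first by rewrite val// pc.
      by rewrite val ?eqxx// rE cE leq_addr.
    - by move=> de1; exact: in_L_gfun_half_line.
  have rE : r = Num.truncn gamma by rewrite /r /smooth_order (negbTE gaN).
  have Hn := @nonneg_exponents_frac R gamma alpha mu gamma_ge0 alpha_gt0 gaN.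
  have Hb := @gap_exists_frac R gamma alpha mu gamma_ge0 alpha_gt0 gaN.
  rewrite -rE in Hn Hb.
  have [ac reg] := regularity_half_line gamma_ge0 alpha_gt0 delta_gt0 Hn Hb.
  split; [split|split; [|split; [|split]]] => //.
  - by have [] := reg r (leqnn r).
  - by rewrite rE; exact: not_Cn_frac.
  - move=> _ p pr; rewrite (rderiven_gder_ray alpha_gt0 Hn) //.
    by apply: gder_ray_at0_frac; rewrite -?rE.
  - by move=> c gac; move: gaN; rewrite gac natr_nat.
  - by move=> de1; exact: in_L_gfun_half_line.
move=> c a gac ala.
have a0 : (0 < a)%N by move: alpha_gt0; rewrite ala ltr0n.
rewrite {}/g {}/delta; subst gamma alpha.
split; [|split; [|split]].
- move=> n; apply: Cn_gder_nat => // [x y|x] /=; rewrite !in_itv /= !andbT //.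
  exact: lt_le_trans.
- move=> q n q1 q0; pose A : set R := `[q, +oo[%classic; rewrite -/A.
  have uA : upclosed A by exact: upclosed_itvcy.
  have HA x : A x -> -1 < x by rewrite /A /= in_itv /= andbT; exact: lt_le_trans.
  have ext k x : q <= x -> rderiven A k (gfun c%:R a%:R mu) x = gder_nat c a mu k x.
    by move=> qx; apply: rderiven_gder_nat => //; rewrite /A /= in_itv /= qx.
  have ac : abs_continuous_ray q (rderiven A n (gfun c%:R a%:R mu)).
    apply: (abs_continuous_ray_ext (ext n)).
    by apply: gder_nat_abs_continuous => //; exact: ltW.
  split => //.
  + exact: Cn_gder_nat.
  + by have [] := ac.
  move=> k _; have := @gder_nat_cvgy R c a mu a0 delta_gt0 k.
  apply: cvg_trans; apply: near_eq_cvg; near=> x.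
  rewrite ext//; near: x; apply: nbhs_pinfty_ge; exact: num_real.
- by move=> E HE u; exact: alt_mathieu_expansion.
- move=> de1; split.
    by move=> q q1 q0; apply: in_L_gfun_ray => //; exact: ltW.
  by move=> B HB u; exact: mathieu_expansion.
Unshelve. all: by end_near. Qed.
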